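(* Let $\mathcal{J}$ be a set of $n$ jobs (each job is a time interval $[s_j, s_j+l_j]$ with $s_j \ge 0$, $l_j \ge 1$ and unit reward). For any $\varepsilon > 0$, there exists a fully dynamic algorithm for $(1+\varepsilon)$-approximate unweighted interval scheduling of $\mathcal{J}$ on a single machine that performs updates (insertions and deletions of jobs) in $O\left(\frac{\log n}{\varepsilon}\right)$ worst-case time and queries in $O(\log n)$ worst-case time.
   Context: Interval scheduling on $M$ machines: each job $j$ has a start time $s_j\ge 0$, a length $l_j\ge 1$ (it occupies the time interval $[s_j,s_j+l_j]$) and a reward $w_j>0$; a feasible schedule assigns a subset of the jobs to the $M$ machines so that jobs assigned to the same machine pairwise do not overlap in time; the goal is to maximize the total reward of the scheduled jobs. In the unweighted case all rewards equal $1$. A solution is $\alpha$-approximate if its reward is at least $1/\alpha$ times the optimum. A fully dynamic algorithm maintains a feasible solution while jobs are inserted and deleted, and supports queries asking whether a given job is in the maintained solution (and the value of the maintained solution). *)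

(* Defs.v *)
From HB Require Import structures.
From mathcomp Require Import all_boot all_order all_algebra.
From mathcomp Require Import finmap.
From mathcomp Require Import reals exp.

Set Implicit Arguments.
Unset Strict Implicit.
Unset Printing Implicit Defensive.

Import Order.TTheory GRing.Theory Num.Theory.

Local Open Scope ring_scope.
Local Open Scope fset_scope.

(* [label] distinguishes jobs that occupy the same time interval. *)
Record job (R : Type) := Job { label : nat; start : R; len : R }.

Definition tuple_of_job (R : Type) (j : job R) := (label j, start j, len j).

Definition job_of_tuple (R : Type) (x : nat * R * R) :=
  Job x.1.1 x.1.2 x.2.

Lemma tuple_of_jobK (R : Type) :
  cancel (@tuple_of_job R) (@job_of_tuple R).
Proof. by case. Qed.

HB.instance Definition _ (R : choiceType) :=
  Choice.copy (job R) (can_type (@tuple_of_jobK R)).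

Definition finish (R : realType) (j : job R) : R := start j + len j.

Definition job_ok (R : realType) (j : job R) : bool :=
  (0 <= start j) && (1 <= len j).

(* A job may start at the very moment at which another one finishes. *)
Definition overlap (R : realType) (i j : job R) : bool :=
  (start i < finish j) && (start j < finish i).

Definition nonoverlapping (R : realType) (S : {fset job R}) : bool :=
  [forall i : S, forall j : S,
     (val i != val j) ==> ~~ overlap (val i) (val j)].

Definition feasible (R : realType) (J S : {fset job R}) : bool :=
  (S `<=` J) && nonoverlapping S.

(* With unit rewards the reward of a schedule is its cardinality. *)
Definition opt (R : realType) (J : {fset job R}) : nat :=
  \max_(S <- fpowerset J | feasible J S) #|` S|.

Definition approximate (R : realType) (alpha : R) (J S : {fset job R}) : Prop :=
  feasible J S /\ (opt J)%:R / alpha <= (#|` S|)%:R.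

(* The memory has an integer part (data and addresses) and a real part (times).
   On reals only addition, subtraction and comparison are available: there is
   no rounding and no conversion from reals to integers.  On integers only
   addition, truncated subtraction and comparison are available. *)
Record memory (R : Type) := Memory { ncell : nat -> nat; rcell : nat -> R }.

Definition set_ncell (R : Type) (m : memory R) (a v : nat) : memory R :=
  Memory (fun b => if b == a then v else ncell m b) (rcell m).

Definition set_rcell (R : Type) (m : memory R) (a : nat) (v : R) : memory R :=
  Memory (ncell m) (fun b => if b == a then v else rcell m b).

Definition blank (R : realType) : memory R :=
  Memory (fun=> 0%N) (fun=> 0).

Inductive nexp : Type :=
| NConst of nat
| NRead of nexp
| NAdd of nexp & nexp
| NSub of nexp & nexp.

Inductive rexp : Type :=
| RRead of nexp
| RAdd of rexp & rexp
| RSub of rexp & rexp.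

Inductive bexp : Type :=
| BNEq of nexp & nexp
| BNLe of nexp & nexp
| BREq of rexp & rexp
| BRLe of rexp & rexp
| BNot of bexp
| BAnd of bexp & bexp.

Inductive cmd : Type :=
| Skip
| NWrite of nexp & nexp
| RWrite of nexp & rexp
| Seq of cmd & cmd
| If of bexp & cmd & cmd
| While of bexp & cmd.

Section Semantics.
Variable R : realType.
Implicit Types m : memory R.

Fixpoint neval m (e : nexp) : nat :=
  match e with
  | NConst k => k
  | NRead a => ncell m (neval m a)
  | NAdd e1 e2 => (neval m e1 + neval m e2)%N
  | NSub e1 e2 => (neval m e1 - neval m e2)%N
  end.

Fixpoint reval m (e : rexp) : R :=
  match e with
  | RRead a => rcell m (neval m a)
  | RAdd e1 e2 => reval m e1 + reval m e2
  | RSub e1 e2 => reval m e1 - reval m e2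
  end.

Fixpoint beval m (b : bexp) : bool :=
  match b with
  | BNEq e1 e2 => neval m e1 == neval m e2
  | BNLe e1 e2 => (neval m e1 <= neval m e2)%N
  | BREq e1 e2 => reval m e1 == reval m e2
  | BRLe e1 e2 => reval m e1 <= reval m e2
  | BNot b1 => ~~ beval m b1
  | BAnd b1 b2 => beval m b1 && beval m b2
  end.

(* One unit of time per node of an evaluated expression. *)
Fixpoint ncost (e : nexp) : nat :=
  match e with
  | NConst _ => 1
  | NRead a => (ncost a).+1
  | NAdd e1 e2 | NSub e1 e2 => (ncost e1 + ncost e2).+1
  end.

Fixpoint rcost (e : rexp) : nat :=
  match e with
  | RRead a => (ncost a).+1
  | RAdd e1 e2 | RSub e1 e2 => (rcost e1 + rcost e2).+1
  end.

Fixpoint bcost (b : bexp) : nat :=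
  match b with
  | BNEq e1 e2 | BNLe e1 e2 => (ncost e1 + ncost e2).+1
  | BREq e1 e2 | BRLe e1 e2 => (rcost e1 + rcost e2).+1
  | BNot b1 => (bcost b1).+1
  | BAnd b1 b2 => (bcost b1 + bcost b2).+1
  end.

(* [exec c m m' t]: started in memory [m], the program [c] halts after [t] units
   of time, leaving memory [m']. *)
Inductive exec : cmd -> memory R -> memory R -> nat -> Prop :=
| ExecSkip m : exec Skip m m 1
| ExecNWrite m a e :
    exec (NWrite a e) m (set_ncell m (neval m a) (neval m e))
      (ncost a + ncost e).+1
| ExecRWrite m a e :
    exec (RWrite a e) m (set_rcell m (neval m a) (reval m e))
      (ncost a + rcost e).+1
| ExecSeq c1 c2 m m1 m2 t1 t2 :
    exec c1 m m1 t1 -> exec c2 m1 m2 t2 -> exec (Seq c1 c2) m m2 (t1 + t2)%N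
| ExecIfTrue b c1 c2 m m' t :
    beval m b -> exec c1 m m' t -> exec (If b c1 c2) m m' (bcost b + t).+1
| ExecIfFalse b c1 c2 m m' t :
    ~~ beval m b -> exec c2 m m' t -> exec (If b c1 c2) m m' (bcost b + t).+1
| ExecWhileTrue b c m m1 m2 t1 t2 :
    beval m b -> exec c m m1 t1 -> exec (While b c) m1 m2 t2 ->
    exec (While b c) m m2 (bcost b + t1 + t2).+1
| ExecWhileFalse b c m :
    ~~ beval m b -> exec (While b c) m m (bcost b).+1.

End Semantics.

Inductive request (R : Type) : Type :=
| Insert of job R
| Delete of job R
| Member of job R
| Value.
Arguments Value {R}.

Record dynamic_algorithm := DynamicAlgorithm {
  insert_prog : cmd;
  delete_prog : cmd;
  member_prog : cmd;
  value_prog : cmd }.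

Section Dynamic.
Variable R : realType.
Implicit Types (m : memory R) (J S : {fset job R}) (q : request R).

Definition prog (A : dynamic_algorithm) q : cmd :=
  match q with
  | Insert _ => insert_prog A
  | Delete _ => delete_prog A
  | Member _ => member_prog A
  | Value => value_prog A
  end.

Definition put_job m (j : job R) : memory R :=
  set_rcell (set_rcell (set_ncell m 0 (label j)) 0 (start j)) 1 (len j).

(* The job concerned is passed in integer cell 0 and real cells 0 and 1; the
   rest of the memory is as the previous request left it. *)
Definition input m q : memory R :=
  match q with
  | Insert j | Delete j | Member j => put_job m j
  | Value => m
  end.

Definition admissible J q : bool :=
  match q with
  | Insert j => job_ok j && (j \notin J)
  | Delete j => j \in J
  | Member j => job_ok j
  | Value => true
  end.

Definition update J q : {fset job R} :=
  match q with
  | Insert j => j |` J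
  | Delete j => J `\ j
  | Member _ | Value => J
  end.

Definition is_update q : bool :=
  match q with
  | Insert _ | Delete _ => true
  | Member _ | Value => false
  end.

(* [reachable A m J]: some sequence of requests, issued from the empty set of
   jobs and a blank memory, leads to the set of jobs [J] and the memory [m]. *)
Inductive reachable (A : dynamic_algorithm) :
    memory R -> {fset job R} -> Prop :=
| ReachBlank : reachable A (blank R) fset0
| ReachStep m J q m' t :
    reachable A m J -> admissible J q -> exec (prog A q) (input m q) m' t ->
    reachable A m' (update J q).

(* The answer to a query is left in integer cell 0. *)
Definition answers S q (a : nat) : Prop :=
  match q with
  | Member j => a = (j \in S)
  | Value => a = #|` S|
  | Insert _ | Delete _ => True
  end.

(* The number of jobs involved in a request: an insertion counts the new job,
   a deletion the job to be deleted. *)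
Definition njobs J q : nat := maxn #|` J| #|` update J q|.

(* [sol m] is the solution represented by the memory [m]; all queries are
   answered according to it and only updates may change it. *)
Definition fully_dynamic (alpha : R) (Tupdate Tquery : nat -> nat)
    (A : dynamic_algorithm) : Prop :=
  exists sol : memory R -> {fset job R},
  forall m J, reachable A m J ->
    approximate alpha J (sol m) /\
    forall q, admissible J q ->
      exists m' t, exec (prog A q) (input m q) m' t /\
        (t <= (if is_update q then Tupdate else Tquery) (njobs J q))%N /\
        (~~ is_update q -> sol m' = sol m /\ answers (sol m) q (ncell m' 0)).

End Dynamic.

Definition bigO_n (R : realType) (T : nat -> nat) (g : nat -> R) : Prop :=
  exists C : R, forall n : nat, (2 <= n)%N -> (T n)%:R <= C * g n.

(* The constant is uniform in [n] and in [eps], as long as [eps] stays bounded.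
   Boundedness is needed: log n / eps tends to 0 as eps grows, whereas every
   operation takes at least one unit of time. *)
Definition bigO_eps_n (R : realType) (T : R -> nat -> nat) (g : R -> nat -> R) :
    Prop :=
  forall E : R, 0 < E ->
  exists C : R, forall (eps : R) (n : nat),
    0 < eps -> eps <= E -> (2 <= n)%N -> (T eps n)%:R <= C * g eps n.

(* Main.v *)
Require Import Defs.
From HB Require Import structures.
From mathcomp Require Import all_boot all_order all_algebra.
From mathcomp Require Import finmap zify boolp.
From mathcomp Require Import reals exp.

(* Time is cut by borders into regions, and in each region the greedy schedule
   (always the job that finishes first) is maintained.  An optimal schedule
   loses at most one job per border, namely the job that crosses it, so if every
   region but the last holds between K and 2K greedy jobs, K >= 1/eps, the union
   of the greedy schedules is (1 + eps)-approximate.  An update changes the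
   greedy schedule of one region only, by at most one job; the region is walked
   again, merged with the next one if it has become too small, and cut after its
   K-th greedy job if it has become too large.

   Jobs and borders (jobs of length 0) are the leaves of a single AVL tree,
   ordered by start, length and label, whose nodes point to the leaf that
   finishes first, to the last border and to the last leaf below, and count the
   scheduled jobs below.  One descent thus yields the next greedy job after a
   given time, or the border that ends the region, as well as the border before
   a given job.  Nodes are never modified: updates copy the path to the root, so
   that what a pointer represents never changes.  The blank memory is the tree
   with a single leaf, the border at time 0, stored at address 0. *)

Set Implicit Arguments.
Unset Strict Implicit.
Unset Printing Implicit Defensive.

Import Order.TTheory GRing.Theory Num.Theory.

Local Open Scope ring_scope.

(** * Straight-line code and loops over an append-only heap *)

(** A region is walked afresh rather than repaired because one new job may shift every later greedy
    choice in it; with at most 3K choices, each costing a constant number of descents, a full walk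
    already fits the bound in the worst case. Marks stay exact because they are cleared first: the
    old schedule is erased before the change, the region is then walked with mark 0 merely to be
    measured, and only the last walk writes 1, once merging is settled. The sizes close up as
    follows. Greedy being optimal inside a region, one update raises 2K to at most 2K + 1. A merge
    joins at most K - 1 and 2K jobs and gains at most one job across the removed border, so 3K is
    never exceeded. A cut after the K-th job then leaves at most 2K, and the walk resumes at the cut
    as if nothing had happened. The lower bound K serves twice: for the ratio, and to keep borders
    from outnumbering jobs by more than one, so that the height is logarithmic in n. As the machine
    has no real constants, zero is written x - x and a border is recognized by start + length =
    start. *)

Definition nregs := 32%N.
Notation rHP := 1%N (only parsing).

Inductive aexp : Type :=
| ACst of nat
| AReg of nat
| AFld of nat & aexp
| AAdd of aexp & aexp
| ASub of aexp & aexp.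

Inductive xexp : Type :=
| XReg of nat
| XFld of nat & aexp
| XAdd of xexp & xexp
| XSub of xexp & xexp.

Inductive test : Type :=
| TNEq of aexp & aexp
| TNLe of aexp & aexp
| TREq of xexp & xexp
| TRLe of xexp & xexp
| TNot of test
| TAnd of test & test.

(* The only heap write is the allocation [CNew ns xs] of a block of 8 cells, at
   the address [rHP] is advanced to, holding the registers [ns] and [xs]. *)
Inductive code : Type :=
| CSkip
| CSetN of nat & aexp
| CSetR of nat & xexp
| CSel of nat & test & aexp & aexp
| CNew of seq nat & seq nat
| CSeq of code & code
| CIf of test & code & code
| CWhile of test & code.

Fixpoint acomp (e : aexp) : nexp :=
  match e with
  | ACst k => NConst k
  | AReg r => NRead (NConst r)
  | AFld k e => NRead (NAdd (NConst (nregs + k)) (acomp e))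
  | AAdd e1 e2 => NAdd (acomp e1) (acomp e2)
  | ASub e1 e2 => NSub (acomp e1) (acomp e2)
  end.

Fixpoint xcomp (e : xexp) : rexp :=
  match e with
  | XReg r => RRead (NConst r)
  | XFld k e => RRead (NAdd (NConst (nregs + k)) (acomp e))
  | XAdd e1 e2 => RAdd (xcomp e1) (xcomp e2)
  | XSub e1 e2 => RSub (xcomp e1) (xcomp e2)
  end.

Fixpoint tcomp (t : test) : bexp :=
  match t with
  | TNEq e1 e2 => BNEq (acomp e1) (acomp e2)
  | TNLe e1 e2 => BNLe (acomp e1) (acomp e2)
  | TREq e1 e2 => BREq (xcomp e1) (xcomp e2)
  | TRLe e1 e2 => BRLe (xcomp e1) (xcomp e2)
  | TNot t1 => BNot (tcomp t1)
  | TAnd t1 t2 => BAnd (tcomp t1) (tcomp t2)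
  end.

Definition hp_cell (k : nat) : nexp :=
  NAdd (NConst (nregs + k)) (NRead (NConst rHP)).

Fixpoint nputs (k : nat) (ns : seq nat) : cmd :=
  if ns is r :: ns' then
    Seq (NWrite (hp_cell k) (NRead (NConst r))) (nputs k.+1 ns')
  else Skip.

Fixpoint rputs (k : nat) (xs : seq nat) : cmd :=
  if xs is r :: xs' then
    Seq (RWrite (hp_cell k) (RRead (NConst r))) (rputs k.+1 xs')
  else Skip.

(** The pointer is advanced before the block is written, because at [rHP] = 0 the block at address 0
    is already taken by the first border. A block can thus store its own address. *)
Definition hp_bump : cmd :=
  NWrite (NConst rHP) (NAdd (NRead (NConst rHP)) (NConst 8)).

Fixpoint compile (c : code) : cmd :=
  match c with
  | CSkip => Skip
  | CSetN r e => NWrite (NConst r) (acomp e)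
  | CSetR r e => RWrite (NConst r) (xcomp e)
  | CSel r t e1 e2 =>
      If (tcomp t) (NWrite (NConst r) (acomp e1)) (NWrite (NConst r) (acomp e2))
  | CNew ns xs => Seq hp_bump (Seq (nputs 0 ns) (rputs 0 xs))
  | CSeq c1 c2 => Seq (compile c1) (compile c2)
  | CIf t c1 c2 => If (tcomp t) (compile c1) (compile c2)
  | CWhile t c => While (tcomp t) (compile c)
  end.

Fixpoint awf (e : aexp) : bool :=
  match e with
  | ACst _ => true
  | AReg r => (r < nregs)%N
  | AFld _ e => awf e
  | AAdd e1 e2 | ASub e1 e2 => awf e1 && awf e2
  end.

Fixpoint xwf (e : xexp) : bool :=
  match e with
  | XReg r => (r < nregs)%N
  | XFld _ e => awf e
  | XAdd e1 e2 | XSub e1 e2 => xwf e1 && xwf e2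
  end.

Fixpoint twf (t : test) : bool :=
  match t with
  | TNEq e1 e2 | TNLe e1 e2 => awf e1 && awf e2
  | TREq e1 e2 | TRLe e1 e2 => xwf e1 && xwf e2
  | TNot t1 => twf t1
  | TAnd t1 t2 => twf t1 && twf t2
  end.

Definition regs_ok (s : seq nat) : bool :=
  (size s <= 8)%N && all (fun r => r < nregs)%N s.

Fixpoint loopfree (c : code) : bool :=
  match c with
  | CSkip => true
  | CSetN r e => [&& r < nregs, r != rHP & awf e]%N
  | CSetR r e => (r < nregs)%N && xwf e
  | CSel r t e1 e2 => [&& r < nregs, r != rHP, twf t, awf e1 & awf e2]%N
  | CNew ns xs => regs_ok ns && regs_ok xs
  | CSeq c1 c2 => loopfree c1 && loopfree c2
  | CIf t c1 c2 => [&& twf t, loopfree c1 & loopfree c2]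
  | CWhile _ _ => false
  end.

Fixpoint nputs_cost (ns : seq nat) : nat :=
  if ns is _ :: ns' then (7 + nputs_cost ns')%N else 1%N.

(** Only an upper bound: the costs of both branches of a conditional are added, which avoids maxima.
    Loops get a junk value, as [loopfree] rules them out. *)
Fixpoint maxcost (c : code) : nat :=
  match c with
  | CSkip => 1
  | CSetN r e => (1 + ncost (acomp e)).+1
  | CSetR r e => (1 + rcost (xcomp e)).+1
  | CSel r t e1 e2 =>
      (bcost (tcomp t) + ((1 + ncost (acomp e1)).+1 + (1 + ncost (acomp e2)).+1)).+1
  | CNew ns xs => (6 + (nputs_cost ns + nputs_cost xs))
  | CSeq c1 c2 => maxcost c1 + maxcost c2
  | CIf t c1 c2 => (bcost (tcomp t) + (maxcost c1 + maxcost c2)).+1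
  | CWhile _ _ => 0
  end%N.

Section Machine.
Variable R : realType.

Record state := State {
  nreg : nat -> nat;
  rreg : nat -> R;
  nheap : nat -> nat;
  rheap : nat -> R }.
Implicit Types s : state.

Definition mem_of s : memory R := Memory
  (fun a => if (a < nregs)%N then nreg s a else nheap s (a - nregs))
  (fun a => if (a < nregs)%N then rreg s a else rheap s (a - nregs)).

Definition state_of (m : memory R) : state :=
  State (ncell m) (rcell m) (fun a => ncell m (nregs + a))
    (fun a => rcell m (nregs + a)).

Lemma state_ofK m : mem_of (state_of m) = m.
Proof.
case: m => n r; rewrite /mem_of /=; congr Memory; apply: funext => a;
  by case: ltnP => // h; rewrite subnKC.
Qed.

Definition upd (T : Type) (f : nat -> T) (a : nat) (v : T) : nat -> T :=
  fun b => if b == a then v else f b.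

Definition set_nreg s r v := State (upd (nreg s) r v) (rreg s) (nheap s) (rheap s).
Definition set_rreg s r v := State (nreg s) (upd (rreg s) r v) (nheap s) (rheap s).

Definition write_block (T : Type) (h : nat -> T) (p : nat) (f : nat -> T)
    (ns : seq nat) : nat -> T :=
  fun a => if (p <= a < p + size ns)%N then f (nth 0%N ns (a - p)) else h a.

Definition alloc s (ns xs : seq nat) : state :=
  let s' := set_nreg s rHP (nreg s rHP + 8)%N in
  State (nreg s') (rreg s')
    (write_block (nheap s) (nreg s' rHP) (nreg s') ns)
    (write_block (rheap s) (nreg s' rHP) (rreg s') xs).

Fixpoint aval s (e : aexp) : nat :=
  match e with
  | ACst k => k
  | AReg r => nreg s r
  | AFld k e => nheap s (k + aval s e)
  | AAdd e1 e2 => (aval s e1 + aval s e2)%N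
  | ASub e1 e2 => (aval s e1 - aval s e2)%N
  end.

Fixpoint xval s (e : xexp) : R :=
  match e with
  | XReg r => rreg s r
  | XFld k e => rheap s (k + aval s e)
  | XAdd e1 e2 => xval s e1 + xval s e2
  | XSub e1 e2 => xval s e1 - xval s e2
  end.

Fixpoint teval s (t : test) : bool :=
  match t with
  | TNEq e1 e2 => aval s e1 == aval s e2
  | TNLe e1 e2 => (aval s e1 <= aval s e2)%N
  | TREq e1 e2 => xval s e1 == xval s e2
  | TRLe e1 e2 => xval s e1 <= xval s e2
  | TNot t1 => ~~ teval s t1
  | TAnd t1 t2 => teval s t1 && teval s t2
  end.

Fixpoint run (c : code) s : state :=
  match c with
  | CSkip => s
  | CSetN r e => set_nreg s r (aval s e)
  | CSetR r e => set_rreg s r (xval s e)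
  | CSel r t e1 e2 =>
      set_nreg s r (if teval s t then aval s e1 else aval s e2)
  | CNew ns xs => alloc s ns xs
  | CSeq c1 c2 => run c2 (run c1 s)
  | CIf t c1 c2 => if teval s t then run c1 s else run c2 s
  | CWhile _ _ => s
  end.

Lemma neval_comp s e : awf e -> neval (mem_of s) (acomp e) = aval s e.
Proof.
elim: e => //= [r ->|k e IHe /IHe ->|e1 IH1 e2 IH2 /andP[/IH1-> /IH2->]|
  e1 IH1 e2 IH2 /andP[/IH1-> /IH2->]] //.
by rewrite -addnA addKn.
Qed.

Lemma reval_comp s e : xwf e -> reval (mem_of s) (xcomp e) = xval s e.
Proof.
elim: e => //= [r ->|k e we|e1 IH1 e2 IH2 /andP[/IH1-> /IH2->]|
  e1 IH1 e2 IH2 /andP[/IH1-> /IH2->]] //.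
rewrite neval_comp //=.
by rewrite -addnA addKn.
Qed.

Lemma beval_comp s t : twf t -> beval (mem_of s) (tcomp t) = teval s t.
Proof.
elim: t => /=[e1 e2 /andP[? ?]|e1 e2 /andP[? ?]|e1 e2 /andP[? ?]|
  e1 e2 /andP[? ?]|t IH /IH->|t1 IH1 t2 IH2 /andP[/IH1-> /IH2->]] //;
  by rewrite ?neval_comp ?reval_comp.
Qed.

Lemma mem_set_nreg s r v : (r < nregs)%N ->
  set_ncell (mem_of s) r v = mem_of (set_nreg s r v).
Proof.
move=> rlt; rewrite /mem_of /set_ncell /=; congr Memory; apply: funext => a.
by rewrite /upd; case: eqP => [->|//]; rewrite rlt.
Qed.

Lemma mem_set_rreg s r v : (r < nregs)%N ->
  set_rcell (mem_of s) r v = mem_of (set_rreg s r v).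
Proof.
move=> rlt; rewrite /mem_of /set_ncell /=; congr Memory; apply: funext => a.
by rewrite /upd; case: eqP => [->|//]; rewrite rlt.
Qed.

Lemma exec_nputs s k ns : all (fun r => r < nregs)%N ns ->
  exec (nputs k ns) (mem_of s)
    (mem_of (State (nreg s) (rreg s)
      (write_block (nheap s) (k + nreg s rHP) (nreg s) ns) (rheap s)))
    (nputs_cost ns).
Proof.
elim: ns k s => [|r ns IH] k s /=.
  move=> _; set s' := State _ _ _ _; have -> : s' = s; last exact: ExecSkip.
  rewrite /s'; case: s @s' => n x h g /=; congr State; apply: funext => a.
  by rewrite /write_block /= addn0; case: ifP => //; lia.
move=> /andP[rlt wf].
have := IH k.+1 (State (nreg s) (rreg s)
  (upd (nheap s) (k + nreg s rHP) (nreg s r)) (rheap s)) wf.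
set m1 := mem_of _; set m2 := mem_of _; move=> E.
set m3 := mem_of (State _ _ _ _).
have -> : m3 = m2; last first.
  apply: ExecSeq E; have -> : m1 = set_ncell (mem_of s)
    (neval (mem_of s) (hp_cell k)) (neval (mem_of s) (NRead (NConst r))).
    rewrite /m1 /mem_of /set_ncell /=; congr Memory; apply: funext => a.
    rewrite /upd rlt; case: (ltnP a nregs) => alt.
      by rewrite ifN //; apply/eqP => e; rewrite e /nregs in alt; lia.
    rewrite (_ : (a == _) = (a - nregs == k + nreg s rHP)%N) //.
    by move: alt; rewrite /nregs => alt; apply/eqP/eqP; lia.
  exact: ExecNWrite.
rewrite /m3 /m2 /mem_of /=; congr Memory; apply: funext => a; case: ltnP => // le.
rewrite /write_block /upd /=; set b := (a - nregs)%N.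
have [->|ne] := eqVneq b (k + nreg s rHP)%N.
  by rewrite leqnn subnn ifT ?ifN //; lia.
case: ifP => h1; case: ifP => h2 //; try lia.
by rewrite (_ : b - _ = (b - (k.+1 + nreg s rHP)).+1)%N //; lia.
Qed.

Lemma exec_rputs s k ns : all (fun r => r < nregs)%N ns ->
  exec (rputs k ns) (mem_of s)
    (mem_of (State (nreg s) (rreg s) (nheap s)
      (write_block (rheap s) (k + nreg s rHP) (rreg s) ns)))
    (nputs_cost ns).
Proof.
elim: ns k s => [|r ns IH] k s /=.
  move=> _; set s' := State _ _ _ _; have -> : s' = s; last exact: ExecSkip.
  rewrite /s'; case: s @s' => n x h g /=; congr State; apply: funext => a.
  by rewrite /write_block /= addn0; case: ifP => //; lia.
move=> /andP[rlt wf].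
have := IH k.+1 (State (nreg s) (rreg s) (nheap s)
  (upd (rheap s) (k + nreg s rHP) (rreg s r))) wf.
set m1 := mem_of _; set m2 := mem_of _; move=> E.
set m3 := mem_of (State _ _ _ _).
have -> : m3 = m2; last first.
  apply: ExecSeq E; have -> : m1 = set_rcell (mem_of s)
    (neval (mem_of s) (hp_cell k)) (reval (mem_of s) (RRead (NConst r))).
    rewrite /m1 /mem_of /set_rcell /=; congr Memory; apply: funext => a.
    rewrite /upd rlt; case: (ltnP a nregs) => alt.
      by rewrite ifN //; apply/eqP => e; rewrite e /nregs in alt; lia.
    rewrite (_ : (a == _) = (a - nregs == k + nreg s rHP)%N) //.
    by move: alt; rewrite /nregs => alt; apply/eqP/eqP; lia.
  exact: ExecRWrite.
rewrite /m3 /m2 /mem_of /=; congr Memory; apply: funext => a; case: ltnP => // le.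
rewrite /write_block /upd /=; set b := (a - nregs)%N.
have [->|ne] := eqVneq b (k + nreg s rHP)%N.
  by rewrite leqnn subnn ifT ?ifN //; lia.
case: ifP => h1; case: ifP => h2 //; try lia.
by rewrite (_ : b - _ = (b - (k.+1 + nreg s rHP)).+1)%N //; lia.
Qed.

Lemma exec_alloc s ns xs : regs_ok ns -> regs_ok xs ->
  exec (compile (CNew ns xs)) (mem_of s) (mem_of (alloc s ns xs))
    (maxcost (CNew ns xs)).
Proof.
move=> /andP[_ wn] /andP[_ wx] /=.
apply: (@ExecSeq _ _ _ _ (mem_of (set_nreg s rHP (nreg s rHP + 8)%N)) _ 6).
  rewrite -mem_set_nreg //; exact: ExecNWrite.
apply: ExecSeq; first exact: exec_nputs.
exact: exec_rputs.
Qed.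

(** [rHP] is the address of the last block, not of the first free cell, hence the 8 further cells.
    Every representation predicate is monotone along this preorder, which takes the place of a
    separation argument. *)
Definition ext s s' : Prop :=
  (nreg s rHP <= nreg s' rHP)%N /\
  forall a, (a < nreg s rHP + 8)%N ->
    nheap s' a = nheap s a /\ rheap s' a = rheap s a.

Lemma ext_trans s1 s2 s3 : ext s1 s2 -> ext s2 s3 -> ext s1 s3.
Proof.
move=> [le12 E12] [le23 E23]; split; first lia.
by move=> a alt; have [<- <-] := E12 a alt; apply: E23; lia.
Qed.

Lemma ext_alloc s ns xs : ext s (alloc s ns xs).
Proof.
split; first by rewrite /= /upd eqxx leq_addr.
by move=> a alt; rewrite /= /write_block /upd eqxx; split; rewrite ifN //; lia.
Qed.

Lemma exec_run c s : loopfree c ->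
  ext s (run c s) /\
  exists2 t, exec (compile c) (mem_of s) (mem_of (run c s)) t & (t <= maxcost c)%N.
Proof.
elim: c s => [|r e|r e|r t e1 e2|ns xs|c1 IH1 c2 IH2|t c1 IH1 c2 IH2|//] s /=.
- by move=> _; split => //; exists 1%N => //; apply: ExecSkip.
- move=> /and3P[rlt rne we]; split.
    by split => //=; rewrite /upd eq_sym (negPf rne).
  exists (1 + ncost (acomp e)).+1 => //.
  rewrite -mem_set_nreg // -neval_comp //.
  exact: (ExecNWrite _ (NConst r)).
- move=> /andP[rlt we]; split => //.
  exists (1 + rcost (xcomp e)).+1 => //.
  rewrite -mem_set_rreg // -reval_comp //.
  exact: (ExecRWrite _ (NConst r)).
- move=> /and5P[rlt rne wt w1 w2]; split.
    by split => //=; rewrite /upd eq_sym (negPf rne).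
  rewrite -mem_set_nreg // -beval_comp //; case: ifPn => tv.
    exists (bcost (tcomp t) + (1 + ncost (acomp e1)).+1).+1; last by lia.
    by apply: ExecIfTrue => //; rewrite -neval_comp //; apply: (ExecNWrite _ (NConst r)).
  exists (bcost (tcomp t) + (1 + ncost (acomp e2)).+1).+1; last by lia.
  by apply: ExecIfFalse => //; rewrite -neval_comp //; apply: (ExecNWrite _ (NConst r)).
- move=> /andP[wn wx]; split; first exact: ext_alloc.
  by eexists; first exact: exec_alloc.
- move=> /andP[w1 w2]; have [e1 [t1 E1 le1]] := IH1 s w1.
  have [e2 [t2 E2 le2]] := IH2 (run c1 s) w2.
  split; first exact: ext_trans e1 e2.
  by exists (t1 + t2)%N; [apply: ExecSeq E1 E2|exact: leq_add].
- move=> /and3P[wt w1 w2]; have [e1 [t1 E1 le1]] := IH1 s w1.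
  have [e2 [t2 E2 le2]] := IH2 s w2.
  case: ifP => tv; split => //.
    exists (bcost (tcomp t) + t1).+1; last by lia.
    by apply: ExecIfTrue => //; rewrite beval_comp.
  exists (bcost (tcomp t) + t2).+1; last by lia.
  by apply: ExecIfFalse => //; rewrite beval_comp ?tv.
Qed.

(** A total-correctness triple with a time bound. Heap extension is built in, so that facts about
    earlier states can always be carried forward. *)
Definition wp (c : code) s (T : nat) (Q : state -> Prop) : Prop :=
  exists s' t, [/\ exec (compile c) (mem_of s) (mem_of s') t, (t <= T)%N,
    ext s s' & Q s'].

Lemma wp_run c s T Q : loopfree c -> (maxcost c <= T)%N -> Q (run c s) ->
  wp c s T Q.
Proof.
move=> lf leT Qs; have [e [t E le]] := exec_run s lf.
by exists (run c s), t; split => //; apply: leq_trans leT.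
Qed.

Lemma wp_seq c1 c2 s T1 T2 Q :
  wp c1 s T1 (fun s1 => ext s s1 -> wp c2 s1 T2 Q) ->
  wp (CSeq c1 c2) s (T1 + T2) Q.
Proof.
move=> [s1 [t1 [E1 le1 e1 [//|s2 [t2 [E2 le2 e2 q]]]]]].
exists s2, (t1 + t2)%N; split => //; first exact: ExecSeq E1 E2.
  exact: leq_add.
exact: ext_trans e1 e2.
Qed.

Lemma wp_weak c s T T' (Q Q' : state -> Prop) :
  wp c s T Q -> (T <= T')%N -> (forall s', ext s s' -> Q s' -> Q' s') ->
  wp c s T' Q'.
Proof.
move=> [s' [t [E le e q]]] leT QQ; exists s', t; split => //.
  exact: leq_trans leT.
exact: QQ.
Qed.

Lemma wp_if t c1 c2 s T Q : twf t ->
  (teval s t -> wp c1 s T Q) -> (~~ teval s t -> wp c2 s T Q) ->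
  wp (CIf t c1 c2) s (bcost (tcomp t) + T).+1 Q.
Proof.
move=> wt W1 W2; case: (boolP (teval s t)) => tv.
  have [s' [u [E le e q]]] := W1 tv; exists s', (bcost (tcomp t) + u).+1.
  split => //; last by lia.
  by apply: ExecIfTrue => //; rewrite beval_comp.
have [s' [u [E le e q]]] := W2 tv; exists s', (bcost (tcomp t) + u).+1.
split => //; last by lia.
by apply: ExecIfFalse => //; rewrite beval_comp.
Qed.

(** The index of the invariant is the variant: it drops in each round, so there are at most [n]
    rounds and [n.+1] evaluations of the test. *)
Lemma wp_while (I : nat -> state -> Prop) t c s T n Q : twf t ->
  I n s ->
  (forall k s', I k s' -> teval s' t ->
     exists2 k', (k' < k)%N & wp c s' T (I k')) ->
  (forall k s', I k s' -> ~~ teval s' t -> Q s') ->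
  wp (CWhile t c) s (n.+1 * (bcost (tcomp t) + T).+1) Q.
Proof.
move=> wt + Istep Iend; elim/ltn_ind: n s => n IH s Is.
case: (boolP (teval s t)) => tv; last first.
  exists s, (bcost (tcomp t)).+1; split => //; last exact: Iend Is tv.
    by apply: ExecWhileFalse; rewrite beval_comp.
  by rewrite mulSn; lia.
have [k ltk [s1 [t1 [E1 le1 e1 I1]]]] := Istep _ _ Is tv.
have [s2 [t2 [E2 le2 e2 q]]] := IH k ltk s1 I1.
exists s2, (bcost (tcomp t) + t1 + t2).+1; split => //.
- by apply: ExecWhileTrue E1 E2; rewrite beval_comp.
- have : (k.+1 * (bcost (tcomp t) + T).+1 <= n * (bcost (tcomp t) + T).+1)%N.
    by rewrite leq_mul2r ltk orbT.
  rewrite mulSn; lia.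
- exact: ext_trans e1 e2.
Qed.

(** [reachable] admits an arbitrary execution, whereas a triple exhibits one; determinism identifies
    their final memories. *)
Lemma exec_det c (m m1 m2 : memory R) t1 t2 :
  exec c m m1 t1 -> exec c m m2 t2 -> m1 = m2.
Proof.
move=> E; elim: E m2 t2 => {c m m1 t1}
  [m|m a e|m a e|c1 c2 m m1 m2 t1 t2 _ IH1 _ IH2|b c1 c2 m m' t bv _ IH|
   b c1 c2 m m' t bv _ IH|b c m m1 m2 t1 t2 bv _ IH1 _ IH2|b c m bv] m3 t3 E';
  inversion E'; subst => //.
- match goal with A : exec c1 _ _ _, B : exec c2 _ _ _ |- _ =>
    have e := IH1 _ _ A; subst; exact: IH2 B end.
- match goal with A : exec c1 _ _ _ |- _ => exact: IH A end.
- by match goal with A : is_true (~~ _) |- _ => rewrite bv in A end.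
- by match goal with A : is_true (beval _ _) |- _ => rewrite A in bv end.
- match goal with A : exec c2 _ _ _ |- _ => exact: IH A end.
- match goal with A : exec c _ _ _, B : exec (While _ _) ?m _ _ |- m2 = _ =>
    have e := IH1 _ _ A; subst; exact: IH2 B end.
- by match goal with A : is_true (~~ _) |- _ => rewrite bv in A end.
- by match goal with A : is_true (beval _ _) |- _ => rewrite A in bv end.
Qed.

End Machine.

(** * Leaf-oriented balanced trees *)

Section Trees.
Variable R : realType.
Implicit Types (x y z : job R) (s : seq (job R)).

Definition jlt x y : bool :=
  (start x < start y) || ((start x == start y) &&
  ((len x < len y) || ((len x == len y) && (label x < label y)%N))).

Lemma job_eq x y :
  start x = start y -> len x = len y -> label x = label y -> x = y.
Proof. by case: x y => [? ? ?] [? ? ?] /= -> -> ->. Qed.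

Lemma jlt_irr : irreflexive jlt.
Proof. by move=> x; rewrite /jlt !ltxx ltnn !andbF. Qed.

Lemma jlt_trans : transitive jlt.
Proof.
move=> y x z /orP[h1|/andP[/eqP e1 /orP[h1|/andP[/eqP f1 h1]]]]
  /orP[h2|/andP[/eqP e2 /orP[h2|/andP[/eqP f2 h2]]]]; rewrite /jlt.
- by rewrite (lt_trans h1 h2).
- by rewrite -e2 h1.
- by rewrite -e2 h1.
- by rewrite e1 h2.
- by rewrite e1 e2 eqxx (lt_trans h1 h2) orbT.
- by rewrite e1 e2 eqxx -f2 h1 orbT.
- by rewrite e1 h2.
- by rewrite e1 e2 eqxx f1 h2 orbT.
- by rewrite e1 e2 eqxx f1 f2 eqxx (ltn_trans h1 h2) !orbT.
Qed.

Lemma jlt_total x y : x != y -> ~~ jlt x y -> jlt y x.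
Proof.
move=> ne; rewrite /jlt !negb_or !negb_and.
case: (ltgtP (start x) (start y)) => //= es.
case: (ltgtP (len x) (len y)) => //= el.
case: (ltngtP (label x) (label y)) => //= ela.
by rewrite (job_eq es el ela) eqxx in ne.
Qed.

Lemma jlt_asym x y : jlt x y -> jlt y x -> False.
Proof. by move=> h1 h2; have := jlt_trans h1 h2; rewrite jlt_irr. Qed.

Lemma jlt_start x y : jlt x y -> start x <= start y.
Proof. by case/orP => [/ltW //|/andP[/eqP->]]. Qed.

Definition sen : job R := Job 0 0 0.

(* The border [sen] at time 0 is left out: it is stored at address 0, which also
   stands for the absence of a later border. *)
Definition isb x : bool := (len x == 0) && (x != sen).

(** Ties go to the left argument. This makes the operation associative, so that the result does not
    depend on the shape of the tree, and it singles out the [jlt]-least job of a sorted list. *)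
Definition bmin x y := if finish x <= finish y then x else y.

Lemma bminA : associative bmin.
Proof.
move=> x y z; rewrite /bmin.
have [yz|yz] := leP (finish y) (finish z); have [xy|xy] := leP (finish x) (finish y).
- by rewrite (le_trans xy yz).
- by rewrite yz.
- by [].
- by rewrite !leNgt yz (lt_trans yz xy).
Qed.

Definition bestq s : option (job R) :=
  foldr (fun x o => Some (if o is Some y then bmin x y else x)) None s.

Definition lastb s : job R := last sen [seq x <- s | isb x].

Lemma lastb_cat s1 s2 :
  lastb (s1 ++ s2) = if lastb s2 == sen then lastb s1 else lastb s2.
Proof.
rewrite /lastb filter_cat last_cat; have : all isb [seq x <- s2 | isb x].
  exact: filter_all.
case/lastP: [seq x <- s2 | isb x] => [|s x] /=; first by rewrite eqxx.
by rewrite !last_rcons all_rcons => /andP[/andP[_ /negPf-> _]].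
Qed.

Inductive tree : Type :=
| Leaf of job R & bool
| Node of tree & tree.
Implicit Types t l r : tree.

Fixpoint leaves t : seq (job R * bool) :=
  match t with Leaf x b => [:: (x, b)] | Node l r => leaves l ++ leaves r end.

Definition keys t : seq (job R) := unzip1 (leaves t).

Lemma keys_node l r : keys (Node l r) = keys l ++ keys r.
Proof. exact: map_cat. Qed.

Fixpoint best t : job R :=
  match t with Leaf x _ => x | Node l r => bmin (best l) (best r) end.

Fixpoint maxl t : job R :=
  match t with Leaf x _ => x | Node _ r => maxl r end.

Definition cnt t : nat := count snd (leaves t).

Fixpoint height t : nat :=
  match t with Leaf _ _ => 0 | Node l r => (maxn (height l) (height r)).+1 end.

Lemma bestq_keys t s :
  bestq (keys t ++ s) =
  Some (if bestq s is Some y then bmin (best t) y else best t).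
Proof.
elim: t s => [x b|l IHl r IHr] s //.
rewrite keys_node -catA IHl IHr /=; case: (bestq s) => //= y.
by rewrite bminA.
Qed.

Lemma maxl_in t : maxl t \in keys t.
Proof.
elim: t => [x b|l _ r IHr]; first by rewrite inE.
by rewrite keys_node mem_cat /= IHr orbT.
Qed.

Lemma best_in t : best t \in keys t.
Proof.
elim: t => [x b|l IHl r IHr]; first by rewrite inE.
by rewrite keys_node mem_cat /= /bmin; case: ifP => _; rewrite ?IHl ?IHr ?orbT.
Qed.

Lemma maxl_max t x : sorted jlt (keys t) -> x \in keys t ->
  (x == maxl t) || jlt x (maxl t).
Proof.
elim: t => [y b|l IHl r IHr]; first by rewrite inE => _ /eqP->; rewrite eqxx.
rewrite keys_node (sorted_pairwise jlt_trans) pairwise_cat => /and3P[/allrelP a _ s].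
rewrite mem_cat => /orP[xl|/IHr]; last first.
  by apply; rewrite (sorted_pairwise jlt_trans).
by rewrite [maxl _]/= a ?orbT ?maxl_in.
Qed.

Fixpoint avl t : bool :=
  match t with
  | Leaf _ _ => true
  | Node l r => [&& avl l, avl r, (height l <= (height r).+1)%N
      & (height r <= (height l).+1)%N]
  end.

Lemma size_leaves_gt0 t : (0 < size (leaves t))%N.
Proof. by elim: t => //= l IHl r IHr; rewrite size_cat; lia. Qed.

(** Squaring replaces the Fibonacci numbers. If the lower subtree has a leaves, the higher one b,
    and E is 2 to the height of the higher one, then E <= b^2 and E <= 2a^2, whence 2E <= (a + b)^2.
    Only a constant factor of the height is lost. *)
Lemma avl_size t : avl t -> (2 ^ height t <= size (leaves t) ^ 2)%N.
Proof.
elim: t => //= l IHl r IHr /and4P[/IHl Hl /IHr Hr h1 h2]; rewrite size_cat.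
have pl := size_leaves_gt0 l; have pr := size_leaves_gt0 r.
move: (size (leaves l)) (size (leaves r)) Hl Hr pl pr => a b.
wlog le : l r a b IHl IHr h1 h2 / (height l <= height r)%N.
  move=> W; case/orP: (leq_total (height l) (height r)); first exact: W.
  by move=> le Ha Hb pa pb; rewrite maxnC addnC; apply: W.
rewrite (maxn_idPr le) => Ha Hb pa pb.
have : (2 ^ height r <= 2 * a ^ 2)%N.
  by apply: leq_trans (leq_pexp2l _ h2) _ => //; rewrite expnS leq_mul2l Ha.
rewrite [(2 ^ _.+1)%N]expnS; move: (2 ^ height r)%N Hb => E; rewrite -!mulnn.
move=> Hb Ha'; rewrite mulnDl !mulnDr (mulnC b a).
by case: (leqP a b) => ab; [have := leq_mul (leqnn a) ab|
  have := leq_mul (ltnW ab) (leqnn b)]; lia.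
Qed.

Definition hbound (n : nat) : nat := trunc_log 2 (n ^ 2).

Lemma avl_height t n :
  avl t -> (size (leaves t) <= n)%N -> (height t <= hbound n)%N.
Proof.
move=> a le; apply: trunc_log_max => //.
by apply: leq_trans (avl_size a) _; rewrite leq_exp2r.
Qed.

Definition rotate_right l r : tree :=
  if l is Node ll lr then
    if (height lr <= height ll)%N then Node ll (Node lr r)
    else if lr is Node a b then Node (Node ll a) (Node b r) else Node l r
  else Node l r.

Definition rotate_left l r : tree :=
  if r is Node rl rr then
    if (height rl <= height rr)%N then Node (Node l rl) rr
    else if rl is Node a b then Node (Node l a) (Node b rr) else Node l r
  else Node l r.

Definition bal l r : tree :=
  if ((height r).+1 < height l)%N then rotate_right l r
  else if ((height l).+1 < height r)%N then rotate_left l r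
  else Node l r.

Lemma bal_node l r : (height l <= (height r).+1)%N ->
  (height r <= (height l).+1)%N -> bal l r = Node l r.
Proof. by move=> h1 h2; rewrite /bal !ifN // -leqNgt. Qed.

Lemma leaves_bal l r : leaves (bal l r) = leaves l ++ leaves r.
Proof.
rewrite /bal; case: ifP => _.
  case: l => [x b|ll lr] //=; case: ifP => _ /=; first by rewrite catA.
  by case: lr => [x b|a b] //=; rewrite !catA.
case: ifP => _ //.
case: r => [x b|rl rr] //=; case: ifP => _ /=; first by rewrite catA.
by case: rl => [x b|a b] //=; rewrite !catA.
Qed.

(** A difference of 2 is the worst that a change of one subtree by one level can cause; the case
    distinctions cover insertion and deletion at once. *)
Lemma avl_bal l r : avl l -> avl r ->
  (height l <= (height r).+2)%N -> (height r <= (height l).+2)%N ->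
  avl (bal l r) /\
  (maxn (height l) (height r) <= height (bal l r)
     <= (maxn (height l) (height r)).+1)%N.
Proof.
move=> al ar h1 h2; rewrite /bal; case: ifPn => g1.
  case: l al h1 h2 g1 => [x b|ll lr] //= /and4P[all alr k1 k2] h1 h2 g1.
  case: ifPn => g2 /=; first by rewrite all alr ar; split; lia.
  case: lr alr k1 k2 h1 h2 g1 g2 => [x b|a b] /=.
    by move=> *; lia.
  move=> /and4P[aa ab m1 m2] k1 k2 h1 h2 g1 g2.
  by rewrite all aa ab ar /=; split; lia.
case: ifPn => g2; last by rewrite /= al ar; split; lia.
case: r ar h1 h2 g1 g2 => [x b|rl rr] //= /and4P[arl arr k1 k2] h1 h2 g1 g2.
case: ifPn => g3 /=; first by rewrite al arl arr; split; lia.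
case: rl arl k1 k2 h1 h2 g1 g2 g3 => [x b|a b] /=.
  by move=> *; lia.
move=> /and4P[aa ab m1 m2] k1 k2 h1 h2 g1 g2 g3.
by rewrite arr aa ab al /=; split; lia.
Qed.

(* A frame [(d, t)] of a path, innermost frame first, holds the sibling [t] of
   the subtree below; it lies on the left if [d] and on the right otherwise. *)
Implicit Type P : seq (bool * tree).

Definition plug P t : tree :=
  foldl (fun t f => if f.1 then Node f.2 t else Node t f.2) t P.

Definition up P t : tree :=
  foldl (fun t f => if f.1 then bal f.2 t else bal t f.2) t P.

Fixpoint pre P : seq (job R * bool) :=
  if P is (d, t) :: P' then pre P' ++ (if d then leaves t else [::]) else [::].

Fixpoint post P : seq (job R * bool) :=
  if P is (d, t) :: P' then (if d then [::] else leaves t) ++ post P' else [::].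

Lemma leaves_plug P t : leaves (plug P t) = pre P ++ leaves t ++ post P.
Proof.
elim: P t => [|[[] u] P IH] t /=; first by rewrite cats0.
  by rewrite IH /= !catA.
by rewrite IH /= cats0 !catA.
Qed.

Lemma leaves_up P t : leaves (up P t) = pre P ++ leaves t ++ post P.
Proof.
elim: P t => [|[[] u] P IH] t /=; first by rewrite cats0.
  by rewrite IH leaves_bal !catA.
by rewrite IH leaves_bal cats0 !catA.
Qed.

Lemma avl_plug P t : avl (plug P t) -> avl t.
Proof. by elim: P t => [|[[] u] P IH] t //= /IH/and4P[]. Qed.

(** If a subtree is replaced by one whose height differs by at most one, the same holds one level
    up, so the bound climbs the path. This serves a leaf turned into a node, a node turned into one
    of its children, and a leaf copied with a new mark. *)
Lemma avl_up P t0 t : avl (plug P t0) -> avl t ->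
  (height t <= (height t0).+1)%N -> (height t0 <= (height t).+1)%N ->
  avl (up P t).
Proof.
elim: P t0 t => [|[[] u] P IH] t0 t //= ap at_ h1 h2;
  have /= /and4P[a1 a2 h3 h4] := avl_plug ap.
- have [] := @avl_bal u t a1 at_; [lia|lia|move=> ab hb].
  apply: IH ap ab _ _ => /=; first lia.
  (* After a rotation the window that [avl_bal] gives for the height is enough. Without one the
     exact height is needed, since the window alone would allow a drop by two. *)
  case: (leqP (height u) (height t).+1) => g; last lia.
  case: (leqP (height t) (height u).+1) => g'; last lia.
  by rewrite bal_node //=; lia.
- have [] := @avl_bal t u at_ a2; [lia|lia|move=> ab hb].
  apply: IH ap ab _ _ => /=; first lia.
  case: (leqP (height u) (height t).+1) => g; last lia.
  case: (leqP (height t) (height u).+1) => g'; last lia.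
  by rewrite bal_node //=; lia.
Qed.

Lemma size_path_plug P t : (size P <= height (plug P t))%N.
Proof.
suff: (size P + height t <= height (plug P t))%N by lia.
elim: P t => [//|[[] u] P IH] t /=; apply: leq_trans (IH _) => /=; lia.
Qed.

End Trees.

(** * Tree programs *)

Notation rROOT := 2%N (only parsing).
Notation rKB := 3%N (only parsing).
Notation rCUR := 4%N (only parsing).
Notation rPATH := 5%N (only parsing).
Notation rSB := 6%N (only parsing).
Notation rPB := 7%N (only parsing).
Notation rA := 8%N (only parsing).
Notation rB := 9%N (only parsing).
Notation rH := 10%N (only parsing).
Notation rBST := 13%N (only parsing).
Notation rLB := 14%N (only parsing).
Notation rMX := 15%N (only parsing).
Notation rCNT := 16%N (only parsing).
Notation rKIND := 17%N (only parsing).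
Notation rX := 20%N (only parsing).
Notation rY := 21%N (only parsing).
Notation rZ := 22%N (only parsing).
Notation xKS := 2%N (only parsing).
Notation xKL := 3%N (only parsing).

Local Notation "c1 ;; c2" := (CSeq c1 c2) (at level 80, right associativity).
Local Notation "r ::= e" := (CSetN r e) (at level 75).
Local Coercion AReg : nat >-> aexp.

(* A leaf stores its label in the field of the left child, and [cnm] is then its
   mark: 1 if the job is scheduled, 0 otherwise. *)
Definition hgt (e : aexp) := AFld 0 e.
Definition lft (e : aexp) := AFld 1 e.
Definition rgt (e : aexp) := AFld 2 e.
Definition bst (e : aexp) := AFld 3 e.
Definition lbd (e : aexp) := AFld 4 e.
Definition mxl (e : aexp) := AFld 5 e.
Definition cnm (e : aexp) := AFld 6 e.
Definition fin (e : aexp) := XAdd (XFld 0 e) (XFld 1 e).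
Definition TOr (t1 t2 : test) := TNot (TAnd (TNot t1) (TNot t2)).

Definition key_lt (e : aexp) : test :=
  TOr (TNot (TRLe (XFld 0 e) (XReg xKS)))
    (TAnd (TREq (XReg xKS) (XFld 0 e))
      (TOr (TNot (TRLe (XFld 1 e) (XReg xKL)))
        (TAnd (TREq (XReg xKL) (XFld 1 e)) (TNot (TNLe (lft e) rKB))))).

Definition lt_key (e : aexp) : test :=
  TOr (TNot (TRLe (XReg xKS) (XFld 0 e)))
    (TAnd (TREq (XFld 0 e) (XReg xKS))
      (TOr (TNot (TRLe (XReg xKL) (XFld 1 e)))
        (TAnd (TREq (XFld 1 e) (XReg xKL)) (TNot (TNLe rKB (lft e)))))).

Definition mk_code : code :=
  CSel rH (TNLe (hgt rA) (hgt rB))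
    (AAdd (ACst 1) (hgt rB)) (AAdd (ACst 1) (hgt rA)) ;;
  CSel rBST (TRLe (fin (bst rA)) (fin (bst rB))) (bst rA) (bst rB) ;;
  CSel rLB (TNEq (lbd rB) (ACst 0)) (lbd rA) (lbd rB) ;;
  rMX ::= mxl rB ;;
  rCNT ::= AAdd (cnm rA) (cnm rB) ;;
  CNew [:: rH; rA; rB; rBST; rLB; rMX; rCNT] [::] ;;
  rCUR ::= rHP.

Definition rotr_code : code :=
  rX ::= lft rA ;; rY ::= rgt rA ;;
  CIf (TNLe (hgt rY) (hgt rX))
    (rA ::= rY ;; mk_code ;; rA ::= rX ;; rB ::= rCUR ;; mk_code)
    (rA ::= rgt rY ;; mk_code ;; rZ ::= rCUR ;; rA ::= rX ;; rB ::= lft rY ;;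
     mk_code ;; rA ::= rCUR ;; rB ::= rZ ;; mk_code).

Definition rotl_code : code :=
  rX ::= lft rB ;; rY ::= rgt rB ;;
  CIf (TNLe (hgt rX) (hgt rY))
    (rB ::= rX ;; mk_code ;; rA ::= rCUR ;; rB ::= rY ;; mk_code)
    (rB ::= lft rX ;; mk_code ;; rZ ::= rCUR ;; rA ::= rgt rX ;; rB ::= rY ;;
     mk_code ;; rA ::= rZ ;; rB ::= rCUR ;; mk_code).

Definition bal_code : code :=
  CIf (TNLe (hgt rA) (AAdd (ACst 1) (hgt rB)))
    (CIf (TNLe (hgt rB) (AAdd (ACst 1) (hgt rA))) mk_code rotl_code)
    rotr_code.

Definition asc_body : code :=
  CIf (TNEq (AFld 1 rPATH) (ACst 1))
    (rA ::= AFld 0 rPATH ;; rB ::= rCUR) (rA ::= rCUR ;; rB ::= AFld 0 rPATH) ;;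
  rPATH ::= AFld 2 rPATH ;;
  bal_code.

Definition asc_test : test := TNot (TNEq rPATH (ACst 0)).

Definition asc_code : code := CWhile asc_test asc_body ;; rROOT ::= rCUR.

Definition desc_init : code :=
  rCUR ::= rROOT ;; rPATH ::= ACst 0 ;; rSB ::= ACst 0 ;; rPB ::= ACst 0.

Definition desc_test : test := TNot (TNLe (hgt rCUR) (ACst 0)).

(** The descent meets the subtrees after the key from right to left, so on a tie the newcomer wins,
    in agreement with [bmin]. *)
Definition first_best (e : aexp) : code :=
  CSel rSB (TOr (TNEq rSB (ACst 0)) (TRLe (fin e) (fin rSB))) e rSB.

(** The subtrees before the key are met from left to right: a border in the newcomer supersedes the
    one found so far. *)
Definition last_border (e : aexp) : code :=
  CSel rPB (TNEq (lbd e) (ACst 0)) rPB (lbd e).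

Definition desc_body : code :=
  CIf (lt_key (mxl (lft rCUR)))
    (last_border (lft rCUR) ;; rA ::= lft rCUR ;; rB ::= ACst 1 ;;
     rCUR ::= rgt rCUR)
    (first_best (bst (rgt rCUR)) ;; rA ::= rgt rCUR ;; rB ::= ACst 0 ;;
     rCUR ::= lft rCUR) ;;
  CNew [:: rA; rB; rPATH] [::] ;; rPATH ::= rHP.

Definition desc_fin : code :=
  CIf (key_lt rCUR) (first_best rCUR) CSkip ;;
  CIf (lt_key rCUR) (last_border rCUR) CSkip.

(* Leaves in [rCUR] the leaf where the search for the key ends, in [rSB] the first
   leaf to finish among those after the key (0 if there is none), in [rPB] the
   last border before the key, and in [rPATH] the path back to the root. *)
Definition desc_code : code :=
  desc_init ;; CWhile desc_test desc_body ;; desc_fin.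

(** The new block lies at the old [rHP] plus 8, and during the allocation [rHP] already is this
    address; this is how a leaf points to itself. Length 0 is tested as start + length = start. *)
Definition leaf_code : code :=
  rH ::= ACst 0 ;;
  CSel rLB (TREq (XAdd (XReg xKS) (XReg xKL)) (XReg xKS))
    (AAdd rHP (ACst 8)) (ACst 0) ;;
  CNew [:: rH; rKB; rH; rHP; rLB; rHP; rKIND] [:: xKS; xKL].

Definition insert_bottom : code :=
  leaf_code ;;
  CIf (key_lt rCUR) (rA ::= rHP ;; rB ::= rCUR) (rA ::= rCUR ;; rB ::= rHP) ;;
  mk_code.

Definition insert_code : code := desc_code ;; insert_bottom ;; asc_code.

(** The parent of the deleted leaf gives way to the sibling, which is what the innermost frame of
    the path holds. *)
Definition delete_bottom : code :=
  rCUR ::= AFld 0 rPATH ;; rPATH ::= AFld 2 rPATH.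

Definition delete_code : code := desc_code ;; delete_bottom ;; asc_code.

Definition mark_bottom : code := leaf_code ;; rCUR ::= rHP.

Definition mark_code : code := desc_code ;; mark_bottom ;; asc_code.

Arguments mk_code : simpl never.
Arguments bal_code : simpl never.
Arguments leaf_code : simpl never.

(** * Trees, paths and optional leaves in the heap *)

Section Representation.
Variable R : realType.
Implicit Types (s : state R) (x y : job R) (t l r : tree R).

(** Only the key of a leaf: the pointers to best leaves and last borders serve to read keys, whereas
    marks are reached by a descent. *)
Definition isleaf s (p : nat) x : Prop :=
  [/\ (p <= nreg s rHP)%N, nheap s (0 + p) = 0%N, nheap s (1 + p) = label x,
      rheap s (0 + p) = start x & rheap s (1 + p) = len x].

(** [sen] and the absence of a later border share the value 0, just as [lastb] answers [sen] by
    default. *)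
Definition border_ptr s (p : nat) x : Prop :=
  if x == sen R then p = 0%N else isleaf s p x.

Fixpoint rep s (p : nat) t : Prop :=
  (p <= nreg s rHP)%N /\
  match t with
  | Leaf x b => isleaf s p x /\
      [/\ nheap s (3 + p) = p, nheap s (4 + p) = (if isb x then p else 0)%N,
          nheap s (5 + p) = p & nheap s (6 + p) = b]
  | Node l r =>
      [/\ nheap s (0 + p) = height t, rep s (nheap s (1 + p)) l,
          rep s (nheap s (2 + p)) r &
        [/\ isleaf s (nheap s (3 + p)) (best t),
            border_ptr s (nheap s (4 + p)) (lastb (keys t)),
            isleaf s (nheap s (5 + p)) (maxl t) & nheap s (6 + p) = cnt t]]
  end.

Fixpoint frames s (p : nat) (P : seq (bool * tree R)) : Prop :=
  match P with
  | [::] => p = 0%N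
  | (d, t) :: P' =>
      [/\ p <> 0%N, (p <= nreg s rHP)%N, rep s (nheap s (0 + p)) t,
          nheap s (1 + p) = d & frames s (nheap s (2 + p)) P']
  end.

(** Address 0 is free to mean [None]: it holds [sen], which never comes after a key that is searched
    for. *)
Definition opt_ptr s (p : nat) (o : option (job R)) : Prop :=
  if o is Some x then p <> 0%N /\ isleaf s p x else p = 0%N.

Definition key_is s x : Prop :=
  [/\ rreg s xKS = start x, rreg s xKL = len x & nreg s rKB = label x].

Lemma isleaf_ext s s' p x : ext s s' -> isleaf s p x -> isleaf s' p x.
Proof.
move=> [le e] [h1 h2 h3 h4 h5]; rewrite /isleaf.
have [-> ->] := e (0 + p)%N ltac:(lia).
have [-> ->] := e (1 + p)%N ltac:(lia).
split => //; lia.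
Qed.

Lemma border_ptr_ext s s' p x : ext s s' -> border_ptr s p x -> border_ptr s' p x.
Proof. by rewrite /border_ptr; case: ifP => // _; apply: isleaf_ext. Qed.

Lemma opt_ptr_ext s s' p o : ext s s' -> opt_ptr s p o -> opt_ptr s' p o.
Proof. by case: o => //= x e [ne]; split => //; apply: isleaf_ext e _. Qed.

Lemma rep_ext s s' p t : ext s s' -> rep s p t -> rep s' p t.
Proof.
move=> ex; elim: t p => [x b|l IHl r IHr] p [le]; have [le' e] := ex.
  move=> [h [h1 h2 h3 h4]]; split; first lia; split; first exact: isleaf_ext h.
  have [-> _] := e (3 + p)%N ltac:(lia).
  have [-> _] := e (4 + p)%N ltac:(lia).
  have [-> _] := e (5 + p)%N ltac:(lia).
  by have [-> _] := e (6 + p)%N ltac:(lia).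
move=> [h0 h1 h2 [h3 h4 h5 h6]]; split; first lia.
have [-> _] := e (0 + p)%N ltac:(lia).
have [-> _] := e (1 + p)%N ltac:(lia).
have [-> _] := e (2 + p)%N ltac:(lia).
have [-> _] := e (3 + p)%N ltac:(lia).
have [-> _] := e (4 + p)%N ltac:(lia).
have [-> _] := e (5 + p)%N ltac:(lia).
have [-> _] := e (6 + p)%N ltac:(lia).
split; [by []|exact: IHl|exact: IHr|split => //].
- exact: isleaf_ext h3.
- exact: border_ptr_ext h4.
- exact: isleaf_ext h5.
Qed.

Lemma frames_ext s s' p P : ext s s' -> frames s p P -> frames s' p P.
Proof.
move=> ex; elim: P p => [//|[d t] P IH] p /= [ne le h1 h2 h3]; have [le' e] := ex.
have [-> _] := e (0 + p)%N ltac:(lia).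
have [-> _] := e (1 + p)%N ltac:(lia).
have [-> _] := e (2 + p)%N ltac:(lia).
split => //; [lia|exact: rep_ext h1|exact: IH].
Qed.

Lemma rep_fields s p t : rep s p t ->
  [/\ nheap s (0 + p) = height t, isleaf s (nheap s (3 + p)) (best t),
      isleaf s (nheap s (5 + p)) (maxl t) & nheap s (6 + p) = cnt t] /\
  border_ptr s (nheap s (4 + p)) (lastb (keys t)).
Proof.
case: t => [x b|l r] /= [le].
  move=> [h [-> -> -> ->]]; rewrite /cnt /= addn0; split.
    by split => //; case: h.
  rewrite /border_ptr /lastb /=; case: (boolP (isb x)) => [/andP[_ /negPf->]|] //=.
  by rewrite eqxx.
by move=> [h0 h1 h2 [h3 h4 h5 h6]].
Qed.

Lemma isleaf_neq0 s p x : isleaf s 0 (sen R) -> isleaf s p x -> x != sen R ->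
  p <> 0%N.
Proof.
move=> [_ _ h1 h2 h3] [_ _ g1 g2 g3] /eqP ne p0; apply: ne; move: g1 g2 g3.
by rewrite p0 h1 h2 h3 => g1 g2 g3; apply: job_eq.
Qed.

Lemma border_ptr0 s p x : isleaf s 0 (sen R) -> border_ptr s p x ->
  (p == 0%N) = (x == sen R).
Proof.
rewrite /border_ptr => h0; case: eqVneq => [_ ->//|ne h].
by apply/eqP/(isleaf_neq0 h0 h).
Qed.

Lemma alloc_field s ns xs k : (k < size ns)%N ->
  nheap (alloc s ns xs) (k + (nreg s rHP + 8)) =
  upd (nreg s) rHP (nreg s rHP + 8)%N (nth 0%N ns k).
Proof.
move=> lt; rewrite /alloc /= /write_block {1 2}/upd eqxx /=.
by rewrite ifT ?addnK //; lia.
Qed.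

Lemma alloc_xfield s ns xs k : (k < size xs)%N ->
  rheap (alloc s ns xs) (k + (nreg s rHP + 8)) = rreg s (nth 0%N xs k).
Proof.
move=> lt; rewrite /alloc /= /write_block {1 2}/upd eqxx /=.
by rewrite ifT ?addnK //; lia.
Qed.

Lemma teval_or s (t1 t2 : test) : teval s (TOr t1 t2) = teval s t1 || teval s t2.
Proof. by rewrite /= negb_and !negbK. Qed.

Lemma key_ltE s e x k : key_is s k -> isleaf s (aval s e) x ->
  teval s (key_lt e) = jlt k x.
Proof.
move=> [k1 k2 k3] [_ _ h1 h2 h3]; rewrite /key_lt teval_or /=.
by rewrite negb_and !negbK /= k1 k2 k3 h1 h2 h3 -!ltNge -ltnNge.
Qed.

Lemma lt_keyE s e x k : key_is s k -> isleaf s (aval s e) x ->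
  teval s (lt_key e) = jlt x k.
Proof.
move=> [k1 k2 k3] [_ _ h1 h2 h3]; rewrite /lt_key teval_or /=.
by rewrite negb_and !negbK /= k1 k2 k3 h1 h2 h3 -!ltNge -ltnNge.
Qed.

Definition same_regs (qs : seq nat) s s' : Prop :=
  rreg s' = rreg s /\ forall q, q \notin qs -> nreg s' q = nreg s q.

Definition mk_regs := [:: rHP; rCUR; rH; rBST; rLB; rMX; rCNT].

Lemma mk_spec s l r : isleaf s 0 (sen R) ->
  rep s (nreg s rA) l -> rep s (nreg s rB) r ->
  let s' := run mk_code s in
  [/\ rep s' (nreg s' rCUR) (Node l r), same_regs mk_regs s s' & ext s s'].
Proof.
move=> h0 repl repr s'; have [] : ext s s' /\ _ := @exec_run _ mk_code s isT.
move=> ex _; split => //; last first.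
  split => // q; rewrite !inE !negb_or => /and4P[/negPf q1 /negPf q2 /negPf q3].
  by move=> /and4P[/negPf q4 /negPf q5 /negPf q6 /negPf q7];
     rewrite /= /upd q2 q1 q7 q6 q5 q4 q3.
have [[l0 l3 l5 l6] l4] := rep_fields repl.
have [[r0 r3 r5 r6] r4] := rep_fields repr.
have -> : nreg s' rCUR = (nreg s rHP + 8)%N by [].
have [le _] := ex.
have repl' := rep_ext ex repl; have repr' := rep_ext ex repr.
split; first by [].
have F k : (k < 7)%N -> nheap s' (k + (nreg s rHP + 8)) = _ :=
  @alloc_field _ [:: rH; rA; rB; rBST; rLB; rMX; rCNT] [::] k.
rewrite !F //= /upd /= l0 r0.
split=> //.
  by case: ifP => h; lia.
split.
- apply: isleaf_ext ex _; have [_ _ _ a1 a2] := l3; have [_ _ _ b1 b2] := r3.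
  by rewrite a1 a2 b1 b2 /bmin; case: ifP.
- apply: border_ptr_ext ex _; rewrite (border_ptr0 h0 r4) keys_node lastb_cat.
  by case: ifP.
- exact: isleaf_ext ex _.
- by rewrite l6 r6 /cnt /= count_cat.
Qed.

End Representation.

(** * Correctness of the rotations *)

Section Balance.
Variable R : realType.
Implicit Types (s : state R) (x y : job R) (t l r : tree R).

Lemma ext_set_nreg s q v : q != rHP -> ext s (set_nreg s q v).
Proof. by move=> ne; split => //=; rewrite /upd eq_sym (negPf ne). Qed.

Lemma same_regs_trans qs s1 s2 s3 :
  same_regs qs s1 s2 -> same_regs qs s2 s3 -> same_regs qs s1 s3.
Proof.
move=> [x1 f1] [x2 f2]; split; first by rewrite x2.
by move=> q h; rewrite f2 ?f1.
Qed.

Lemma same_regs_sub qs qs' s s' :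
  all (mem qs') qs -> same_regs qs s s' -> same_regs qs' s s'.
Proof.
move=> /allP sub [x f]; split => // q h; apply: f.
by apply: contra h => /sub.
Qed.

Lemma same_regs_set qs s s' q v : q \in qs -> same_regs qs s s' ->
  same_regs qs s (set_nreg s' q v).
Proof.
move=> qin [x f]; split => // q' h /=; rewrite /upd ifN ?f //.
by apply: contra h => /eqP->.
Qed.

Lemma run_seq c1 c2 s : run (c1 ;; c2) s = run c2 (run c1 s).
Proof. by []. Qed.

Lemma run_set q e s : run (q ::= e) s = set_nreg s q (aval s e).
Proof. by []. Qed.

Lemma run_if b c1 c2 s :
  run (CIf b c1 c2) s = if teval s b then run c1 s else run c2 s.
Proof. by []. Qed.

Lemma run_set_seq q e c s :
  run (q ::= e ;; c) s = run c (set_nreg s q (aval s e)).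
Proof. by []. Qed.

Opaque mk_code.

Definition bal_regs := mk_regs ++ [:: rA; rB; rX; rY; rZ].

Lemma mk_spec' s0 s l r : ext s0 s -> same_regs bal_regs s0 s ->
  isleaf s0 0 (sen R) -> rep s (nreg s rA) l -> rep s (nreg s rB) r ->
  forall s', run mk_code s = s' ->
  [/\ rep s' (nreg s' rCUR) (Node l r), same_regs bal_regs s0 s',
      same_regs mk_regs s s', ext s0 s' & ext s s'].
Proof.
move=> ex sm h0 hl hr s' <-; have [h1 h2 h3] := mk_spec (isleaf_ext ex h0) hl hr.
split => //; last exact: ext_trans h3.
apply: same_regs_trans sm (same_regs_sub _ h2) => //.
Qed.

Lemma rotr_spec s l r : isleaf s 0 (sen R) ->
  rep s (nreg s rA) l -> rep s (nreg s rB) r -> ((height r).+1 < height l)%N ->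
  forall s', s' = run rotr_code s ->
  [/\ rep s' (nreg s' rCUR) (rotate_right l r), same_regs bal_regs s s' & ext s s'].
Proof.
move=> h0; case: l => [//|ll lr] repl repr lt.
have [_ [_ repll replr _]] := repl.
have [[ll0 _ _ _] _] := rep_fields repll; have [[lr0 _ _ _] _] := rep_fields replr.
move=> _ ->; rewrite /rotr_code 2!run_set_seq run_if.
set s1 := set_nreg (set_nreg s rX _) rY _.
have -> : teval s1 (TNLe (hgt rY) (hgt rX)) = (height lr <= height ll)%N.
  by rewrite -ll0 -lr0.
rewrite [rotate_right _ _]/=.
have e1 : ext s s1 by apply: ext_trans (ext_set_nreg _ _ _) (ext_set_nreg _ _ _).
have m1 : same_regs bal_regs s s1 by do 2 apply: same_regs_set => //.
case: ifPn => cmp.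
  rewrite run_set_seq run_seq; set s2 := set_nreg s1 rA _.
  have e2 : ext s s2 by apply: ext_trans e1 (ext_set_nreg _ _ _).
  have m2 : same_regs bal_regs s s2 by apply: same_regs_set.
  move E3: (run mk_code s2) => s3.
  have [r3 m3 [_ f3] e3 e23] := mk_spec' e2 m2 h0 (rep_ext e2 replr) (rep_ext e2 repr) E3.
  rewrite 2!run_set_seq; set s4 := set_nreg (set_nreg s3 _ _) _ _.
  have e34 : ext s3 s4 by apply: ext_trans (ext_set_nreg _ _ _) (ext_set_nreg _ _ _).
  have e4 := ext_trans e3 e34.
  have m4 : same_regs bal_regs s s4 by do 2 apply: same_regs_set => //.
  move E: (run mk_code s4) => s7.
  have [||?? _ ? _] := mk_spec' (l := ll) (r := Node lr r) e4 m4 h0 _ _ E; last by split.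
    by rewrite [nreg s4 _]/= /upd /= f3 //; exact: rep_ext e4 repll.
  exact: rep_ext e34 r3.
case: lr replr lr0 cmp {lt repl} => [x b|a b] replr lr0 cmp; first by [].
have [_ [_ repa repb _]] := replr.
rewrite run_set_seq run_seq; set s2 := set_nreg s1 rA _.
have e2 : ext s s2 by apply: ext_trans e1 (ext_set_nreg _ _ _).
have m2 : same_regs bal_regs s s2 by apply: same_regs_set.
move E3: (run mk_code s2) => s3.
have [r3 m3 [_ f3] e3 e23] := mk_spec' e2 m2 h0 (rep_ext e2 repb) (rep_ext e2 repr) E3.
rewrite 3!run_set_seq run_seq.
set s4 := set_nreg (set_nreg (set_nreg s3 _ _) _ _) _ _.
have e34 : ext s3 s4.
  by apply: ext_trans (ext_trans (ext_set_nreg _ _ _) (ext_set_nreg _ _ _))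
    (ext_set_nreg _ _ _).
have e4 := ext_trans e3 e34.
have m4 : same_regs bal_regs s s4 by do 3 apply: same_regs_set => //.
move E5: (run mk_code s4) => s5.
have [||r5 m5 [_ f5] e5 e45] := mk_spec' (l := ll) (r := a) e4 m4 h0 _ _ E5.
- by rewrite [nreg s4 _]/= /upd /= f3 //; exact: rep_ext e4 repll.
- rewrite [nreg s4 _]/= /upd /= f3 //.
  have [_ E] := e3; rewrite [nreg s2 _]/=.
  have [-> _] := E (1 + nheap s (2 + nreg s rA))%N ltac:(case: replr; lia).
  exact: rep_ext e4 repa.
rewrite 2!run_set_seq; set s6 := set_nreg (set_nreg s5 _ _) _ _.
have e56 : ext s5 s6 by apply: ext_trans (ext_set_nreg _ _ _) (ext_set_nreg _ _ _).
have e6 := ext_trans e5 e56.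
have m6 : same_regs bal_regs s s6 by do 2 apply: same_regs_set => //.
move E: (run mk_code s6) => s7.
  have [||?? _ ? _] := mk_spec' (l := Node ll a) (r := Node b r) e6 m6 h0 _ _ E; last by split.
  exact: rep_ext e56 r5.
rewrite [nreg s6 _]/= /upd /= f5 //.
exact: rep_ext (ext_trans e45 e56) (rep_ext e34 r3).
Qed.

Lemma rotl_spec s l r : isleaf s 0 (sen R) ->
  rep s (nreg s rA) l -> rep s (nreg s rB) r -> ((height l).+1 < height r)%N ->
  forall s', s' = run rotl_code s ->
  [/\ rep s' (nreg s' rCUR) (rotate_left l r), same_regs bal_regs s s' & ext s s'].
Proof.
move=> h0 repl; case: r => [//|rl rr] repr lt.
have [_ [_ reprl reprr _]] := repr.
have [[rl0 _ _ _] _] := rep_fields reprl; have [[rr0 _ _ _] _] := rep_fields reprr.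
move=> _ ->; rewrite /rotl_code 2!run_set_seq run_if.
set s1 := set_nreg (set_nreg s rX _) rY _.
have -> : teval s1 (TNLe (hgt rX) (hgt rY)) = (height rl <= height rr)%N.
  by rewrite -rl0 -rr0.
rewrite [rotate_left _ _]/=.
have e1 : ext s s1 by apply: ext_trans (ext_set_nreg _ _ _) (ext_set_nreg _ _ _).
have m1 : same_regs bal_regs s s1 by do 2 apply: same_regs_set => //.
case: ifPn => cmp.
  rewrite run_set_seq run_seq; set s2 := set_nreg s1 rB _.
  have e2 : ext s s2 by apply: ext_trans e1 (ext_set_nreg _ _ _).
  have m2 : same_regs bal_regs s s2 by apply: same_regs_set.
  move E3: (run mk_code s2) => s3.
  have [r3 m3 [_ f3] e3 e23] := mk_spec' e2 m2 h0 (rep_ext e2 repl) (rep_ext e2 reprl) E3.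
  rewrite 2!run_set_seq; set s4 := set_nreg (set_nreg s3 _ _) _ _.
  have e34 : ext s3 s4 by apply: ext_trans (ext_set_nreg _ _ _) (ext_set_nreg _ _ _).
  have e4 := ext_trans e3 e34.
  have m4 : same_regs bal_regs s s4 by do 2 apply: same_regs_set => //.
  move E: (run mk_code s4) => s7.
  have [||?? _ ? _] := mk_spec' (l := Node l rl) (r := rr) e4 m4 h0 _ _ E; last by split.
    exact: rep_ext e34 r3.
  by rewrite [nreg s4 _]/= /upd /= f3 //; exact: rep_ext e4 reprr.
case: rl reprl rl0 cmp {lt repr} => [x b|a b] reprl rl0 cmp; first by [].
have [_ [_ repa repb _]] := reprl.
rewrite run_set_seq run_seq; set s2 := set_nreg s1 rB _.
have e2 : ext s s2 by apply: ext_trans e1 (ext_set_nreg _ _ _).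
have m2 : same_regs bal_regs s s2 by apply: same_regs_set.
move E3: (run mk_code s2) => s3.
have [r3 m3 [_ f3] e3 e23] := mk_spec' e2 m2 h0 (rep_ext e2 repl) (rep_ext e2 repa) E3.
rewrite 3!run_set_seq run_seq.
set s4 := set_nreg (set_nreg (set_nreg s3 _ _) _ _) _ _.
have e34 : ext s3 s4.
  by apply: ext_trans (ext_trans (ext_set_nreg _ _ _) (ext_set_nreg _ _ _))
    (ext_set_nreg _ _ _).
have e4 := ext_trans e3 e34.
have m4 : same_regs bal_regs s s4 by do 3 apply: same_regs_set => //.
move E5: (run mk_code s4) => s5.
have [||r5 m5 [_ f5] e5 e45] := mk_spec' (l := b) (r := rr) e4 m4 h0 _ _ E5.
- rewrite [nreg s4 _]/= /upd /= f3 //.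
  have [_ E] := e3; rewrite [nreg s2 _]/=.
  have [-> _] := E (2 + nheap s (1 + nreg s rB))%N ltac:(case: reprl; lia).
  exact: rep_ext e4 repb.
- by rewrite [nreg s4 _]/= /upd /= f3 //; exact: rep_ext e4 reprr.
rewrite 2!run_set_seq; set s6 := set_nreg (set_nreg s5 _ _) _ _.
have e56 : ext s5 s6 by apply: ext_trans (ext_set_nreg _ _ _) (ext_set_nreg _ _ _).
have e6 := ext_trans e5 e56.
have m6 : same_regs bal_regs s s6 by do 2 apply: same_regs_set => //.
move E: (run mk_code s6) => s7.
  have [||?? _ ? _] := mk_spec' (l := Node l a) (r := Node b rr) e6 m6 h0 _ _ E; last by split.
  rewrite [nreg s6 _]/= /upd /= f5 //.
  exact: rep_ext (ext_trans e45 e56) (rep_ext e34 r3).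
exact: rep_ext e56 r5.
Qed.

Lemma bal_spec s l r : isleaf s 0 (sen R) ->
  rep s (nreg s rA) l -> rep s (nreg s rB) r ->
  forall s', s' = run bal_code s ->
  [/\ rep s' (nreg s' rCUR) (bal l r), same_regs bal_regs s s' & ext s s'].
Proof.
move=> h0 repl repr.
have [[l0 _ _ _] _] := rep_fields repl; have [[r0 _ _ _] _] := rep_fields repr.
move=> _ ->; rewrite /bal_code 2!run_if [X in if X then _ else _]/=.
rewrite [X in if _ then if X then _ else _ else _]/= l0 r0 /bal !add1n.
case: leqP => c1; last exact: (rotr_spec h0).
case: leqP => c2; last exact: (rotl_spec h0).
have [h1 h2 h3] := mk_spec h0 repl repr; split => //.
exact: same_regs_sub h2.
Qed.

End Balance.
Transparent mk_code.

(** * Ascent along a path, and the elementary steps of the descent *)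

Section Traversals.
Variable R : realType.
Implicit Types (s : state R) (x y k : job R) (t l r : tree R).

Opaque mk_code bal_code.

Definition asc_regs := bal_regs ++ [:: rPATH; rROOT].

Lemma asc_body_spec s d u P t : isleaf s 0 (sen R) ->
  rep s (nreg s rCUR) t -> frames s (nreg s rPATH) ((d, u) :: P) ->
  forall s', run asc_body s = s' ->
  [/\ rep s' (nreg s' rCUR) (if d then bal u t else bal t u),
      frames s' (nreg s' rPATH) P, same_regs asc_regs s s' & ext s s'].
Proof.
move=> h0 rt [p0 ple ru dd fP] s'; rewrite /asc_body run_seq run_if run_set_seq.
have -> : teval s (TNEq (AFld 1 rPATH) (ACst 1)) = d by rewrite /= dd; case: (d).
set s1 := if d then _ else _; set s2 := set_nreg s1 _ _.
have e1 : ext s s1.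
  by rewrite /s1; case: (d); rewrite run_seq !run_set;
    apply: ext_trans (ext_set_nreg _ _ _) (ext_set_nreg _ _ _).
have e2 : ext s s2 by apply: ext_trans e1 (ext_set_nreg _ _ _).
have m1 : same_regs asc_regs s s1.
  by rewrite /s1; case: (d); rewrite run_seq !run_set; do 2 apply: same_regs_set => //.
have m2 : same_regs asc_regs s s2 by apply: same_regs_set.
have p2 : nreg s2 rPATH = nheap s (2 + nreg s rPATH) by rewrite /s2 /s1; case: (d).
have [ra rb] : rep s2 (nreg s2 rA) (if d then u else t) /\
               rep s2 (nreg s2 rB) (if d then t else u).
  have ru' := rep_ext e2 ru; have rt' := rep_ext e2 rt.
  have -> : nreg s2 rA = if d then nheap s (0 + nreg s rPATH) else nreg s rCUR.
    by rewrite /s2 /s1; case: (d).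
  have -> : nreg s2 rB = if d then nreg s rCUR else nheap s (0 + nreg s rPATH).
    by rewrite /s2 /s1; case: (d).
  by clearbody s2; case: (d); split.
move=> E; have [h1 h2 h3] := bal_spec (isleaf_ext e2 h0) ra rb (esym E).
have e := ext_trans e2 h3; split => //.
- by move: h1; case: (d).
- have [_ f] := h2; rewrite f // p2; exact: frames_ext e fP.
- apply: same_regs_trans m2 (same_regs_sub _ h2) => //.
Qed.

Definition asc_cost : nat :=
  ((bcost (tcomp asc_test) + maxcost asc_body).+1 + maxcost (rROOT ::= rCUR))%N.

Lemma asc_spec s P t n : isleaf s 0 (sen R) ->
  rep s (nreg s rCUR) t -> frames s (nreg s rPATH) P -> (size P <= n)%N ->
  wp asc_code s (asc_cost * n.+1)
    (fun s' => rep s' (nreg s' rROOT) (up P t) /\ same_regs asc_regs s s').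
Proof.
move=> h0 rt fP le.
pose I (k : nat) s' := [/\ ext s s', same_regs asc_regs s s' &
  exists t' P', [/\ rep s' (nreg s' rCUR) t', frames s' (nreg s' rPATH) P',
    size P' = k & up P' t' = up P t]].
pose Q s' := rep s' (nreg s' rCUR) (up P t) /\ same_regs asc_regs s s'.
have L : wp (CWhile asc_test asc_body) s
    ((size P).+1 * (bcost (tcomp asc_test) + maxcost asc_body).+1) Q.
  apply: (@wp_while _ I) => //.
  - by split => //; exists t, P.
  - move=> k s' [ex sm [t' [[|[d u] P'] [rt' fP' sz eq]]]] /=.
      by rewrite fP'.
    move=> _; exists (size P'); first by rewrite -sz.
    apply: wp_run => //; move E: (run asc_body s') => s2.
    have [h1 h2 h3 h4] := asc_body_spec (isleaf_ext ex h0) rt' fP' E.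
    split; [exact: ext_trans h4|exact: same_regs_trans h3|].
    by exists (if d then bal u t' else bal t' u), P'; split => //; rewrite -eq.
  - move=> k s' [ex sm [t' [[|[d u] P'] [rt' fP' sz eq]]]] /=.
      by move=> _; rewrite /Q -eq; split.
    by case: fP' => /eqP/negPf->.
apply: wp_weak (wp_seq (T2 := maxcost (rROOT ::= rCUR)) (Q := fun s' =>
  rep s' (nreg s' rROOT) (up P t) /\ same_regs asc_regs s s') _) _ _; last by [].
  apply: wp_weak L (leqnn _) _ => s1 e1 [h1 h2] _.
  apply: wp_run => //; rewrite run_set; split; last exact: same_regs_set.
  by apply: rep_ext h1; apply: ext_set_nreg.
rewrite /asc_cost; move: (bcost _ + _).+1%N (maxcost (rROOT ::= rCUR)) => a b.
rewrite mulnC mulnDl; apply: leq_add; first by rewrite leq_mul2l ltnS le orbT.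
by rewrite leq_pmulr.
Qed.

Lemma push_spec s u P (d : bool) : rep s (nreg s rA) u -> nreg s rB = d ->
  frames s (nreg s rPATH) P ->
  let s' := run (CNew [:: rA; rB; rPATH] [::] ;; rPATH ::= rHP) s in
  [/\ frames s' (nreg s' rPATH) ((d, u) :: P), ext s s' &
    same_regs [:: rHP; rPATH] s s'].
Proof.
move=> ru dd fP s'; have [ex _] := exec_run (c := CNew [:: rA; rB; rPATH] [::] ;; rPATH ::= rHP) s isT.
have F j : (j < 3)%N -> nheap s' (j + (nreg s rHP + 8)) = _ :=
  @alloc_field R s [:: rA; rB; rPATH] [::] j.
split => //.
  have -> : nreg s' rPATH = (nreg s rHP + 8)%N by [].
  split; rewrite ?F //; [by rewrite addnC|exact: rep_ext ex ru|].
  exact: frames_ext ex fP.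
by split => // q; rewrite !inE negb_or /= /upd => /andP[/negPf-> /negPf->].
Qed.

Lemma first_best_spec s e x o : opt_ptr s (nreg s rSB) o ->
  isleaf s (aval s e) x -> aval s e <> 0%N ->
  let s' := run (first_best e) s in
  opt_ptr s' (nreg s' rSB) (Some (if o is Some y then bmin x y else x)) /\
  same_regs [:: rSB] s s'.
Proof.
move=> ho hx ne s'; have sm : same_regs [:: rSB] s s' by exact: same_regs_set.
split => //; have ex : ext s s' by exact: ext_set_nreg.
apply: opt_ptr_ext ex _.
have [_ _ _ h1 h2] := hx; rewrite /= /upd /= h1 h2.
case: o ho => [y|] /= => [[n0 hy]|->] /=; last by split.
have [_ _ _ g1 g2] := hy; rewrite g1 g2 negb_and !negbK (introF eqP n0) /=.
by rewrite /bmin /finish; case: ifP => _; split.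
Qed.

Lemma last_border_spec s e ks ks' : isleaf s 0 (sen R) ->
  border_ptr s (nreg s rPB) (lastb ks) ->
  border_ptr s (nheap s (4 + aval s e)) (lastb ks') ->
  let s' := run (last_border e) s in
  border_ptr s' (nreg s' rPB) (lastb (ks ++ ks')) /\ same_regs [:: rPB] s s'.
Proof.
move=> h0 h1 h2 s'; have sm : same_regs [:: rPB] s s' by exact: same_regs_set.
split => //; have ex : ext s s' by exact: ext_set_nreg.
apply: border_ptr_ext ex _; rewrite /= /upd /= (border_ptr0 h0 h2) lastb_cat.
by case: ifP.
Qed.

End Traversals.
Transparent mk_code bal_code.

(** * Search for a key *)

Section Descent.
Variable R : realType.
Implicit Types (s : state R) (x y k : job R) (t l r : tree R).

Definition desc_regs := [:: rHP; rCUR; rPATH; rSB; rPB; rA; rB].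

(** The loop invariant of the descent: the siblings stored in the path are the parts of the tree
    already known to lie before or after [k], and [rPB] and [rSB] summarize them. *)
Definition located s k (P : seq (bool * tree R)) t : Prop :=
  [/\ rep s (nreg s rCUR) t, frames s (nreg s rPATH) P,
      all (fun z => jlt z.1 k) (pre P), all (fun z => jlt k z.1) (post P) &
      opt_ptr s (nreg s rSB) (bestq (unzip1 (post P))) /\
      border_ptr s (nreg s rPB) (lastb (unzip1 (pre P)))].

Lemma plug_node_keys P l r :
  keys (plug P (Node l r)) =
  unzip1 (pre P) ++ (keys l ++ keys r) ++ unzip1 (post P).
Proof. by rewrite /keys leaves_plug /unzip1 !map_cat. Qed.

Lemma plug_node_split P l r k : sorted (@jlt R) (keys (plug P (Node l r))) ->
  if jlt (maxl l) k then all (fun z => jlt z.1 k) (leaves l)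
  else all (fun z => jlt k z.1) (leaves r).
Proof.
rewrite plug_node_keys (sorted_pairwise (@jlt_trans R)) pairwise_cat.
rewrite (pairwise_cat _ (keys l ++ _)) (pairwise_cat _ (keys l)).
move=> /and3P[_ _ /and3P[_ /and3P[/allrelP lr sl _] _]].
rewrite -(sorted_pairwise (@jlt_trans R)) in sl.
case: ifPn => lt; apply/allP => -[y b] yin /=.
  have /(maxl_max sl)/orP[/eqP->//|] : y \in keys l.
    by apply/mapP; exists (y, b).
  by move=> lty; apply: jlt_trans lt.
have ylt : jlt (maxl l) y by apply: lr; [exact: maxl_in|apply/mapP; exists (y, b)].
have [<-//|ne] := eqVneq (maxl l) k.
exact: jlt_trans (jlt_total ne lt) ylt.
Qed.

Lemma desc_body_spec s k P l r : isleaf s 0 (sen R) -> key_is s k ->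
  ~~ jlt k (sen R) -> sorted (@jlt R) (keys (plug P (Node l r))) ->
  located s k P (Node l r) ->
  let s' := run desc_body s in
  [/\ same_regs desc_regs s s', ext s s' &
    located s' k (if jlt (maxl l) k then (true, l) :: P else (false, r) :: P)
      (if jlt (maxl l) k then r else l)].
Proof.
move=> h0 hk sk srt [hc hf a1 a2 [hb hp]].
have [_ [_ rl rr _]] := hc.
have [[_ _ lmx _] llb] := rep_fields rl; have [[_ rbst _ _] _] := rep_fields rr.
move: (plug_node_split k srt); move=> spl s'.
have [ex _] : ext s s' /\ _ := exec_run (c := desc_body) s isT.
have Es' : s' = run desc_body s by []; move: (s') Es' ex => {}s'.
rewrite /desc_body run_seq run_if (lt_keyE hk (e := mxl (lft rCUR)) lmx).
case: ifP spl => cmp spl.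
- rewrite [run (last_border _ ;; _) _]run_seq 2!run_set_seq [run (rCUR ::= _) _]run_set.
  set s0 := run _ s; set s1 := set_nreg _ _ _.
  have [pb1 sm1] := last_border_spec (e := lft rCUR) h0 hp llb.
  have e1 : ext s s1 by [].
  have [] := @push_spec R s1 l P true (rep_ext e1 rl) erefl (frames_ext e1 hf).
  move=> h1 h2 h3 Es ex; rewrite -Es in h1 h2 h3.
  have sm : same_regs desc_regs s s'.
    apply: same_regs_trans (same_regs_sub _ h3) => //.
    by do 3 apply: same_regs_set => //; apply: same_regs_sub sm1.
  split => //; split => //=.
  + by have [_ ->] := h3; last by []; exact: rep_ext ex rr.
  + by rewrite all_cat a1.
  + split; have [_ f] := h3; rewrite !f //.
      exact: opt_ptr_ext ex hb.
    rewrite /unzip1 map_cat; apply: border_ptr_ext h2 _; exact: pb1.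
- rewrite [run (first_best _ ;; _) _]run_seq 2!run_set_seq [run (rCUR ::= _) _]run_set.
  (* The best leaf on the right comes after [k] and so is not [sen]; its address is therefore not 0
     and cannot be mistaken for [None]. *)
  have ne : best r != sen R.
    have /mapP[[y b] yin ->] := best_in r; have /= ky := allP spl _ yin.
    by apply: contraNneq sk => <-.
  set s0 := run _ s; set s1 := set_nreg _ _ _.
  have [sb1 sm1] := first_best_spec (e := bst (rgt rCUR)) hb rbst (isleaf_neq0 h0 rbst ne).
  have e1 : ext s s1 by [].
  have [] := @push_spec R s1 r P false (rep_ext e1 rr) erefl (frames_ext e1 hf).
  move=> h1 h2 h3 Es ex; rewrite -Es in h1 h2 h3.
  have sm : same_regs desc_regs s s'.
    apply: same_regs_trans (same_regs_sub _ h3) => //.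
    by do 3 apply: same_regs_set => //; apply: same_regs_sub sm1.
  split => //; split => //=.
  + by have [_ ->] := h3; last by []; exact: rep_ext ex rl.
  + by rewrite cats0.
  + by rewrite all_cat spl.
  + split; have [_ f] := h3; rewrite !f //; last first.
      by rewrite cats0; apply: border_ptr_ext ex hp.
    apply: opt_ptr_ext h2 _; rewrite /unzip1 map_cat.
    rewrite (bestq_keys r (unzip1 (post P))); exact: sb1.
Qed.

Definition desc_loop_cost : nat := (bcost (tcomp desc_test) + maxcost desc_body).+1.

Definition desc_cost : nat :=
  (maxcost desc_init + (desc_loop_cost + maxcost desc_fin))%N.

Definition desc_post s0 k t s : Prop :=
  [/\ same_regs desc_regs s0 s,
      exists x b P, plug P (Leaf x b) = t /\ [/\ rep s (nreg s rCUR) (Leaf x b),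
        frames s (nreg s rPATH) P, all (fun z => jlt z.1 k) (pre P) &
        all (fun z => jlt k z.1) (post P)],
      opt_ptr s (nreg s rSB) (bestq [seq y <- keys t | jlt k y]) &
      border_ptr s (nreg s rPB) (lastb [seq y <- keys t | jlt y k])].

Lemma desc_loop_spec s k P t n : isleaf s 0 (sen R) -> key_is s k ->
  ~~ jlt k (sen R) -> sorted (@jlt R) (keys (plug P t)) ->
  located s k P t -> (height t <= n)%N ->
  wp (CWhile desc_test desc_body) s (n.+1 * desc_loop_cost)
    (fun s' => same_regs desc_regs s s' /\
      exists x b P', plug P' (Leaf x b) = plug P t /\ located s' k P' (Leaf x b)).
Proof.
move=> h0 hk sk srt loc le.
pose I (j : nat) s' := [/\ ext s s', same_regs desc_regs s s' &
  exists t' P', [/\ plug P' t' = plug P t, located s' k P' t' & (height t' <= j)%N]].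
apply: (@wp_while _ I) => //.
- by split => //; exists t, P.
- move=> j s' [ex sm [t' [P' [eq loc' lej]]]].
  have [rt _ _ _ _] := loc'; have [[ht _ _ _] _] := rep_fields rt.
  rewrite /= ht -ltnNge; case: t' eq loc' lej {rt ht} => [//|l r] eq loc' lej _.
  exists j.-1; first by move: lej => /=; lia.
  have hk' : key_is s' k by have [x f] := sm; have [? ? ?] := hk; split; rewrite ?x ?f.
  have srt' : sorted (@jlt R) (keys (plug P' (Node l r))) by rewrite eq.
  have [h1 h2 h3] := desc_body_spec (isleaf_ext ex h0) hk' sk srt' loc'.
  apply: wp_run => //; split; [exact: ext_trans h2|exact: same_regs_trans h1|].
  exists (if jlt (maxl l) k then r else l),
    (if jlt (maxl l) k then (true, l) :: P' else (false, r) :: P'); split => //.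
    by rewrite -eq; case: ifP.
  by move: lej => /=; case: ifP => _; lia.
- move=> j s' [ex sm [t' [P' [eq loc' lej]]]].
  have [rt _ _ _ _] := loc'; have [[ht _ _ _] _] := rep_fields rt.
  rewrite /= ht negbK leqn0; case: t' eq loc' {lej rt ht} => [x b|//] eq loc' _.
  by split => //; exists x, b, P'.
Qed.

Lemma located_filters P x b k :
  all (fun y : job R * bool => jlt y.1 k) (pre P) ->
  all (fun y : job R * bool => jlt k y.1) (post P) ->
  [seq y <- keys (plug P (Leaf x b)) | jlt k y] =
    (if jlt k x then [:: x] else [::]) ++ unzip1 (post P) /\
  [seq y <- keys (plug P (Leaf x b)) | jlt y k] =
    unzip1 (pre P) ++ (if jlt x k then [:: x] else [::]).
Proof.
move=> a1 a2; rewrite /keys leaves_plug /unzip1 !map_cat !filter_cat /=.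
have F1 : [seq y <- [seq i.1 | i <- pre P] | jlt k y] = [::].
  apply/eqP; rewrite -[_ == _]negbK -has_filter; apply/hasPn => y /mapP[z /(allP a1) zk ->].
  by apply/negP => /(jlt_asym zk).
have F2 : [seq y <- [seq i.1 | i <- pre P] | jlt y k] = [seq i.1 | i <- pre P].
  by apply/all_filterP; rewrite all_map.
have F3 : [seq y <- [seq i.1 | i <- post P] | jlt y k] = [::].
  apply/eqP; rewrite -[_ == _]negbK -has_filter; apply/hasPn => y /mapP[z /(allP a2) zk ->].
  by apply/negP => /(jlt_asym zk).
have F4 : [seq y <- [seq i.1 | i <- post P] | jlt k y] = [seq i.1 | i <- post P].
  by apply/all_filterP; rewrite all_map.
by rewrite F1 F2 F3 F4 cats0.
Qed.

Lemma desc_spec s k t n : isleaf s 0 (sen R) -> key_is s k ->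
  ~~ jlt k (sen R) -> sorted (@jlt R) (keys t) ->
  rep s (nreg s rROOT) t -> (height t <= n)%N ->
  wp desc_code s (desc_cost * n.+1) (desc_post s k t).
Proof.
move=> h0 hk sk srt rt le.
apply: (@wp_weak _ _ _ (maxcost desc_init + (n.+1 * desc_loop_cost + maxcost desc_fin)) _
  (desc_post s k t)) => //; last first.
  rewrite /desc_cost; move: (maxcost desc_init) desc_loop_cost (maxcost desc_fin).
  by move=> a b c; rewrite !mulnDl (mulnC b) !leq_add // leq_pmulr.
apply: wp_seq; apply: wp_run => //; set s1 := run _ s => e1.
have m1 : same_regs desc_regs s s1 by do 4 apply: same_regs_set => //.
have hk1 : key_is s1 k by have [x f] := m1; have [? ? ?] := hk; split; rewrite ?x ?f.
apply: wp_seq.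
have L : located s1 k [::] t.
  split => //; first exact: rep_ext e1 rt.
  by split => //; rewrite /border_ptr eqxx.
have D := desc_loop_spec (P := [::]) (isleaf_ext e1 h0) hk1 sk srt L le.
apply: wp_weak D (leqnn _) _.
move=> s2 e2 [m2 [x [b [P [eq [rx fP a1 a2 [hb hp]]]]]]] _.
have e12 := ext_trans e1 e2; have h02 := isleaf_ext e12 h0.
have hk2 : key_is s2 k by have [z f] := m2; have [? ? ?] := hk1; split; rewrite ?z ?f.
have isx : isleaf s2 (nreg s2 rCUR) x by case: rx => _ [].
have [[_ _ _ _] lbx] := rep_fields rx.
apply: wp_run => //.
have [e23 _] := exec_run (c := desc_fin) s2 isT; move: e23.
rewrite /desc_fin run_seq; set s3 := run _ s2; set s4 := run _ s3 => e24.
have [E1 E2] := located_filters x b a1 a2; rewrite eq /= in E1 E2.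
have [q3 [x3 f3] b3] : [/\ opt_ptr s3 (nreg s3 rSB) (bestq [seq y <- keys t | jlt k y]),
    same_regs [:: rSB] s2 s3 & ext s2 s3].
  rewrite /s3 run_if (key_ltE hk2 (e := rCUR) isx) E1.
  case: ifP => kx; last by split.
  have ne : x != sen R.
    by apply: contraNneq sk => <-.
  have [q1 q2] := first_best_spec (e := rCUR) hb isx (isleaf_neq0 h02 isx ne).
  by split => //; apply: ext_set_nreg.
have hk3 : key_is s3 k by have [? ? ?] := hk2; split; rewrite ?x3 ?f3.
have isx3 : isleaf s3 (nreg s3 rCUR) x by rewrite f3 //; apply: isleaf_ext isx.
have [q4 [x4 f4] b4] : [/\ border_ptr s4 (nreg s4 rPB) (lastb [seq y <- keys t | jlt y k]),
    same_regs [:: rPB] s3 s4 & ext s3 s4].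
  rewrite /s4 run_if (lt_keyE hk3 (e := rCUR) isx3) E2.
  have hp3 : border_ptr s3 (nreg s3 rPB) (lastb (unzip1 (pre P))).
    by rewrite f3 //; apply: border_ptr_ext hp.
  case: ifP => kx; last by rewrite cats0; split.
  have lbx3 : border_ptr s3 (nheap s3 (4 + nreg s3 rCUR)) (lastb [:: x]).
    have [_ F] := b3; have [-> _] := F (4 + nreg s3 rCUR)%N ltac:(rewrite f3 //; case: isx; lia).
    by rewrite f3 //; apply: border_ptr_ext lbx.
  have [q1 q2] := last_border_spec (e := rCUR) (isleaf_ext b3 h02) hp3 lbx3.
  by split => //; apply: ext_set_nreg.
split => //.
- apply: same_regs_trans m1 _; apply: same_regs_trans m2 _.
  by split; [rewrite x4 x3|move=> q; rewrite !inE => h; rewrite f4 ?f3 // ?inE;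
    apply: contra h => /eqP->].
- exists x, b, P; split => //; split => //; rewrite f4 // f3 //.
    exact: rep_ext e24 rx.
  exact: frames_ext e24 fP.
- by rewrite f4 //; apply: opt_ptr_ext b4 q3.
Qed.

End Descent.

(** * A dictionary of marked keys *)

Section Dictionary.
Variable R : realType.
Implicit Types (s : state R) (x y k : job R) (t l r : tree R).
Implicit Types (ks : seq (job R)) (mu : job R -> bool).

Opaque mk_code bal_code.

(** From here on the tree is known only through its sorted keys and a marking. As a leaf-oriented
    tree cannot be empty, [sen] is always among the keys. *)
Definition holds s ks mu : Prop :=
  [/\ isleaf s 0 (sen R), sorted (@jlt R) ks, sen R \in ks &
    exists t, [/\ rep s (nreg s rROOT) t, avl t, keys t = ks &
      all (fun z => z.2 == mu z.1) (leaves t)]].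

Definition dict_regs := desc_regs ++ asc_regs.

Lemma holds_size t ks N : keys t = ks -> (size ks <= N)%N -> avl t ->
  (height t <= hbound N)%N.
Proof. by move=> <-; rewrite size_map => le av; apply: avl_height. Qed.

Lemma holds_ext s s' ks mu : ext s s' -> nreg s' rROOT = nreg s rROOT ->
  holds s ks mu -> holds s' ks mu.
Proof.
move=> ex e [h0 st sin [t [h1 h2 h3 h4]]]; split => //.
  exact: isleaf_ext h0.
by exists t; split => //; rewrite e; apply: rep_ext h1.
Qed.

Lemma lookup_spec s ks mu k N : holds s ks mu -> key_is s k -> ~~ jlt k (sen R) ->
  (size ks <= N)%N ->
  wp desc_code s (desc_cost * (hbound N).+1) (fun s' =>
    [/\ holds s' ks mu, same_regs desc_regs s s',
        opt_ptr s' (nreg s' rSB) (bestq [seq y <- ks | jlt k y]),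
        border_ptr s' (nreg s' rPB) (lastb [seq y <- ks | jlt y k]) &
        exists x, [/\ isleaf s' (nreg s' rCUR) x, x \in ks,
          nheap s' (6 + nreg s' rCUR) = mu x & k \in ks -> x = k]]).
Proof.
move=> H hk sk le; have [h0 st sin [t [rt av kt mt]]] := H.
rewrite -kt in st.
apply: wp_weak (desc_spec h0 hk sk st rt (holds_size kt le av)) (leqnn _) _.
move=> s' ex [sm [x [b [P [eq [rx fP a1 a2]]]]] h1 h2]; rewrite kt in h1 h2.
have lv : leaves t = pre P ++ (x, b) :: post P by rewrite -eq leaves_plug.
split => //.
  by apply: holds_ext ex _ H; have [_ ->] := sm.
exists x; split.
- by case: rx => _ [].
- by rewrite -kt /keys lv /unzip1 map_cat mem_cat inE eqxx orbT.
- case: rx => _ [_ [_ _ _ ->]]; move: mt; rewrite lv all_cat /= => /and3P[_ /eqP -> _].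
  by [].
rewrite -kt /keys lv /unzip1 map_cat mem_cat inE => /or3P[|/eqP->//|].
  by move=> /mapP[z /(allP a1) zk e]; rewrite -e jlt_irr in zk.
by move=> /mapP[z /(allP a2) zk e]; rewrite -e jlt_irr in zk.
Qed.

Lemma leaf_spec s k (b : bool) : key_is s k -> k != sen R -> nreg s rKIND = b ->
  forall s', run leaf_code s = s' ->
  [/\ rep s' (nreg s' rHP) (Leaf k b), ext s s' &
      same_regs [:: rHP; rH; rLB] s s'].
Proof.
move=> [k1 k2 k3] ks kb s' E.
have [ex _] := exec_run (c := leaf_code) s isT; rewrite E in ex.
have sm : same_regs [:: rHP; rH; rLB] s s'.
  rewrite -E; split => // q; rewrite !inE !negb_or => /and3P[/negPf q1 /negPf q2 /negPf q3].
  by rewrite /= /upd q1 q2 q3.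
split => //.
move: E; rewrite /leaf_code run_set_seq run_seq.
set s1 := run (CSel _ _ _ _) _ => E.
have N j : (j < 7)%N -> nheap s' (j + (nreg s1 rHP + 8)) =
    upd (nreg s1) rHP (nreg s1 rHP + 8)%N
      (nth 0%N [:: rH; rKB; rH; rHP; rLB; rHP; rKIND] j).
  by move=> h; rewrite -E; apply: (@alloc_field R s1 [:: rH; rKB; rH; rHP; rLB; rHP; rKIND] [:: xKS; xKL]).
have X j : (j < 2)%N -> rheap s' (j + (nreg s1 rHP + 8)) = rreg s1 (nth 0%N [:: xKS; xKL] j).
  by move=> h; rewrite -E; apply: (@alloc_xfield R s1 [:: rH; rKB; rH; rHP; rLB; rHP; rKIND] [:: xKS; xKL]).
have hp : nreg s' rHP = (nreg s1 rHP + 8)%N by rewrite -E.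
rewrite /= /isleaf hp !N // !X //= /upd /= k1 k2 k3 kb; split => //; split=> //.
(* The test start + length = start amounts to length 0, and [k] is not [sen]: together this is
   [isb]. *)
split => //; rewrite /isb ks andbT -subr_eq0 addrAC subrr add0r.
by case: eqP.
Qed.

Lemma sorted_replace (a m m' c : seq (job R)) :
  sorted (@jlt R) (a ++ m ++ c) -> sorted (@jlt R) m' ->
  (forall y, y \in m' -> all (fun z => jlt z y) a /\ all (jlt y) c) ->
  sorted (@jlt R) (a ++ m' ++ c).
Proof.
rewrite !(sorted_pairwise (@jlt_trans R)) !pairwise_cat !allrel_catr.
move=> /and3P[/andP[_ ac] pa /and3P[_ _ pc]] pm H; rewrite ac pa pc pm /= !andbT.
apply/andP; split; apply/allrelP => y z yin zin.
  by have [/allP h _] := H z zin; apply: h.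
by have [_ /allP h] := H y yin; apply: h.
Qed.

Lemma sorted_mid (a c : seq (job R)) x : sorted (@jlt R) (a ++ x :: c) ->
  all (fun z => jlt z x) a /\ all (jlt x) c.
Proof.
rewrite (sorted_pairwise (@jlt_trans R)) pairwise_cat /=.
move=> /and3P[/allrelP ax _ /andP[xc _]]; split => //.
by apply/allP => z zin; apply: ax => //; rewrite inE eqxx.
Qed.

(** The common last stage of insertion, marking and deletion: at the end of the path, [t0] has been
    exchanged for [t]. *)
Lemma finish_update s s0 t0 t P mu N : isleaf s 0 (sen R) ->
  same_regs dict_regs s0 s ->
  rep s (nreg s rCUR) t -> frames s (nreg s rPATH) P ->
  avl (plug P t0) -> avl t -> (height t <= (height t0).+1)%N ->
  (height t0 <= (height t).+1)%N -> (size P <= hbound N)%N ->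
  let L := pre P ++ leaves t ++ post P in
  all (fun z => z.2 == mu z.1) L -> sorted (@jlt R) (unzip1 L) ->
  sen R \in unzip1 L ->
  wp asc_code s (asc_cost * (hbound N).+1)
    (fun s' => holds s' (unzip1 L) mu /\ same_regs dict_regs s0 s').
Proof.
move=> h0 sm0 rt fP ap at_ h1 h2 sz L al st sin.
apply: wp_weak (asc_spec h0 rt fP sz) (leqnn _) _ => s' ex [rp sm].
split; last exact: same_regs_trans sm0 (same_regs_sub _ sm).
split => //; first exact: isleaf_ext h0.
by exists (up P t); split => //; rewrite ?(avl_up ap) // /keys leaves_up.
Qed.

Lemma pre_lt P k : all (fun z : job R * bool => jlt z.1 k) (pre P) ->
  all (fun y => jlt y k) (unzip1 (pre P)).
Proof. by rewrite all_map. Qed.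

Lemma post_gt P k : all (fun z : job R * bool => jlt k z.1) (post P) ->
  all (jlt k) (unzip1 (post P)).
Proof. by rewrite all_map. Qed.

Definition insert_cost : nat := (desc_cost + (maxcost insert_bottom + asc_cost))%N.

(** It is enough to know the new keys up to [=i], since [holds] makes them sorted by a strict order.
    As the new leaf is given the mark [mu k], the marking function stays the same. *)
Lemma insert_spec s ks mu k N : holds s ks mu -> key_is s k -> jlt (sen R) k ->
  (size ks <= N)%N -> k \notin ks -> nreg s rKIND = mu k ->
  wp insert_code s (insert_cost * (hbound N).+1) (fun s' =>
    same_regs dict_regs s s' /\
    exists2 ks', ks' =i k :: ks & holds s' ks' mu).
Proof.
move=> H hk sk le nin kd; have [h0 st sin [t [rt av kt mt]]] := H.
have sk' : ~~ jlt k (sen R) by apply/negP => /(jlt_asym sk).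
apply: (@wp_weak _ _ _ (desc_cost * (hbound N).+1 +
  (maxcost insert_bottom + asc_cost * (hbound N).+1)) _ _ _); last by move=> s' _; exact: id.
  apply: wp_seq.
  have st' : sorted (@jlt R) (keys t) by rewrite kt.
  apply: wp_weak (desc_spec h0 hk sk' st' rt (holds_size kt le av)) (leqnn _) _.
  move=> s1 e1 [m1 [x [b [P [eq [rx fP a1 a2]]]]] _ _] _.
  have hk1 : key_is s1 k by have [z f] := m1; have [? ? ?] := hk; split; rewrite ?z ?f.
  have lv : leaves t = pre P ++ (x, b) :: post P by rewrite -eq leaves_plug.
  have kx : k != x.
    by apply: contraNneq nin => ->; rewrite -kt /keys lv /unzip1 map_cat mem_cat inE eqxx orbT.
  have ksen : k != sen R by apply: contraTneq sk => ->; rewrite jlt_irr.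
  apply: wp_seq; apply: wp_run => // ; rewrite /insert_bottom run_seq.
  move E2: (run leaf_code s1) => s2.
  have kd1 : nreg s1 rKIND = mu k by have [_ ->] := m1.
  have [rk e2 m2] := leaf_spec hk1 ksen kd1 E2.
  have hk2 : key_is s2 k by have [z f] := m2; have [? ? ?] := hk1; split; rewrite ?z ?f.
  have m02 : same_regs dict_regs s s2.
    by apply: same_regs_trans (same_regs_sub _ m1) (same_regs_sub _ m2).
  have cur2 : nreg s2 rCUR = nreg s1 rCUR by have [_ ->] := m2.
  have rx2 : rep s2 (nreg s2 rCUR) (Leaf x b) by rewrite cur2; apply: rep_ext rx.
  have isx2 : isleaf s2 (nreg s2 rCUR) x by case: rx2 => _ [].
  rewrite run_seq run_if (key_ltE hk2 (e := rCUR) isx2).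
  set s3 := if jlt k x then _ else _.
  have e23 : ext s2 s3.
    by rewrite /s3; case: ifP => _; rewrite run_seq !run_set;
      apply: ext_trans (ext_set_nreg _ _ _) (ext_set_nreg _ _ _).
  have m03 : same_regs dict_regs s s3.
    by rewrite /s3; case: ifP => _; rewrite run_seq !run_set;
      do 2 apply: same_regs_set => //.
  pose l3 := if jlt k x then Leaf k (mu k) else Leaf x b.
  pose r3 := if jlt k x then Leaf x b else Leaf k (mu k).
  have rl3 : rep s3 (nreg s3 rA) l3.
    apply: rep_ext e23 _; rewrite /s3 /l3; case: ifP => _ //.
  have rr3 : rep s3 (nreg s3 rB) r3.
    apply: rep_ext e23 _; rewrite /s3 /r3; case: ifP => _ //.
  have e03 : ext s s3 := ext_trans e1 (ext_trans e2 e23).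
  have pth3 : nreg s3 rPATH = nreg s1 rPATH.
    have <- : nreg s2 rPATH = nreg s1 rPATH by have [_ ->] := m2.
    by rewrite /s3; case: ifP.
  have := mk_spec (isleaf_ext e03 h0) rl3 rr3.
  move: (run mk_code s3) => s4 [r4 m4 e34] _.
  have m04 : same_regs dict_regs s s4.
    by apply: same_regs_trans m03 (same_regs_sub _ m4).
  have f4 : frames s4 (nreg s4 rPATH) P.
    have [_ ->] := m4; last by [].
    by rewrite pth3; apply: frames_ext (ext_trans (ext_trans e2 e23) e34) fP.
  have kmx : [:: k; x] =i keys (Node l3 r3).
    by move=> z; rewrite /l3 /r3; case: ifP => _; rewrite /keys /= !inE // orbC.
  have ap : avl (plug P (Leaf x b)) by rewrite eq.
  have szP : (size P <= hbound N)%N.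
    apply: leq_trans (size_path_plug P (Leaf x b)) _; rewrite eq.
    exact: holds_size kt le av.
  pose L := pre P ++ leaves (Node l3 r3) ++ post P.
  have uL : unzip1 L = unzip1 (pre P) ++ keys (Node l3 r3) ++ unzip1 (post P).
    by rewrite /L /unzip1 map_cat map_cat.
  have memL : unzip1 L =i k :: ks.
    move=> z; rewrite uL -kt [in RHS]/keys lv [in RHS]/unzip1 map_cat !mem_cat -kmx.
    by rewrite !inE mem_cat !inE /=; do !case: (_ \in _); do !case: (_ == _).
  have aL : all (fun z => z.2 == mu z.1) L.
    move: mt; rewrite lv /L !all_cat /= => /and3P[-> hb ->].
    by rewrite andbT /l3 /r3; case: ifP => _ /=; rewrite eqxx hb.
  have sL : sorted (@jlt R) (unzip1 L).
    have st2 : sorted (@jlt R) (unzip1 (pre P) ++ [:: x] ++ unzip1 (post P)).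
      by move: st; rewrite -kt /keys lv /unzip1 map_cat.
    have [xa xc] := sorted_mid st2.
    rewrite uL; apply: sorted_replace st2 _ _.
      rewrite /l3 /r3; case: ifPn => cmp /=; first by rewrite cmp.
      by rewrite (jlt_total kx cmp).
    move=> y; rewrite -kmx !inE => /orP[]/eqP-> //.
    by rewrite pre_lt ?post_gt.
  have sinL : sen R \in unzip1 L by rewrite memL inE sin orbT.
  have at4 : avl (Node l3 r3) by rewrite /l3 /r3; case: ifP.
  have ht : height (Node l3 r3) = 1%N by rewrite /l3 /r3; case: ifP.
  have e4 := ext_trans e03 e34.
  have := @finish_update s4 s (Leaf x b) (Node l3 r3) P mu N (isleaf_ext e4 h0)
    m04 r4 f4 ap at4 _ _ szP aL sL sinL.
  rewrite ht => /(_ isT isT) W; apply: wp_weak W (leqnn _) _ => s5 _ [H5 m5].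
  by split => //; exists (unzip1 L).
rewrite /insert_cost; move: desc_cost (maxcost insert_bottom) asc_cost (hbound N) => a1 a2 a3 h.
by rewrite !mulnDl !leq_add // leq_pmulr.
Qed.

Definition mark_cost : nat := (desc_cost + (maxcost mark_bottom + asc_cost))%N.

Lemma mark_spec s ks mu k N (b : bool) : holds s ks mu -> key_is s k ->
  jlt (sen R) k -> (size ks <= N)%N -> k \in ks -> nreg s rKIND = b ->
  wp mark_code s (mark_cost * (hbound N).+1) (fun s' =>
    same_regs dict_regs s s' /\
    holds s' ks (fun y => if y == k then b else mu y)).
Proof.
move=> H hk sk le kin kd; have [h0 st sin [t [rt av kt mt]]] := H.
have sk' : ~~ jlt k (sen R) by apply/negP => /(jlt_asym sk).
apply: (@wp_weak _ _ _ (desc_cost * (hbound N).+1 +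
  (maxcost mark_bottom + asc_cost * (hbound N).+1)) _ _ _); last by move=> s' _; exact: id.
  apply: wp_seq.
  have st' : sorted (@jlt R) (keys t) by rewrite kt.
  apply: wp_weak (desc_spec h0 hk sk' st' rt (holds_size kt le av)) (leqnn _) _.
  move=> s1 e1 [m1 [x [b0 [P [eq [rx fP a1 a2]]]]] _ _] _.
  have hk1 : key_is s1 k by have [z f] := m1; have [? ? ?] := hk; split; rewrite ?z ?f.
  have lv : leaves t = pre P ++ (x, b0) :: post P by rewrite -eq leaves_plug.
  have kx : k = x.
    move: kin; rewrite -kt /keys lv /unzip1 map_cat mem_cat inE => /or3P[|/eqP->//|].
      by move=> /mapP[z /(allP a1) zk e]; rewrite -e jlt_irr in zk.
    by move=> /mapP[z /(allP a2) zk e]; rewrite -e jlt_irr in zk.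
  have ksen : k != sen R by apply: contraTneq sk => ->; rewrite jlt_irr.
  apply: wp_seq; apply: wp_run => // ; rewrite /mark_bottom run_seq run_set.
  move E2: (run leaf_code s1) => s2.
  have kd1 : nreg s1 rKIND = b by have [_ ->] := m1.
  have [rk e2 m2] := leaf_spec hk1 ksen kd1 E2.
  set s3 := set_nreg _ _ _ => _.
  have e23 : ext s2 s3 by apply: ext_set_nreg.
  have m03 : same_regs dict_regs s s3.
    apply: same_regs_set => //.
    by apply: same_regs_trans (same_regs_sub _ m1) (same_regs_sub _ m2).
  have f3 : frames s3 (nreg s3 rPATH) P.
    have -> : nreg s3 rPATH = nreg s2 rPATH by [].
    by have [_ ->] := m2; last by []; apply: frames_ext (ext_trans e2 e23) fP.
  have r3 : rep s3 (nreg s3 rCUR) (Leaf k b) by apply: rep_ext e23 rk.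
  have ap : avl (plug P (Leaf x b0)) by rewrite eq.
  have szP : (size P <= hbound N)%N.
    apply: leq_trans (size_path_plug P (Leaf x b0)) _; rewrite eq.
    exact: holds_size kt le av.
  have kL : unzip1 (pre P ++ leaves (Leaf k b) ++ post P) = ks.
    by rewrite -kt /keys lv /unzip1 !map_cat kx.
  have := @finish_update s3 s (Leaf x b0) (Leaf k b) P
    (fun y => if y == k then b else mu y) N
    (isleaf_ext (ext_trans e1 (ext_trans e2 e23)) h0) m03 r3 f3 ap isT isT isT szP.
  cbv zeta; rewrite kL => W; apply: wp_weak (W _ st sin) (leqnn _) _; last first.
    by move=> s5 _ [H5 m5].
  have st2 : sorted (@jlt R) (unzip1 (pre P) ++ x :: unzip1 (post P)).
    by move: st; rewrite -kt /keys lv /unzip1 map_cat.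
  have [xa xc] := sorted_mid st2; rewrite -kx !all_map in xa xc.
  move: mt; rewrite lv !all_cat /= eqxx eqxx /= => /and3P[/allP m1' _ /allP m2'].
  apply/andP; split; apply/allP => z zin.
    rewrite ifN; first exact: m1'.
    by apply: contraTneq (allP xa _ zin) => /= ->; rewrite jlt_irr.
  rewrite ifN; first exact: m2'.
  by apply: contraTneq (allP xc _ zin) => /= ->; rewrite jlt_irr.
rewrite /mark_cost; move: desc_cost (maxcost mark_bottom) asc_cost (hbound N) => a1 a2 a3 h.
by rewrite !mulnDl !leq_add // leq_pmulr.
Qed.

Definition delete_cost : nat := (desc_cost + (maxcost delete_bottom + asc_cost))%N.

Lemma delete_spec s ks mu k N : holds s ks mu -> key_is s k ->
  jlt (sen R) k -> (size ks <= N)%N -> k \in ks ->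
  wp delete_code s (delete_cost * (hbound N).+1) (fun s' =>
    same_regs dict_regs s s' /\
    exists2 ks', ks' =i [pred y in ks | y != k] & holds s' ks' mu).
Proof.
move=> H hk sk le kin; have [h0 st sin [t [rt av kt mt]]] := H.
have sk' : ~~ jlt k (sen R) by apply/negP => /(jlt_asym sk).
apply: (@wp_weak _ _ _ (desc_cost * (hbound N).+1 +
  (maxcost delete_bottom + asc_cost * (hbound N).+1)) _ _ _); last by move=> s' _; exact: id.
  apply: wp_seq.
  have st' : sorted (@jlt R) (keys t) by rewrite kt.
  apply: wp_weak (desc_spec h0 hk sk' st' rt (holds_size kt le av)) (leqnn _) _.
  move=> s1 e1 [m1 [x [b0 [P [eq [rx fP a1 a2]]]]] _ _] _.
  have lv : leaves t = pre P ++ (x, b0) :: post P by rewrite -eq leaves_plug.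
  have kx : k = x.
    move: kin; rewrite -kt /keys lv /unzip1 map_cat mem_cat inE => /or3P[|/eqP->//|].
      by move=> /mapP[z /(allP a1) zk e]; rewrite -e jlt_irr in zk.
    by move=> /mapP[z /(allP a2) zk e]; rewrite -e jlt_irr in zk.
  have ksen : k != sen R by apply: contraTneq sk => ->; rewrite jlt_irr.
  (* The path is not empty: otherwise the leaf of [k] would be the whole tree, which also contains
     [sen]. *)
  case: P eq fP a1 a2 lv => [|[d u] P] eq fP a1 a2 lv.
    by move: sin; rewrite -kt /keys lv inE -kx eq_sym (negPf ksen).
  apply: wp_seq; apply: wp_run => // ; rewrite /delete_bottom run_set_seq run_set.
  set s2 := set_nreg _ _ _ => e12.
  have [p0 ple ru _ fP'] := fP.
  have r2 : rep s2 (nreg s2 rCUR) u by apply: rep_ext e12 ru.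
  have f2 : frames s2 (nreg s2 rPATH) P by apply: frames_ext e12 fP'.
  have m02 : same_regs dict_regs s s2.
    by do 2 apply: same_regs_set => //; apply: same_regs_sub m1.
  have ap : avl (plug P (if d then Node u (Leaf x b0) else Node (Leaf x b0) u)).
    by move: (av); rewrite -eq.
  have szP : (size P <= hbound N)%N.
    apply: leq_trans (leqnSn _) _.
    apply: leq_trans (size_path_plug ((d, u) :: P) (Leaf x b0)) _; rewrite eq.
    exact: holds_size kt le av.
  have au := avl_plug ap.
  have EL : pre P ++ leaves u ++ post P = pre ((d, u) :: P) ++ post ((d, u) :: P).
    by rewrite /=; case: (d); rewrite -?catA ?cats0.
  have st2 : sorted (@jlt R) (unzip1 (pre ((d, u) :: P)) ++ [:: x] ++ unzip1 (post ((d, u) :: P))).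
    by move: st; rewrite -kt /keys lv /unzip1 map_cat.
  have memL : unzip1 (pre P ++ leaves u ++ post P) =i [pred y in ks | y != k].
    move=> z; rewrite inE EL -kt /keys lv -kx /unzip1.
    move: (pre _) (post _) a1 a2 => A C a1 a2.
    rewrite !map_cat !mem_cat map_cons inE [(k, _).1]/=.
    have [->|] := eqVneq z k; last by rewrite andbT.
    rewrite andbF; apply/negbTE; rewrite negb_or; apply/andP; split.
      by apply/mapP => -[y /(allP a1) yk e]; rewrite -e jlt_irr in yk.
    by apply/mapP => -[y /(allP a2) yk e]; rewrite -e jlt_irr in yk.
  have aL : all (fun z => z.2 == mu z.1) (pre P ++ leaves u ++ post P).
    move: mt; rewrite EL lv; move: (pre _) (post _) => A C.
    by rewrite !all_cat /= => /and3P[-> _ ->].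
  have sL : sorted (@jlt R) (unzip1 (pre P ++ leaves u ++ post P)).
    rewrite EL; move: (pre _) (post _) st2 => A C st2.
    by rewrite /unzip1 map_cat; apply: (sorted_replace (m' := [::]) st2).
  have sinL : sen R \in unzip1 (pre P ++ leaves u ++ post P).
    by rewrite memL inE sin eq_sym.
  have au' : avl u by move: au; case: (d) => /= /andP[].
  have hh : height (if d then Node u (Leaf x b0) else Node (Leaf x b0) u) = (height u).+1.
    by case: (d) => /=; rewrite ?maxn0 ?max0n.
  have h1 : (height u <= (height (if d then Node u (Leaf x b0) else Node (Leaf x b0) u)).+1)%N.
    by rewrite hh; exact: leq_trans (leqnSn _) (leqnSn _).
  have h2 : (height (if d then Node u (Leaf x b0) else Node (Leaf x b0) u) <= (height u).+1)%N.
    by rewrite hh.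
  have W := @finish_update s2 s _ u P mu N (isleaf_ext (ext_trans e1 e12) h0)
    m02 r2 f2 ap au' h1 h2 szP aL sL sinL.
  apply: wp_weak W (leqnn _) _ => s5 _ [H5 m5].
  by split => //; exists (unzip1 (pre P ++ leaves u ++ post P)).
rewrite /delete_cost; move: desc_cost (maxcost delete_bottom) asc_cost (hbound N) => a1 a2 a3 h.
by rewrite !mulnDl !leq_add // leq_pmulr.
Qed.

End Dictionary.

(** * Greedy walks *)

Section Greedy.
Variable R : realType.
Implicit Types (x y z k b e u : job R) (A B s : seq (job R)).

(** The keys that occur. The label of a border is fixed to 0, so that its time alone determines
    it. *)
Definition wfk x : bool :=
  (0 <= start x) && ((1 <= len x) || ((len x == 0) && (label x == 0)%N)).

Definition border x : bool := len x == 0.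

Definition good A : bool := sorted (@jlt R) A && all wfk A.

Lemma border_job x : border x -> (1 <= len x) = false.
Proof. by move=> /eqP->; rewrite ler10. Qed.

Lemma wfk_job x : wfk x -> ~~ border x -> 1 <= len x.
Proof. by rewrite /wfk /border => /andP[_ /orP[//|/andP[->]]]. Qed.

Lemma wfk_len x : wfk x -> 0 <= len x.
Proof. by move=> /andP[_ /orP[/(le_trans ler01)//|/andP[/eqP->]]]. Qed.

Lemma wfk_border x : wfk x -> ~~ (1 <= len x) -> border x.
Proof. by rewrite /wfk /border => /andP[_ /orP[->|/andP[->]]]. Qed.

Lemma finish_border x : border x -> finish x = start x.
Proof. by move=> /eqP h; rewrite /finish h addr0. Qed.

Lemma start_finish x : 1 <= len x -> start x < finish x.
Proof. by move=> h; rewrite ltrDl (lt_le_trans ltr01). Qed.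

Lemma start_le_finish x : wfk x -> start x <= finish x.
Proof. by move=> /wfk_len h; rewrite lerDl. Qed.

Lemma border_eq x y : wfk x -> wfk y -> border x -> border y ->
  start x = start y -> x = y.
Proof.
move=> wx wy bx by_ e; have [/eqP lx /eqP ly] := (bx, by_).
move: wx wy; rewrite /wfk lx ly ler10 eqxx /= => /andP[_ /eqP l1] /andP[_ /eqP l2].
by apply: job_eq; rewrite ?lx ?ly ?l1 ?l2.
Qed.

Lemma sen_border : border (sen R). Proof. exact: eqxx. Qed.

Lemma sen_wfk : wfk (sen R). Proof. by rewrite /wfk lexx !eqxx orbT. Qed.

Lemma sen_min x : wfk x -> x != sen R -> jlt (sen R) x.
Proof.
move=> wx ne; have /andP[s0 _] := wx; rewrite /jlt /=.
have [//|s1] := ltP 0 (start x).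
have {s1}e : start x = 0 by apply/eqP; rewrite eq_le s0 s1.
rewrite e eqxx /=; have [bx|nb] := boolP (border x); last first.
  by rewrite (lt_le_trans ltr01 (wfk_job wx nb)).
by move: ne; rewrite (border_eq wx sen_wfk bx sen_border e) eqxx.
Qed.

(** With length as the second component of the order, a border precedes the jobs that start at its
    time: these belong to the region it opens. *)
Lemma jlt_border_job b y : border b -> 1 <= len y ->
  jlt b y = (start b <= start y).
Proof.
move=> /eqP lb ly; rewrite /jlt lb (lt_le_trans ltr01 ly) /= andbT.
by rewrite le_eqVlt orbC.
Qed.

Lemma jlt_borders b u : wfk b -> wfk u -> border b -> border u ->
  jlt b u = (start b < start u).
Proof.
move=> wb wu bb bu; rewrite /jlt; case: ltgtP => //= e.
by rewrite (border_eq wb wu bb bu e) ltxx ltnn andbF.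
Qed.

Lemma jlt_job_border y u : border u -> 1 <= len y ->
  jlt y u = (start y < start u).
Proof.
move=> /eqP lu ly; rewrite /jlt lu [len y < 0]ltNge (le_trans ler01 ly) /=.
have -> : (len y == 0) = false by apply/eqP => e; rewrite e ler10 in ly.
by rewrite andbF orbF.
Qed.

(** The strict order that [bmin] minimizes on a sorted list. Among equal finishing times a job
    precedes the border at that time, as it starts earlier, so a job that ends exactly at a border
    is still picked. *)
Definition bl x y : bool :=
  (finish x < finish y) || ((finish x == finish y) && jlt x y).

Lemma bl_asym x y : bl x y -> bl y x -> False.
Proof.
move=> /orP[h|/andP[/eqP h h']] /orP[g|/andP[/eqP g g']].
- by have := lt_trans h g; rewrite ltxx.
- by rewrite g ltxx in h.
- by rewrite h ltxx in g.
- exact: jlt_asym h' g'.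
Qed.

Lemma bl_le x y : bl x y -> finish x <= finish y.
Proof. by move=> /orP[/ltW//|/andP[/eqP->]]. Qed.

Definition isbest s x : Prop :=
  x \in s /\ forall y, y \in s -> y != x -> bl x y.

Lemma isbest_uniq s x y : isbest s x -> isbest s y -> x = y.
Proof.
move=> [xs hx] [ys hy]; apply/eqP; apply: contraT => ne.
by case: (bl_asym (hx _ ys _) (hy _ xs ne)); rewrite eq_sym.
Qed.

Lemma bestq_isbest s : sorted (@jlt R) s ->
  if bestq s is Some x then isbest s x else s = [::].
Proof.
elim: s => [//|x s IH] /= p; have := IH (path_sorted p).
move: (order_path_min (@jlt_trans R) p) => /allP xmin.
case: (bestq s) => [y [ys hy]|->]; last first.
  by split=> [|z]; rewrite inE // => /eqP->; rewrite eqxx.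
rewrite /bmin; case: (leP (finish x) (finish y)) => xy.
  split=> [|z]; rewrite inE ?eqxx // => /orP[/eqP->|zs]; first by rewrite eqxx.
  move=> _; rewrite /bl xmin // andbT orbC -le_eqVlt.
  have [->//|ne] := eqVneq z y; exact: le_trans xy (bl_le (hy _ zs ne)).
split=> [|z]; rewrite inE ?ys ?orbT // => /orP[/eqP->|zs]; last exact: hy.
by rewrite /bl xy.
Qed.

Definition nxt A k : option (job R) := bestq [seq y <- A | jlt k y].

Lemma nxtP A k x : good A -> (nxt A k = Some x) <->
  [/\ x \in A, jlt k x & forall y, y \in A -> jlt k y -> y != x -> bl x y].
Proof.
move=> /andP[sA _]; have := bestq_isbest (sorted_filter (@jlt_trans R) (jlt k) sA).
rewrite /nxt; case: (bestq _) => [z|].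
  move=> hz; split=> [[<-]|[xA kx hx]].
    case: hz; rewrite mem_filter => /andP[kz zA] hz; split => // y yA ky.
    by apply: hz; rewrite mem_filter ky.
  congr Some; apply: isbest_uniq hz _; split; first by rewrite mem_filter kx.
  by move=> y; rewrite mem_filter => /andP[ky yA]; apply: hx.
move=> e; split=> // -[xA kx _]; have : x \in [seq y <- A | jlt k y].
  by rewrite mem_filter kx.
by rewrite e.
Qed.

Lemma nxt_none A k : good A -> nxt A k = None -> forall y, y \in A -> ~~ jlt k y.
Proof.
move=> /andP[sA _]; have := bestq_isbest (sorted_filter (@jlt_trans R) (jlt k) sA).
rewrite /nxt; case: (bestq _) => // e _ y yA; apply/negP => ky.
have : y \in [seq y <- A | jlt k y] by rewrite mem_filter ky.
by rewrite e.
Qed.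

Lemma nxt_some A k y : good A -> y \in A -> jlt k y ->
  exists2 x, nxt A k = Some x & finish x <= finish y.
Proof.
move=> gA yA ky; case e : (nxt A k) => [x|]; last first.
  by have := nxt_none gA e yA; rewrite ky.
exists x => //; have [_ _ h] := (nxtP k x gA).1 e.
by have [->//|ne] := eqVneq y x; apply: bl_le; apply: h.
Qed.

Lemma nxt_cong A B k k' : good A -> good B ->
  (forall y, (y \in A) && jlt k y = (y \in B) && jlt k' y) ->
  nxt A k = nxt B k'.
Proof.
move=> /andP[sA _] /andP[sB _] h; rewrite /nxt; congr bestq.
apply: (irr_sorted_eq (@jlt_trans R) (@jlt_irr R)); rewrite ?sorted_filter //;
  try exact: jlt_trans.
by move=> y; rewrite !mem_filter andbC h andbC.
Qed.

(* Of the well-formed jobs, those after [thr x] start when [x] has finished. *)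
Definition thr x : job R := Job 0 (finish x) (- len x).

Lemma thr_lt x y : 1 <= len x -> wfk y -> jlt (thr x) y = (finish x <= start y).
Proof.
move=> lx wy; rewrite /jlt /=.
have -> : - len x < len y.
  by rewrite (lt_le_trans _ (wfk_len wy)) // oppr_lt0 (lt_le_trans ltr01).
by rewrite /= andbT le_eqVlt orbC.
Qed.

Lemma thr_trans k x y : 1 <= len x -> wfk y -> jlt k x -> jlt (thr x) y -> jlt k y.
Proof.
move=> lx wy kx; rewrite thr_lt // => h; apply: (jlt_trans kx).
by rewrite /jlt (lt_le_trans (start_finish lx) h).
Qed.

(** The walk stops as soon as a border is the next to finish: all jobs left then cross this border
    or start no earlier than it. The argument [n] is fuel, and by [walk_count] the number of keys
    bounds the number of picks. *)
Fixpoint walkn (n : nat) A k : seq (job R) :=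
  if n is n'.+1 then
    if nxt A k is Some x then
      if 1 <= len x then x :: walkn n' A (thr x) else [::]
    else [::]
  else [::].

Definition walk A k : seq (job R) := walkn (size A).+1 A k.

Lemma good_wfk A x : good A -> x \in A -> wfk x.
Proof. by move=> /andP[_ /allP h] /h. Qed.

Lemma walk_count A k x : good A -> nxt A k = Some x -> 1 <= len x ->
  (count (jlt (thr x)) A < count (jlt k) A)%N.
Proof.
move=> gA /nxtP[] // xA kx _ lx; rewrite -!size_filter.
have sub : {subset x :: [seq y <- A | jlt (thr x) y] <= [seq y <- A | jlt k y]}.
  move=> y; rewrite inE => /orP[/eqP->|]; first by rewrite mem_filter kx.
  rewrite !mem_filter => /andP[xy yA]; rewrite yA andbT.
  exact: thr_trans lx (good_wfk gA yA) kx xy.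
apply: (uniq_leq_size _ sub) => /=; rewrite filter_uniq; last first.
  by case/andP: gA => sA _; apply: (sorted_uniq (@jlt_trans R) (@jlt_irr R)).
rewrite mem_filter thr_lt ?(good_wfk gA xA) // negb_and.
by rewrite -ltNge start_finish.
Qed.

Lemma walkn_fuel n m A k : good A -> (count (jlt k) A < n)%N ->
  (count (jlt k) A < m)%N -> walkn n A k = walkn m A k.
Proof.
move=> gA; elim: n m k => [//|n IH] [//|m] k ln lm /=.
case e : (nxt A k) => [x|//]; case: ifP => // lx; congr cons.
have lt := walk_count gA e lx; apply: IH; lia.
Qed.

Lemma walkE A k : good A -> walk A k =
  if nxt A k is Some x then if 1 <= len x then x :: walk A (thr x) else [::]
  else [::].
Proof.
move=> gA; rewrite {1}/walk /=; case e : (nxt A k) => [x|//]; case: ifP => // lx.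
congr cons; have lt := walk_count gA e lx; have := count_size (jlt k) A.
by move=> le; apply: walkn_fuel => //; lia.
Qed.

(** Functional induction for the walk, freed from the fuel. The second case unites both reasons to
    stop: no candidate, or a border as candidate. *)
Lemma walk_indP A (P : job R -> seq (job R) -> Prop) : good A ->
  (forall k x, nxt A k = Some x -> x \in A -> 1 <= len x -> jlt k x ->
     P (thr x) (walk A (thr x)) -> P k (x :: walk A (thr x))) ->
  (forall k, (forall x, nxt A k = Some x -> border x) -> P k [::]) ->
  forall k, P k (walk A k).
Proof.
move=> gA H1 H2 k; have [n] := ubnP (count (jlt k) A); elim: n k => // n IH k le.
rewrite walkE //; case e : (nxt A k) => [x|]; last by apply: H2 => x; rewrite e.
have [xA kx _] := (nxtP k x gA).1 e.
case: ifPn => lx; last first.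
  by apply: H2 => y; rewrite e => -[<-]; apply: wfk_border lx; apply: good_wfk xA.
apply: H1 => //; apply: IH; have := walk_count gA e lx; lia.
Qed.

Lemma walk_in A k x : good A -> x \in walk A k -> [/\ x \in A, 1 <= len x & jlt k x].
Proof.
move=> gA; pose P (k : job R) (w : seq (job R)) := forall x, x \in w -> [/\ x \in A, 1 <= len x & jlt k x].
suff H (k' : job R) : P k' (walk A k') by exact: H.
move: k' => {k x}.
apply: (walk_indP (P := P) gA) => // k x e xA lx kx IH y.
rewrite inE => /orP[/eqP->//|/IH[yA ly xy]]; split => //.
exact: thr_trans lx (good_wfk gA yA) kx xy.
Qed.

Lemma walk_chain A k : good A ->
  pairwise (fun x y => finish x <= start y) (walk A k).
Proof.
move=> gA; pose P (k : job R) (w : seq (job R)) := pairwise (fun x y => finish x <= start y) w.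
suff H (k' : job R) : P k' (walk A k') by exact: (H k).
move: k' => {k}.
apply: (walk_indP (P := P) gA) => // k x e xA lx kx IH; apply/andP; split; last exact: IH.
apply/allP => y /(walk_in gA)[yA ly xy].
by rewrite -thr_lt // (good_wfk gA).
Qed.

Lemma walk_uniq A k : good A -> uniq (walk A k).
Proof.
move=> gA; have := walk_chain k gA; have : all (fun x => 1 <= len x) (walk A k).
  by apply/allP => x /(walk_in gA)[].
elim: (walk A k) => //= x w IH /andP[lx lw] /andP[xw pw]; rewrite IH // andbT.
apply: contraL (start_finish lx) => xin; rewrite -leNgt; exact: (allP xw).
Qed.

(** While [u] lies ahead it is itself a candidate, so whatever is picked finishes no later than [u],
    and [u] still lies ahead of the new threshold. *)
Lemma walk_border A k x u : good A -> x \in walk A k -> u \in A -> border u ->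
  jlt k u -> finish x <= start u.
Proof.
move=> gA xin uA bu; pose P (k : job R) (w : seq (job R)) :=
  forall x, x \in w -> jlt k u -> finish x <= start u.
suff H (k' : job R) : P k' (walk A k') by exact: H xin.
move: k' => {k x xin}.
apply: (walk_indP (P := P) gA) => // k x e xA lx kx IH y yin ku.
have xu : finish x <= start u.
  have [z ez] := nxt_some gA uA ku; rewrite e in ez; case: ez => <-.
  by rewrite (finish_border bu).
move: yin; rewrite inE => /orP[/eqP->//|/IH]; apply.
by rewrite thr_lt // (good_wfk gA).
Qed.

(* Exchange argument: the walk always picks the job that finishes first. *)
Lemma walk_opt A k s : good A -> {subset s <= A} ->
  pairwise (fun x y => finish x <= start y) s ->
  (forall y, y \in s -> 1 <= len y /\ jlt k y) ->
  (forall y u, y \in s -> u \in A -> border u -> jlt k u -> finish y <= start u) ->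
  (size s <= size (walk A k))%N.
Proof.
move=> gA; pose P (k : job R) (w : seq (job R)) := forall s, {subset s <= A} ->
  pairwise (fun x y => finish x <= start y) s ->
  (forall y, y \in s -> 1 <= len y /\ jlt k y) ->
  (forall y u, y \in s -> u \in A -> border u -> jlt k u -> finish y <= start u) ->
  (size s <= size w)%N.
suff H (k' : job R) : P k' (walk A k') by exact: H.
move: k' => {k s}.
apply: (walk_indP (P := P) gA) => [k x e xA lx kx IH|k nb] [|y s] // sA /= /andP[ys ps] Hs Hb.
- rewrite ltnS; apply: IH => //.
  + by move=> z zs; apply: sA; rewrite inE zs orbT.
  + move=> z zs; have zin : z \in y :: s by rewrite inE zs orbT.
    split; first by case: (Hs z zin).
    rewrite thr_lt ?(good_wfk gA (sA _ zin)) //.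
    have yin : y \in y :: s by rewrite inE eqxx.
    have [w ew wy] := nxt_some gA (sA _ yin) (Hs y yin).2.
    by move: ew wy; rewrite e => -[<-] xy; apply: le_trans xy (allP ys _ zs).
  + move=> z u zs uA bu xu; apply: Hb => //; first by rewrite inE zs orbT.
    exact: thr_trans lx (good_wfk gA uA) kx xu.
- have yin : y \in y :: s by rewrite inE eqxx.
  have [ly ky] := Hs y yin.
  have [x e xy] := nxt_some gA (sA _ yin) ky; have bx := nb _ e.
  have [xA kx hx] := (nxtP k x gA).1 e.
  have yx : y != x by apply: contraTneq bx => <-; apply: contraTN ly => /border_job->.
  have := hx _ (sA _ yin) ky yx; rewrite /bl ltNge (finish_border bx).
  rewrite (Hb y x) //= => /andP[/eqP fx]; rewrite jlt_border_job // leNgt.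
  by rewrite fx start_finish.
Qed.

(** The candidate at which the walk stops: the border that ends the region, or [None] in the last
    region. After a walk, [rSB] points to it. *)
Definition wend A k : option (job R) := nxt A (last k [seq thr x | x <- walk A k]).

Lemma wendE A k x : good A -> nxt A k = Some x -> 1 <= len x ->
  wend A k = wend A (thr x).
Proof. by move=> gA e lx; rewrite {1}/wend walkE // e lx. Qed.

Lemma wend0 A k : walk A k = [::] -> wend A k = nxt A k.
Proof. by rewrite /wend => ->. Qed.

Lemma wendP A k : good A ->
  if wend A k is Some e then [/\ e \in A, border e, jlt k e &
    forall u, u \in A -> border u -> jlt k u -> start e <= start u]
  else forall u, u \in A -> border u -> ~~ jlt k u.
Proof.
move=> gA; have [n] := ubnP (count (jlt k) A); elim: n k => // n IH k le.
case e : (nxt A k) => [x|]; last first.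
  rewrite wend0; last by rewrite walkE // e.
  by rewrite e => u uA _; apply: nxt_none e _ uA.
have [xA kx hx] := (nxtP k x gA).1 e.
case: (boolP (1 <= len x)) => lx; last first.
  have bx := wfk_border (good_wfk gA xA) lx.
  rewrite wend0; last by rewrite walkE // e (negPf lx).
  rewrite e; split => // u uA bu ku; have [->//|ne] := eqVneq u x.
  by have := bl_le (hx _ uA ku ne); rewrite !finish_border.
have xu u : u \in A -> border u -> jlt k u -> jlt (thr x) u.
  move=> uA bu ku; rewrite thr_lt ?(good_wfk gA uA) //.
  by apply: (walk_border gA _ uA bu ku); rewrite walkE // e lx inE eqxx.
rewrite (wendE gA e lx); have lt := walk_count gA e lx.
have {lt le} := IH (thr x) (leq_trans lt le).
case: (wend A (thr x)) => [f [fA bf xf hf]|h u uA bu].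
  split => //; first exact: thr_trans lx (good_wfk gA fA) kx xf.
  by move=> u uA bu ku; apply: hf => //; apply: xu.
apply: contra (h u uA bu); exact: xu.
Qed.

(** Each step looks only at the keys after its threshold, and these are among the keys after the
    starting point. *)
Lemma walk_cong A B k k' : good A -> good B ->
  (forall y, (y \in A) && jlt k y = (y \in B) && jlt k' y) ->
  walk A k = walk B k' /\ wend A k = wend B k'.
Proof.
move=> gA gB; have [n] := ubnP (count (jlt k) A).
elim: n k k' => // n IH k k' le h; have E := nxt_cong gA gB h.
case e : (nxt A k) => [x|]; last first.
  have w1 : walk A k = [::] by rewrite walkE // e.
  have w2 : walk B k' = [::] by rewrite walkE // -E e.
  by rewrite !wend0 // w1 w2 E.
have [xA kx hx] := (nxtP k x gA).1 e.
have [xB kx' _] := (nxtP k' x gB).1 (etrans (esym E) e).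
case: (boolP (1 <= len x)) => lx; last first.
  have w1 : walk A k = [::] by rewrite walkE // e (negPf lx).
  have w2 : walk B k' = [::] by rewrite walkE // -E e (negPf lx).
  by rewrite !wend0 // w1 w2 E.
rewrite (wendE gA e lx) (wendE gB (etrans (esym E) e) lx) walkE // e lx.
rewrite [walk B _]walkE // -E e lx; have lt := walk_count gA e lx.
suff H y : (y \in A) && jlt (thr x) y = (y \in B) && jlt (thr x) y.
  by have [->->] := IH (thr x) (thr x) (leq_trans lt le) H.
apply/andP/andP => -[yin xy].
  have ky := thr_trans lx (good_wfk gA yin) kx xy.
  by have := h y; rewrite yin ky /= => /esym/andP[-> _].
have ky := thr_trans lx (good_wfk gB yin) kx' xy.
by have := h y; rewrite yin ky /= => /andP[-> _].
Qed.

(** Locality of updates. Either [z] is never a candidate, or the border [u] finishes before it and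
    remains a candidate until the walk stops, so that [z] is never the best. *)
Lemma walk_add A B z k : good A -> good B -> B =i z :: A ->
  ~~ jlt k z \/ (exists2 u, u \in A & [/\ border u, jlt k u & start u < finish z]) ->
  walk A k = walk B k /\ wend A k = wend B k.
Proof.
move=> gA gB BA [kz|[u uA [bu]]].
  apply: walk_cong => // y; rewrite BA inE; have [->|//] := eqVneq y z.
  by rewrite (negPf kz) !andbF.
move=> ku uz; have [n] := ubnP (count (jlt k) A); elim: n k ku => // n IH k ku le.
have [x e xu] := nxt_some gA uA ku; rewrite (finish_border bu) in xu.
have [xA kx hx] := (nxtP k x gA).1 e.
have E : nxt B k = Some x.
  apply/(nxtP k x gB); split => //; first by rewrite BA inE xA orbT.
  move=> y; rewrite BA inE => /orP[/eqP-> _ _|yA]; last exact: hx.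
  by rewrite /bl (le_lt_trans xu uz).
case: (boolP (1 <= len x)) => lx; last first.
  have w1 : walk A k = [::] by rewrite walkE // e (negPf lx).
  have w2 : walk B k = [::] by rewrite walkE // E (negPf lx).
  by rewrite !wend0 // w1 w2 E e.
rewrite (wendE gA e lx) (wendE gB E lx) walkE // e lx.
rewrite [walk B _]walkE // E lx; have lt := walk_count gA e lx.
have [||->->//] := IH (thr x); last exact: leq_trans lt le.
by rewrite thr_lt // (good_wfk gA).
Qed.

Definition border_at (a : R) : job R := Job 0 a 0.

Lemma nxt_border_at A x : good A -> 1 <= len x -> border_at (finish x) \in A ->
  nxt A (thr x) = Some (border_at (finish x)).
Proof.
move=> gA lx zA; set z := border_at _; have bz : border z by rewrite /border.
have wz := good_wfk gA zA; apply/(nxtP _ _ gA); split => //.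
  by rewrite thr_lt.
move=> y yA; rewrite thr_lt ?(good_wfk gA yA) // => xy yz.
have wy := good_wfk gA yA; rewrite /bl (finish_border bz) /=.
have := le_trans xy (start_le_finish wy); rewrite le_eqVlt orbC => /orP[->//|/eqP e].
have sy : start y = finish x.
  by apply/eqP; rewrite eq_le xy andbT e start_le_finish.
have by_ : border y.
  by move: e; rewrite -sy /finish /border => /eqP; rewrite -subr_eq0 opprD addrA subrr add0r oppr_eq0.
by move: yz; rewrite (border_eq wy wz by_ bz sy) eqxx.
Qed.

(** A cut at the finishing time of a picked job [x] costs nothing: the keys after the border [z] are
    those after [thr x]. As the walk goes on beyond [x], [z] cannot be in [A], where it would have
    stopped the walk. *)
Lemma walk_split A B k n x0 : good A -> (n.+1 < size (walk A k))%N ->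
  forall z, z = border_at (finish (nth x0 (walk A k) n)) ->
  good B -> B =i z :: A ->
  [/\ z \notin A, walk B k = take n.+1 (walk A k), wend B k = Some z &
      walk B z = drop n.+1 (walk A k) /\ wend B z = wend A k].
Proof.
move=> gA; elim: n k => [|n IH] k; rewrite walkE //;
  case e : (nxt A k) => [x|//]; case: ifP => // lx /= lt z zE gB BA;
  have [xA kx hx] := (nxtP k x gA).1 e.
- have zB : z \in B by rewrite BA inE eqxx.
  have bz : border z by rewrite zE /border.
  have sz : start z = finish x by rewrite zE.
  have wz := good_wfk gB zB.
  have nz : z \notin A.
    apply: contraL lt => zA; rewrite zE in zA; have E := nxt_border_at gA lx zA.
    by rewrite walkE // E ler10.
  have xz : bl x z.
    by rewrite /bl (finish_border bz) sz eqxx /= jlt_job_border // sz start_finish ?orbT.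
  have E : nxt B k = Some x.
    apply/(nxtP _ _ gB); split => //; first by rewrite BA inE xA orbT.
    by move=> y; rewrite BA inE => /orP[/eqP-> //|yA]; apply: hx.
  have E' := nxt_border_at gB lx (eq_ind _ (fun z => z \in B) zB _ zE).
  have w' : walk B (thr x) = [::] by rewrite walkE // E' ler10.
  split => //.
  + by rewrite walkE // E lx w' take0.
  + by rewrite (wendE gB E lx) wend0 // E' zE.
  + rewrite drop0 (wendE gA e lx); apply: walk_cong => // y.
    rewrite BA inE; have [->|ne] := eqVneq y z.
      by rewrite jlt_irr (negPf nz) andbF.
    case yA : (y \in A) => //=; have wy := good_wfk gA yA; rewrite thr_lt //.
    case: (boolP (border y)) => [by_|nb]; last first.
      by rewrite jlt_border_job ?(wfk_job wy) ?sz.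
    rewrite jlt_borders // lt_neqAle -sz; case: eqP => // e'.
    by move: ne; rewrite (border_eq wy wz by_ bz (esym e')) eqxx.
- have [nz w1 w2 w3] := IH (thr x) lt z zE gB BA.
  have bz : border z by rewrite zE /border.
  have xz : finish x < start z.
    have yin : nth x0 (walk A (thr x)) n \in walk A (thr x).
      by apply: mem_nth; apply: ltn_trans (ltnSn n) _.
    have [yA ly xy] := walk_in gA yin; rewrite thr_lt ?(good_wfk gA yA) // in xy.
    rewrite zE; exact: le_lt_trans xy (start_finish ly).
  have E : nxt B k = Some x.
    apply/(nxtP _ _ gB); split => //; first by rewrite BA inE xA orbT.
    move=> y; rewrite BA inE => /orP[/eqP-> _ _|yA]; last exact: hx.
    by rewrite /bl (finish_border bz) xz.
  split => //.
  + by rewrite walkE // E lx w1.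
  + by rewrite (wendE gB E lx).
  + by rewrite (wendE gA e lx).
Qed.

End Greedy.

(** * Regions *)

Section Regions.
Variable R : realType.
Implicit Types (x y z k a b e u j : job R) (A B s : seq (job R)) (K : nat).

Definition borders A : seq (job R) := [seq b <- A | border b].

Lemma mem_borders A b : (b \in borders A) = (b \in A) && border b.
Proof. by rewrite mem_filter andbC. Qed.

Definition marks A x : bool := has (fun b => x \in walk A b) (borders A).

(** The marks that are present while the region of [a] is being reworked and its own marks are
    cleared. *)
Definition marks_but A a x : bool :=
  has (fun b => (b != a) && (x \in walk A b)) (borders A).

(** The later of two borders separates their walks: one finishes by it, the other starts there or
    later. *)
Lemma walk_disjoint A b b' x : good A -> b \in borders A -> b' \in borders A ->
  x \in walk A b -> x \in walk A b' -> b = b'.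
Proof.
move=> gA; wlog lt : b b' / jlt b b' => [W|].
  move=> h h' xb xb'; have [//|ne] := eqVneq b b'.
  case: (boolP (jlt b b')) => lt; first exact: W lt h h' xb xb'.
  by apply: esym; apply: W (jlt_total ne lt) h' h xb' xb.
rewrite !mem_borders => /andP[bA bb] /andP[bA' bb'] xb xb'.
have [xA lx b'x] := walk_in gA xb'; rewrite jlt_border_job // in b'x.
have := walk_border gA xb bA' bb' lt.
by move=> /(lt_le_trans (start_finish lx)); rewrite ltNge b'x.
Qed.

Lemma marks_butE A a x : good A -> a \in borders A ->
  marks A x = marks_but A a x || (x \in walk A a).
Proof.
move=> gA aA; apply/hasP/orP => [[b bA xb]|[/hasP[b bA /andP[_ xb]]|xa]].
- have [<-|ne] := eqVneq b a; first by right.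
  by left; apply/hasP; exists b; rewrite ?ne.
- by exists b.
- by exists a.
Qed.

Lemma marks_but_walk A a x : good A -> a \in borders A -> marks_but A a x ->
  x \notin walk A a.
Proof.
move=> gA aA /hasP[b bA /andP[ne xb]]; apply/negP => xa.
by rewrite (walk_disjoint gA aA bA xa xb) eqxx in ne.
Qed.

Lemma marks_in A x : good A -> marks A x -> x \in A /\ 1 <= len x.
Proof. by move=> gA /hasP[b _ /(walk_in gA)[]]. Qed.

(** A region is not the last one precisely when some border [u] comes later; only then is the lower
    bound imposed. *)
Definition invK K A : Prop :=
  [/\ good A, sen R \in A & forall b, b \in borders A ->
    (size (walk A b) <= K.*2)%N /\
    forall u, u \in borders A -> jlt b u -> (K <= size (walk A b))%N].

(** The invariant in the middle of an update, with the region of [a] exempted. *)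
Definition semiK K A a : Prop :=
  [/\ good A, sen R \in A, a \in borders A &
    forall b, b \in borders A -> b != a -> (size (walk A b) <= K.*2)%N /\
    forall u, u \in borders A -> jlt b u -> (K <= size (walk A b))%N].

Lemma lastbP A j : good A -> sen R \in A -> wfk j -> 1 <= len j ->
  let a := lastb [seq y <- A | jlt y j] in
  [/\ a \in borders A, jlt a j & forall u, u \in borders A -> jlt a u -> jlt j u].
Proof.
move=> gA sA wj lj a; have /andP[st _] := gA.
have js : j != sen R by apply: contraTneq lj => ->; rewrite ler10.
have sj := sen_min wj js.
have ha : a \in sen R :: [seq x <- [seq y <- A | jlt y j] | isb x] by apply: mem_last.
have [aA aj] : a \in borders A /\ jlt a j.
  rewrite mem_borders; move: ha; rewrite inE => /orP[/eqP->|].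
    by rewrite sA sen_border.
  by rewrite !mem_filter => /and3P[/andP[ba _] -> ->].
split => // u; rewrite mem_borders => /andP[uA bu] au.
have uj : u != j by apply: contraTneq lj => <-; rewrite border_job.
apply: jlt_total uj _; apply/negP => ulj.
have us : u != sen R.
  apply: contraTneq au => ->; have [->|ne] := eqVneq a (sen R); first by rewrite jlt_irr.
  apply/negP; apply: jlt_asym; apply: sen_min => //.
  by apply: good_wfk gA _; move: aA; rewrite mem_borders => /andP[].
have : u \in [seq x <- [seq y <- A | jlt y j] | isb x].
  by rewrite !mem_filter /isb us ulj uA -/(border u) bu.
have : sorted (@jlt R) [seq x <- [seq y <- A | jlt y j] | isb x].
  by rewrite !sorted_filter //; exact: jlt_trans.
move: au; rewrite /a /lastb; case/lastP: [seq x <- _ | isb x] => [//|s z].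
rewrite last_rcons mem_rcons inE => zu; rewrite -cats1.
rewrite (sorted_pairwise (@jlt_trans R)) pairwise_cat => /and3P[/allrelP h _ _].
move=> /orP[/eqP e|us']; first by rewrite e jlt_irr in zu.
by apply: (jlt_asym zu); apply: h => //; rewrite inE.
Qed.

(** Earlier regions are shut off by [a], which finishes before [z]; later regions do not open before
    [z], so [z] is no candidate there. *)
Lemma walk_others A B z a : good A -> good B -> B =i z :: A -> a \in borders A ->
  start a < finish z -> (forall u, u \in borders A -> jlt a u -> ~~ jlt u z) ->
  forall b, b \in borders A -> b != a -> walk A b = walk B b.
Proof.
move=> gA gB BA aA az az' b bA ne.
have [] // := walk_add (k := b) gA gB BA; case: (boolP (jlt b a)) => ba.
  by move: aA; rewrite mem_borders => /andP[aA ba']; right; exists a.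
by left; apply: az' => //; apply: jlt_total.
Qed.

Lemma border_neq_job b j : border b -> 1 <= len j -> b != j.
Proof. by move=> bb; apply: contraTneq => <-; rewrite border_job. Qed.

Lemma borders_job A B j : B =i j :: A -> 1 <= len j -> borders A =i borders B.
Proof.
move=> BA lj b; rewrite !mem_borders BA inE; case: (boolP (border b)) => bb; last by rewrite !andbF.
by rewrite (negPf (border_neq_job bb lj)).
Qed.

Section Update.
Variables (A A' : seq (job R)) (j a : job R).
Hypotheses (gA : good A) (gA' : good A') (lj : 1 <= len j).
Hypothesis AA' : A' =i j :: A \/ A =i j :: A'.
Hypotheses (aA : a \in borders A) (aj : jlt a j).
Hypothesis aj' : forall u, u \in borders A -> jlt a u -> jlt j u.

Lemma update_borders : borders A =i borders A'.
Proof. by case: AA' => h b; rewrite (borders_job h lj). Qed.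

Lemma update_walks b : b \in borders A -> b != a -> walk A b = walk A' b.
Proof.
have az : start a < finish j by apply: le_lt_trans (jlt_start aj) (start_finish lj).
have aj'' u : u \in borders A -> jlt a u -> ~~ jlt u j.
  by move=> uA /(aj' uA) ju; apply/negP => /(jlt_asym ju).
case: AA' => h bA ne; first exact: (walk_others gA gA' h aA az aj'' bA ne).
apply: esym; apply: (walk_others gA' gA h _ az) => //.
- by rewrite -update_borders.
- by move=> u; rewrite -update_borders; apply: aj''.
- by rewrite -update_borders.
Qed.

(** Without [j], the new greedy schedule is also a schedule of the old region, where greedy is
    optimal. The argument is the same whether [j] was added or removed. *)
Lemma update_size : (size (walk A' a) <= (size (walk A a)).+1)%N.
Proof.
have -> : size (walk A' a) = (count (predC1 j) (walk A' a) + count_mem j (walk A' a))%N.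
  by rewrite addnC count_predC.
rewrite -[X in (_ <= X)%N]addn1 leq_add //; last first.
  by rewrite count_uniq_mem ?walk_uniq //; case: (_ \in _).
have /andP[aA1 ba] : (a \in A) && border a by rewrite -mem_borders.
rewrite -size_filter; apply: walk_opt => //.
- move=> y; rewrite mem_filter /= => /andP[yj /(walk_in gA')[yA' _ _]].
  by case: AA' => h; [move: yA'|]; rewrite h inE ?(negPf yj) // yA' orbT.
- exact: pairwise_filter (walk_chain _ gA').
- by move=> y; rewrite mem_filter => /andP[_ /(walk_in gA')[]].
- move=> y u; rewrite mem_filter => /andP[_ yw] uA bu au.
  apply: (walk_border gA' yw) => //.
  by have := update_borders u; rewrite !mem_borders uA bu /= andbT => <-.
Qed.

(** The walk before the change clears the old schedule of the region, and the walk that measures it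
    afterwards clears the new one; what is left are the marks of the other regions. *)
Lemma update_marks x :
  [&& marks A x, x \notin walk A a & x \notin walk A' a] = marks_but A' a x.
Proof.
have aA' : a \in borders A' by rewrite -update_borders.
rewrite (marks_butE x gA aA).
have -> : marks_but A a x = marks_but A' a x.
  apply/hasP/hasP => -[b bA /andP[ne xb]]; exists b.
  - by rewrite -update_borders.
  - by rewrite ne -update_walks.
  - by rewrite update_borders.
  - by rewrite ne update_walks // update_borders.
apply/idP/idP => [/and3P[/orP[//|->]]//|h].
rewrite h /= (marks_but_walk gA' aA' h) andbT.
apply: contraT; rewrite negbK => xa; move: h => /hasP[b bA' /andP[ne xb]].
have bA : b \in borders A by rewrite update_borders.
rewrite -update_walks // in xb.
by rewrite (walk_disjoint gA aA bA xa xb) eqxx in ne.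
Qed.

Lemma update_semi K : invK K A -> sen R \in A' ->
  semiK K A' a /\ (size (walk A' a) <= K.*2.+1)%N.
Proof.
move=> [_ _ H] sA'; split; last first.
  by apply: leq_trans update_size _; rewrite ltnS; case: (H a aA).
split => //; first by rewrite -update_borders.
move=> b; rewrite -update_borders => bA ne; rewrite -update_walks //.
have [h1 h2] := H b bA; split => // u; rewrite -update_borders; exact: h2.
Qed.

End Update.

Section Merge.
Variables (K : nat) (A A' : seq (job R)) (a e : job R).
Hypotheses (sK : semiK K A a) (gA' : good A') (eA : e \notin A').
Hypotheses (AA' : A =i e :: A') (we : wend A a = Some e).

Let gA : good A. Proof. by case: sK. Qed.
Let aA : a \in borders A. Proof. by case: sK. Qed.

Let eP : [/\ e \in A, border e, jlt a e &
    forall u, u \in A -> border u -> jlt a u -> start e <= start u].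
Proof. by have := wendP a gA; rewrite we. Qed.

Let eB : e \in borders A.
Proof. by case: eP => ? ? _ _; rewrite mem_borders; apply/andP. Qed.

Let ea : e != a.
Proof. by case: eP => _ _ + _; apply: contraTneq => ->; rewrite jlt_irr. Qed.

Lemma merge_borders b : (b \in borders A') = (b \in borders A) && (b != e).
Proof.
rewrite !mem_borders AA' inE; have [->|_] := eqVneq b e; last by rewrite andbT.
by rewrite (negPf eA) andbF.
Qed.

Let aA' : a \in borders A'. Proof. by rewrite merge_borders aA eq_sym ea. Qed.

Let wfB b : b \in borders A -> wfk b.
Proof. by rewrite mem_borders => /andP[/(good_wfk gA)]. Qed.

Let bdB b : b \in borders A -> border b.
Proof. by rewrite mem_borders => /andP[]. Qed.

Lemma merge_after u : u \in borders A' -> jlt a u -> jlt e u.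
Proof.
rewrite merge_borders => /andP[uA ne] au; have [_ _ _ h] := eP.
have := uA; rewrite mem_borders => /andP[uA1 bu].
have := h u uA1 bu au; rewrite le_eqVlt => /orP[/eqP es|lt].
  by move: ne; rewrite (border_eq (wfB uA) (wfB eB) bu (bdB eB) (esym es)) eqxx.
by rewrite jlt_borders ?wfB ?bdB.
Qed.

Lemma merge_walks b : b \in borders A' -> b != a -> walk A b = walk A' b.
Proof.
move=> bA' ne; apply: esym; apply: (walk_others gA' gA AA' aA') => //.
  rewrite finish_border ?bdB // -jlt_borders ?wfB ?bdB //.
  by case: eP.
by move=> u uA' au; apply/negP => /(jlt_asym (merge_after uA' au)).
Qed.

Lemma merge_marks x :
  marks_but A a x && (x \notin walk A e) = marks_but A' a x.
Proof.
apply/andP/hasP => [[/hasP[b bA /andP[ne xb]] xe]|[b bA' /andP[ne xb]]].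
  have be : b != e by apply: contraNneq xe => <-.
  have bA' : b \in borders A' by rewrite merge_borders bA.
  by exists b; rewrite // ne -merge_walks.
rewrite -merge_walks // in xb; move: bA'; rewrite merge_borders => /andP[bA be].
split; first by apply/hasP; exists b; rewrite ?ne.
apply/negP => xe; by rewrite (walk_disjoint gA bA eB xb xe) eqxx in be.
Qed.

(** A job of the merged walk ends by the time of [e], starts from it on, or crosses it. The first
    two kinds are bounded by the optimality of the two old walks, and two crossing jobs would
    overlap. *)
Lemma merge_size :
  (size (walk A' a) <= size (walk A a) + size (walk A e) + 1)%N.
Proof.
have [eA1 be ae emin] := eP; set w := walk A' a.
pose p x := finish x <= start e; pose q x := start e <= start x.
have win x : x \in w -> [/\ x \in A, 1 <= len x & jlt a x].
  by move=> /(walk_in gA')[xA lx ax]; rewrite AA' inE xA orbT.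
have wb x u : x \in w -> u \in A -> u != e -> border u -> jlt a u -> finish x <= start u.
  move=> xw uA ue bu au; apply: (walk_border gA' xw) => //.
  by move: uA; rewrite AA' inE (negPf ue).
have h1 : (count p w <= size (walk A a))%N.
  rewrite -size_filter; apply: walk_opt => //.
  - by move=> x; rewrite mem_filter => /andP[_ /win[]].
  - exact: pairwise_filter (walk_chain _ gA').
  - by move=> x; rewrite mem_filter => /andP[_ /win[]].
  - move=> x u; rewrite mem_filter => /andP[px xw] uA bu au.
    by have [->//|ne] := eqVneq u e; apply: wb.
have h2 : (count q w <= size (walk A e))%N.
  rewrite -size_filter; apply: walk_opt => //.
  - by move=> x; rewrite mem_filter => /andP[_ /win[]].
  - exact: pairwise_filter (walk_chain _ gA').
  - by move=> x; rewrite mem_filter => /andP[qx /win[_ lx _]]; rewrite jlt_border_job.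
  - move=> x u; rewrite mem_filter => /andP[px xw] uA bu eu.
    apply: wb => //; first by apply: contraTneq eu => ->; rewrite jlt_irr.
    exact: jlt_trans ae eu.
have h3 : (count (predC (predU p q)) w <= 1)%N.
  rewrite -size_filter; have : pairwise (fun x y => finish x <= start y)
      [seq x <- w | predC (predU p q) x].
    exact: pairwise_filter (walk_chain _ gA').
  have : all (predC (predU p q)) [seq x <- w | predC (predU p q) x] by apply: filter_all.
  case: [seq x <- w | _] => [|x [|y s]] //=; rewrite /p /q !negb_or -!ltNge.
  move=> /and3P[/andP[ex xe] /andP[ey ye] _] /andP[/andP[xy _] _].
  by have := lt_le_trans ex xy; rewrite ltNge (ltW ye).
have h4 : (count (predU p q) w <= count p w + count q w)%N.
  by rewrite -(count_predUI p q) leq_addr.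
have := count_predC (predU p q) w; move: h1 h2 h3 h4; lia.
Qed.

(** The old walk from [e] competes with the merged one. Unless [e] opened the last region it had [K]
    jobs, so a merge restores the lower bound. *)
Lemma merge_size_ge : (size (walk A e) <= size (walk A' a))%N.
Proof.
have [eA1 be ae emin] := eP; apply: walk_opt => //.
- move=> x /(walk_in gA)[xA lx _]; move: xA; rewrite AA' inE => /orP[/eqP xe|//].
  by rewrite xe border_job in lx.
- exact: walk_chain.
- by move=> x /(walk_in gA)[xA lx ex]; split => //; apply: jlt_trans ae ex.
- move=> x u xw uA' bu au; apply: (walk_border gA xw) => //.
    by rewrite AA' inE uA' orbT.
  by apply: merge_after => //; rewrite mem_borders uA'.
Qed.

(** The upper bound is (K - 1) + 2K + 1 = 3K, by [merge_size]. *)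
Lemma merge_semi : sen R \in A' -> (size (walk A a) < K)%N ->
  [/\ semiK K A' a, (size (walk A' a) <= K + K.*2)%N &
    forall u, u \in borders A' -> jlt a u -> (K <= size (walk A' a))%N].
Proof.
move=> sA' lt; have [_ _ _ H] := sK; have [h1 h2] := H e eB ea.
split.
- split => // b bA' ne; rewrite -merge_walks //.
  move: (bA'); rewrite merge_borders => /andP[bA be].
  have [g1 g2] := H b bA ne; split => // u; rewrite merge_borders => /andP[uA _].
  exact: g2.
- have := merge_size; move: h1 lt; lia.
- move=> u uA' au; apply: leq_trans merge_size_ge; apply: (h2 u).
    by move: uA'; rewrite merge_borders => /andP[].
  exact: merge_after.
Qed.

End Merge.

Lemma semi_inv K A a : semiK K A a -> (size (walk A a) <= K.*2)%N ->
  (forall u, u \in borders A -> jlt a u -> (K <= size (walk A a))%N) -> invK K A.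
Proof.
move=> [gA sA aA H] h1 h2; split => // b bA.
by have [->|ne] := eqVneq b a; [split|apply: H].
Qed.

Section Split.
Variables (K : nat) (A B : seq (job R)) (a z x0 : job R).
Hypotheses (sK : semiK K A a) (K0 : (0 < K)%N) (gB : good B).
Hypotheses (ltK : (K.*2 < size (walk A a))%N) (leK : (size (walk A a) <= K + K.*2)%N).
Hypotheses (zE : z = border_at (finish (nth x0 (walk A a) K.-1))) (BA : B =i z :: A).

Let gA : good A. Proof. by case: sK. Qed.
Let aA : a \in borders A. Proof. by case: sK. Qed.

Let S : [/\ z \notin A, walk B a = take K (walk A a), wend B a = Some z &
      walk B z = drop K (walk A a) /\ wend B z = wend A a].
Proof.
rewrite -(prednK K0); apply: (walk_split (x0 := x0)) => //.
by rewrite prednK //; move: ltK; lia.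
Qed.

Let bz : border z. Proof. by rewrite zE /border. Qed.

Lemma split_borders b : (b \in borders B) = (b \in borders A) || (b == z).
Proof.
rewrite !mem_borders BA inE; have [->|_] := eqVneq b z; first by rewrite bz orbT.
by rewrite orbF.
Qed.

Let wK : nth x0 (walk A a) K.-1 \in walk A a.
Proof. by apply: mem_nth; apply: leq_ltn_trans ltK; lia. Qed.

Let wKA : [/\ nth x0 (walk A a) K.-1 \in A, 1 <= len (nth x0 (walk A a) K.-1) &
  jlt a (nth x0 (walk A a) K.-1)] := walk_in gA wK.

Let ba : border a. Proof. by move: aA; rewrite mem_borders => /andP[]. Qed.

Let az : start a < finish z.
Proof.
have [_ lx ax] := wKA; rewrite (finish_border bz) zE /=.
by apply: le_lt_trans (start_finish lx); rewrite -jlt_border_job.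
Qed.

Lemma split_before u : u \in borders A -> jlt a u -> ~~ jlt u z.
Proof.
move=> uA au; move: (uA); rewrite mem_borders => /andP[uA1 bu].
rewrite jlt_borders ?(good_wfk gA uA1) //; last by rewrite (good_wfk gB) // BA inE eqxx.
by rewrite -leNgt zE /=; apply: walk_border wK _ _ _.
Qed.

Lemma split_walks b : b \in borders A -> b != a -> walk A b = walk B b.
Proof. exact: (walk_others gA gB BA aA az split_before). Qed.

(** The cut divides the walk without changing it, so a split inserts a border and touches no
    mark. *)
Lemma split_marks x : marks B x = marks A x.
Proof.
have [zA w1 _ [w2 _]] := S; rewrite (marks_butE x gA aA); apply/hasP/orP.
  move=> [b]; rewrite split_borders => /orP[bA|/eqP->] xb; last first.
    by right; rewrite w2 in xb; apply: mem_drop xb.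
  have [e|ne] := eqVneq b a.
    by right; rewrite e w1 in xb; apply: mem_take xb.
  by left; apply/hasP; exists b; rewrite ?ne // split_walks.
move=> [/hasP[b bA /andP[ne xb]]|].
  by exists b; [rewrite split_borders bA|rewrite -split_walks].
rewrite -(cat_take_drop K (walk A a)) mem_cat -w1 -w2 => /orP[xa|xz].
  by exists a => //; rewrite split_borders aA.
by exists z => //; rewrite split_borders eqxx orbT.
Qed.

(** Of more than 2K and at most 3K jobs, a cut after the K-th leaves K before it and between K + 1
    and 2K after it. *)
Lemma split_inv : invK K B.
Proof.
have [zA w1 _ [w2 _]] := S; have [_ sA _ H] := sK; split => //.
  by rewrite BA inE sA orbT.
move=> b; rewrite split_borders => /orP[bA|/eqP->]; last first.
  by rewrite w2 size_drop; split=> [|u _ _]; move: ltK leK; lia.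
have [->|ne] := eqVneq b a.
  by rewrite w1 size_take_min; split=> [|u _ _]; move: ltK leK; lia.
rewrite -split_walks //; have [h1 h2] := H b bA ne; split => // u.
rewrite split_borders => /orP[uA|/eqP-> bz']; first exact: h2.
(* If [z] comes after [b], so does [a]: otherwise [b] would be a border after [a], and by
   [split_before] not before [z]. *)
apply: (h2 a aA); apply: contraTT bz' => nba; apply: split_before => //.
by apply: jlt_total nba.
Qed.

End Split.

End Regions.

(** * Approximation ratio and number of borders *)

Section Approximation.
Variable R : realType.
Implicit Types (x y b u : job R) (s bs : seq (job R)).
Local Open Scope fset_scope.

Variables (K : nat) (A : seq (job R)) (J : {fset job R}).
Hypotheses (iA : invK K A) (JA : forall x, (x \in J) = (x \in A) && (1 <= len x)).

Let gA : good A. Proof. by case: iA. Qed.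
Let sA : sen R \in A. Proof. by case: iA. Qed.
Let uA : uniq A.
Proof.
by case/andP: gA => st _; apply: (sorted_uniq (@jlt_trans R) (@jlt_irr R)).
Qed.
Let uB : uniq (borders A). Proof. exact: filter_uniq. Qed.
Let sB : sen R \in borders A. Proof. by rewrite mem_borders sA sen_border. Qed.

Definition marked : {fset job R} := [fset x in J | marks A x].

Definition walks bs : seq (job R) := flatten [seq walk A b | b <- bs].

Lemma walks_uniq bs : uniq bs -> {subset bs <= borders A} -> uniq (walks bs).
Proof.
elim: bs => //= b bs IH /andP[nb ub] sub; rewrite cat_uniq walk_uniq //.
have sub' : {subset bs <= borders A} by move=> c cin; apply: sub; rewrite inE cin orbT.
rewrite (IH ub sub') andbT; apply/hasPn => x /flatten_mapP[c cin xc].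
apply/negP => xb; move: nb; rewrite (walk_disjoint gA _ _ xb xc) ?cin //.
  by apply: sub; rewrite inE eqxx.
exact: sub'.
Qed.

Lemma marked_mem : marked =i walks (borders A).
Proof.
move=> x; rewrite !inE JA; apply/andP/flatten_mapP => [[_ /hasP[b bA xb]]|[b bA xb]].
  by exists b.
have [-> -> _] := walk_in gA xb; split => //.
by apply/hasP; exists b.
Qed.

Lemma card_seq_eq (F : {fset job R}) s : uniq s -> F =i s -> #|` F| = size s.
Proof.
by move=> us Fs; apply: perm_size; apply: uniq_perm (fset_uniq F) us Fs.
Qed.

Lemma size_walks bs : size (walks bs) = (\sum_(b <- bs) size (walk A b))%N.
Proof. by rewrite size_flatten /shape -map_comp sumnE big_map. Qed.

Lemma card_marked : #|` marked| = (\sum_(b <- borders A) size (walk A b))%N.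
Proof.
rewrite -size_walks; apply: card_seq_eq marked_mem.
by apply: walks_uniq.
Qed.

(* Only the last region may have fewer than [K] jobs. *)
Lemma card_marked_ge : (K * (size (borders A)).-1 <= #|` marked|)%N.
Proof.
rewrite card_marked; set l := last (sen R) (borders A).
have lB : l \in borders A.
  by rewrite /l; case: (borders A) sB => // b bs _ /=; apply: mem_last.
have lmax b : b \in borders A -> b != l -> jlt b l.
  have : sorted (@jlt R) (borders A).
    by case/andP: gA => st _; apply: sorted_filter st; exact: jlt_trans.
  rewrite /l; case/lastP: (borders A) => // bs c; rewrite last_rcons -cats1.
  rewrite (sorted_pairwise (@jlt_trans R)) pairwise_cat => /and3P[/allrelP h _ _].
  by rewrite mem_cat inE => /orP[bin _|->//]; apply: h => //; rewrite inE.
apply: (@leq_trans (\sum_(b <- borders A | b != l) K)).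
  rewrite big_const_seq iter_addn_0 leq_mul2l; apply/orP; right.
  have := count_predC (pred1 l) (borders A); rewrite count_uniq_mem // lB.
  by rewrite (eq_count (a2 := fun b => b != l)) // => <-.
rewrite [X in (_ <= X)%N](bigID (fun b => b != l)) /= -[X in (X <= _)%N]addn0.
apply: leq_add => //; rewrite big_seq_cond [X in (_ <= X)%N]big_seq_cond.
apply: leq_sum => b /andP[bB ne]; have [_ _ H] := iA.
have [_ h] := H b bB; exact: h lB (lmax b bB ne).
Qed.

Lemma marked_feasible : feasible J marked.
Proof.
apply/andP; split; first by apply/fsubsetP => x; rewrite !inE => /andP[].
apply/forallP => -[x /= xS]; apply/forallP => -[y /= yS]; apply/implyP => /= ne.
have key u v : u \in marked -> v \in marked -> jlt u v -> ~~ overlap u v.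
  rewrite !marked_mem => /flatten_mapP[b bB ub] /flatten_mapP[c cB vc] uv.
  have [uA' lu bu] := walk_in gA ub; have [vA lv cv] := walk_in gA vc.
  suff h : finish u <= start v by rewrite /overlap negb_and -!leNgt h orbT.
  move: (bB) (cB); rewrite !mem_borders => /andP[bA bb] /andP[cA bc].
  have [e|nbc] := eqVneq b c; last first.
    case: (boolP (jlt b c)) => lt.
      apply: le_trans (walk_border gA ub cA bc lt) _.
      by rewrite -jlt_border_job.
    have := walk_border gA vc bA bb (jlt_total nbc lt).
    move=> /(lt_le_trans (start_finish lv)) h.
    have := jlt_start uv; rewrite jlt_border_job // in bu.
    by move=> /(le_trans bu); rewrite leNgt h.
  subst c; have := walk_chain b gA; move: ub vc uv.
  elim: (walk A b) => //= w ws IH; rewrite !inE => + + uv /andP[/allP aw pw].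
  move=> /orP[/eqP uw|uw] /orP[/eqP vw|vw].
  - by rewrite uw vw jlt_irr in uv.
  - by rewrite uw; apply: aw.
  - have := aw _ uw; rewrite -vw => h; have := jlt_start uv.
    by move=> /(le_trans h); rewrite leNgt start_finish.
  - exact: IH.
case: (boolP (jlt x y)) => lt; first exact: key.
by rewrite /overlap andbC; apply: key => //; apply: jlt_total lt.
Qed.

Definition crosses x u : bool := (start x < start u) && (start u < finish x).

(** A job of an optimal schedule either lies within a region, where greedy does at least as well, or
    has a border strictly inside. Disjoint jobs have different borders inside, and none of these is
    [sen], which saves one. *)
Lemma opt_le : (opt J <= #|` marked| + (size (borders A)).-1)%N.
Proof.
apply/bigmax_leqP_seq => F _ /andP[/fsubsetP FJ /forallP nF].
have Fjob x : x \in F -> x \in A /\ 1 <= len x by move=> /FJ; rewrite JA => /andP[].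
have nov x y : x \in F -> y \in F -> x != y -> ~~ overlap x y.
  move=> xF yF ne; have /forallP/(_ [` yF])/implyP := nF [` xF].
  exact.
pose s := [seq x <- A | x \in F].
have us : uniq s by apply: filter_uniq.
have Fs : F =i s.
  by move=> x; rewrite mem_filter; case xF : (x \in F) => //=; case: (Fjob x xF) => ->.
rewrite (card_seq_eq us Fs).
have chain : pairwise (fun x y => finish x <= start y) s.
  have : sorted (@jlt R) s.
    by case/andP: gA => st _; apply: sorted_filter st; exact: jlt_trans.
  rewrite (sorted_pairwise (@jlt_trans R)); apply: sub_in_pairwise (allss s) => x y.
  rewrite -!Fs => xF yF xy; rewrite leNgt; apply/negP => lt.
  have ne : x != y by apply: contraTneq xy => ->; rewrite jlt_irr.
  have := nov x y xF yF ne; rewrite /overlap lt andbT => /negP; apply.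
  by have [_ ly] := Fjob y yF; apply: le_lt_trans (jlt_start xy) (start_finish ly).
(* [Q b x] is the position relative to the borders that [walk_opt] demands of a competitor of the
   walk from [b]. *)
pose Q b x := jlt b x && all (fun u => jlt b u ==> (finish x <= start u)) (borders A).
pose cr x := has (crosses x) (borders A).
have sub : {subset s <= flatten [seq filter (Q b) s | b <- borders A] ++ filter cr s}.
  move=> x xs; rewrite mem_cat [_ \in filter cr s]mem_filter xs andbT.
  case: (boolP (cr x)) => [|ncr]; first by rewrite orbT.
  have [xA lx] := Fjob x (etrans (Fs x) xs).
  have [aB ax amax] := lastbP gA sA (good_wfk gA xA) lx.
  rewrite orbF; apply/flatten_mapP; exists (lastb [seq y <- A | jlt y x]) => //.
  rewrite mem_filter xs andbT /Q ax /=; apply/allP => u uB'; apply/implyP => au.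
  have := amax u uB' au; have := uB'; rewrite mem_borders => /andP[_ bu].
  rewrite jlt_job_border // => xu; rewrite leNgt; apply/negP => ux.
  by move/hasPn: ncr => /(_ u uB'); rewrite /crosses xu ux.
apply: leq_trans (uniq_leq_size us sub) _; rewrite size_cat; apply: leq_add.
  rewrite card_marked size_flatten /shape -map_comp sumnE big_map.
  rewrite big_seq [X in (_ <= X)%N]big_seq; apply: leq_sum => b bB.
  have bb : border b by move: bB; rewrite mem_borders => /andP[].
  apply: walk_opt => //.
  - by move=> x; rewrite mem_filter -Fs => /andP[_ /Fjob[]].
  - exact: pairwise_filter.
  - by move=> x; rewrite mem_filter -Fs => /andP[/andP[bx _] /Fjob[]].
  - move=> x u; rewrite mem_filter => /andP[/andP[_ /allP h] _] uA' bu bu'.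
    by apply: (implyP (h u _)); rewrite ?mem_borders ?uA'.
(* Any crossed border would do; the default value is not reached on [filter cr s]. *)
pose g x := head (sen R) [seq u <- borders A | crosses x u].
have gP x : x \in filter cr s -> [/\ x \in F, g x \in borders A & crosses x (g x)].
  rewrite mem_filter -Fs => /andP[/hasP[u uB' xu] xF].
  have hu : u \in [seq u <- borders A | crosses x u] by rewrite mem_filter xu.
  have : g x \in [seq u <- borders A | crosses x u].
    by rewrite /g; case: [seq u <- _ | _] hu => //= c cs _; rewrite inE eqxx.
  by rewrite mem_filter => /andP[].
have ginj : {in filter cr s &, injective g}.
  move=> x y /gP[xF _ /andP[x1 x2]] /gP[yF _ /andP[y1 y2]] e.
  apply/eqP; apply: contraT => ne; have := nov x y xF yF ne.
  rewrite /overlap; rewrite e in x1 x2.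
  by rewrite (lt_trans x1 y2) (lt_trans y1 x2).
rewrite -(size_map g (filter cr s)).
(* No job starts before time 0, so [g] never takes the value [sen]. This makes the crossing jobs
   match the regions counted in [card_marked_ge], all but the last. *)
apply: (@leq_trans (size (rem (sen R) (borders A)))); last by rewrite size_rem.
apply: uniq_leq_size; first by rewrite map_inj_in_uniq // filter_uniq.
move=> u /mapP[x /gP[xF gB /andP[xg _]] ->]; rewrite mem_rem_uniq // inE gB andbT.
apply: contraTneq xg => ->; rewrite /= -leNgt.
by have [xA _] := Fjob x xF; have /andP[] := good_wfk gA xA.
Qed.

Lemma inv_approximate (eps : R) : 0 < eps -> eps^-1 <= K%:R ->
  approximate (1 + eps)%R J marked.
Proof.
move=> e0 eK; split; first exact: marked_feasible.
have e1 : (0 < 1 + eps)%R by rewrite addr_gt0.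
rewrite ler_pdivrMr // mulrDr mulr1.
have := opt_le; rewrite -(ler_nat R) natrD => /le_trans; apply; rewrite lerD2l.
have := card_marked_ge; rewrite -(ler_nat R) natrM => h.
(* With B the number of borders minus one and m the number of scheduled jobs, B / eps <= K B <= m,
   hence B <= eps m. *)
rewrite mulrC -ler_pdivrMl //; apply: le_trans h.
by rewrite ler_wpM2r.
Qed.

(** Each region but the last contains a scheduled job, so there is at most one border more than
    jobs. This keeps the descents logarithmic in the number of jobs. *)
Lemma inv_size : (0 < K)%N -> (size A <= (#|` J|).*2.+1)%N.
Proof.
move=> K0; have le1 : (#|` marked| <= #|` J|)%N.
  by apply: fsubset_leq_card; apply/fsubsetP => x; rewrite !inE => /andP[].
have le2 : ((size (borders A)).-1 <= #|` marked|)%N.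
  by apply: leq_trans card_marked_ge; rewrite leq_pmull.
have e : #|` J| = count (predC (@border R)) A.
  rewrite -size_filter; apply: card_seq_eq; first exact: filter_uniq.
  move=> x; rewrite JA mem_filter /= andbC; case xA : (x \in A); rewrite ?andbF //= !andbT.
  apply/idP/idP => [lx|]; last exact: wfk_job (good_wfk gA xA).
  by apply: contraTN lx => /border_job ->.
have := count_predC (@border R) A; rewrite -e -size_filter -/(borders A).
by move: le1 le2; lia.
Qed.

End Approximation.

(** * Walk programs *)

Notation rAP := 18%N (only parsing).
Notation rC := 19%N (only parsing).
Notation rEP := 23%N (only parsing).
Notation rW := 24%N (only parsing).
Notation xTK := 4%N (only parsing).

Definition key_from (p : nat) : code :=
  CSetR xKS (XFld 0 p) ;; CSetR xKL (XFld 1 p) ;; rKB ::= lft p.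

Definition walk_test : test :=
  TAnd (TNot (TNEq rSB (ACst 0))) (TNot (TREq (fin rSB) (XFld 0 rSB))).

Definition walk_pick : code := rW ::= rSB ;; key_from rW.

(** The new key is [thr x], whose length is start minus finish; being negative, it puts the key
    before everything that starts at [finish x]. The finishing time of the K-th job is kept in [xTK]
    for a possible cut. *)
Definition walk_step (K : nat) : code :=
  rC ::= AAdd rC (ACst 1) ;;
  CIf (TNEq rC (ACst K)) (CSetR xTK (fin rW)) CSkip ;;
  CSetR xKS (fin rW) ;; CSetR xKL (XSub (XFld 0 rW) (fin rW)) ;; rKB ::= ACst 0.

(** A pick is marked through a descent of its own, since [rSB] gives the leaf but no path to it. *)
Definition walk_body (K : nat) : code :=
  walk_pick ;; mark_code ;; walk_step K ;; desc_code.

Definition walk_start (p : nat) : code := key_from p ;; rC ::= ACst 0.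

Definition walk_code (K p : nat) : code :=
  walk_start p ;; desc_code ;; CWhile walk_test (walk_body K).

Section Walking.
Variable R : realType.
Implicit Types (s : state R) (x y k b : job R) (A w : seq (job R)).
Implicit Types (mu : job R -> bool).

Definition keeps (qs xs : seq nat) s s' : Prop :=
  (forall q, q \notin qs -> nreg s' q = nreg s q) /\
  (forall q, q \notin xs -> rreg s' q = rreg s q).

Lemma keeps_trans qs xs s1 s2 s3 :
  keeps qs xs s1 s2 -> keeps qs xs s2 s3 -> keeps qs xs s1 s3.
Proof. by move=> [f1 g1] [f2 g2]; split=> q h; rewrite ?f2 ?g2 ?f1 ?g1. Qed.

Lemma keeps_sub qs xs qs' xs' s s' : all (mem qs') qs -> all (mem xs') xs ->
  keeps qs xs s s' -> keeps qs' xs' s s'.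
Proof.
move=> /allP a1 /allP a2 [f g]; split=> q h.
  by apply: f; apply: contra h => /a1.
by apply: g; apply: contra h => /a2.
Qed.

Lemma same_keeps qs s s' : same_regs qs s s' -> keeps qs [::] s s'.
Proof. by move=> [x f]; split=> // q _; rewrite x. Qed.

Lemma keeps_nset qs xs s s' q v : q \in qs -> keeps qs xs s s' ->
  keeps qs xs s (set_nreg s' q v).
Proof.
move=> qin [f g]; split=> // q' h /=; rewrite /upd ifN ?f //.
by apply: contra h => /eqP->.
Qed.

Lemma keeps_rset qs xs s s' q v : q \in xs -> keeps qs xs s s' ->
  keeps qs xs s (set_rreg s' q v).
Proof.
move=> qin [f g]; split=> // q' h /=; rewrite /upd ifN ?g //.
by apply: contra h => /eqP->.
Qed.

Lemma holds_eq s A mu mu' : {in A, mu =1 mu'} -> holds s A mu -> holds s A mu'.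
Proof.
move=> E [h0 st sin [t [h1 h2 h3 h4]]]; split => //; exists t; split => //.
apply/allP => z zin; rewrite -E; first exact: (allP h4).
by rewrite -h3; apply/mapP; exists z.
Qed.

Lemma key_from_spec s p x : isleaf s (nreg s p) x -> p != rKB ->
  key_is (run (key_from p) s) x /\
  keeps [:: rKB] [:: xKS; xKL] s (run (key_from p) s).
Proof.
move=> [_ _ h1 h2 h3] ne; split; last first.
  by apply: keeps_nset => //; do 2 apply: keeps_rset => //.
by split; rewrite /= /upd.
Qed.

(** Left out, and hence preserved by a walk: [rAP], [rEP], [rKIND] and the cells that hold the
    request. *)
Definition walk_regs := dict_regs ++ [:: rKB; rC; rW].
Definition walk_xregs := [:: xKS; xKL; xTK].

Definition walk_body_cost : nat :=
  (maxcost walk_pick + (mark_cost + (maxcost (walk_step 0) + desc_cost)))%N.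

(** The loop invariant: [w] has been picked and marked, [k] is the current threshold, and the
    variant is the length of the remaining walk. *)
Definition walked s0 A b mu (kd : bool) K (n : nat) s : Prop :=
  [/\ ext s0 s, keeps walk_regs walk_xregs s0 s &
  exists k w, [/\ walk A b = w ++ walk A k, wend A b = wend A k,
      n = size (walk A k) & opt_ptr s (nreg s rSB) (nxt A k)] /\
    [/\ holds s A (fun x => if x \in w then kd else mu x), nreg s rC = size w &
      forall x0, (0 < K <= size w)%N -> rreg s xTK = finish (nth x0 w K.-1)]].

Lemma walk_step_spec K s x w :
  isleaf s (nreg s rW) x -> nreg s rC = size w ->
  (forall x0, (0 < K <= size w)%N -> rreg s xTK = finish (nth x0 w K.-1)) ->
  forall s', run (walk_step K) s = s' ->
  [/\ key_is s' (thr x), keeps walk_regs walk_xregs s s',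
      nreg s' rC = (size w).+1 &
      forall x0, (0 < K <= (size w).+1)%N ->
        rreg s' xTK = finish (nth x0 (rcons w x) K.-1)].
Proof.
move=> [_ _ h1 h2 h3] hc hT _ <-.
rewrite /walk_step run_set_seq run_seq run_if.
set s1 := set_nreg s rC _; set s2 := if _ then _ else _.
have Et : teval s1 (TNEq rC (ACst K)) = ((size w).+1 == K) by rewrite /= /upd /= hc addn1.
have E2 : [/\ nreg s2 = nreg s1, nheap s2 = nheap s, rheap s2 = rheap s,
    keeps walk_regs walk_xregs s s2 &
    rreg s2 xTK = if (size w).+1 == K then finish x else rreg s xTK].
  rewrite /s2 Et; have k1 : keeps walk_regs walk_xregs s s1 by apply: keeps_nset.
  case: ifP => _; last by split.
  by split => //; [apply: keeps_rset|rewrite /= /upd /= h2 h3].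
clearbody s2; have [n2 nh2 rh2 k2 T2] := E2.
have C2 : nreg s2 rC = (size w).+1 by rewrite n2 /= /upd /= hc addn1.
have W2 : nreg s2 rW = nreg s rW by rewrite n2.
split.
- by split; rewrite /= /upd /= ?rh2 ?W2 ?h2 ?h3 // opprD addrA subrr add0r.
- by apply: keeps_nset => //; do 2 apply: keeps_rset => //.
- exact: C2.
- move=> x0 /andP[K0 Kle]; rewrite /= /upd /= T2 nth_rcons.
  case: eqP => [<-|ne] /=; first by rewrite ltnn eqxx.
  have Kw : (K <= size w)%N by lia.
  by rewrite (hT x0) ?K0 ?Kw // prednK ?Kw.
Qed.

Lemma walk_body_spec s0 s A b mu (kd : bool) K n N : walked s0 A b mu kd K n s ->
  good A -> (size A <= N)%N -> nreg s0 rKIND = kd -> teval s walk_test ->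
  exists2 n', (n' < n)%N &
    wp (walk_body K) s (walk_body_cost * (hbound N).+1) (walked s0 A b mu kd K n').
Proof.
move=> [ex kp [k [w [[h1 h2 h3 h4] [h5 h6 h7]]]]] gA leN hkd.
case e : (nxt A k) h4 => [x|] /=; last by move=> ->.
move=> [ne lx] /andP[_]; have [_ _ g1 g2 g3] := lx; rewrite g2 g3.
have [xA kx _] := (nxtP k x gA).1 e.
move=> jx; have {jx}lenx : 1 <= len x.
  by apply: wfk_job (good_wfk gA xA) _; apply: contra jx => /eqP->; rewrite addr0.
have Ew : walk A k = x :: walk A (thr x) by rewrite walkE // e lenx.
exists (size (walk A (thr x))); first by rewrite h3 Ew.
apply: (@wp_weak _ _ _ (maxcost walk_pick + (mark_cost * (hbound N).+1 +
  (maxcost (walk_step K) + desc_cost * (hbound N).+1))) _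
  (walked s0 A b mu kd K (size (walk A (thr x))))) => //; last first.
  have -> : maxcost (walk_step K) = maxcost (walk_step 0) by [].
  rewrite /walk_body_cost; move: (maxcost walk_pick) mark_cost (maxcost (walk_step 0)) desc_cost (hbound N).
  by move=> a1 a2 a3 a4 h; rewrite !mulnDl !leq_add // leq_pmulr.
have sx : jlt (sen R) x.
  apply: sen_min (good_wfk gA xA) _; apply: contraTneq lenx => ->.
  by rewrite ler10.
apply: wp_seq; apply: wp_run => //; rewrite /walk_pick run_set_seq.
set s1 := set_nreg s rW _.
have [hk k2] := key_from_spec (s := s1) (p := rW) lx isT.
move: (run _ s1) hk k2 => s2 hk k2 e2.
have kp2 : keeps walk_regs walk_xregs s0 s2.
  apply: keeps_trans kp _; apply: keeps_trans (keeps_sub _ _ k2) => //.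
  exact: keeps_nset.
have [k2n k2r] := k2.
have H2 : holds s2 A (fun x => if x \in w then kd else mu x).
  by apply: holds_ext e2 _ h5; rewrite k2n.
have kd2 : nreg s2 rKIND = kd by have [f _] := kp2; rewrite f.
apply: wp_seq; apply: wp_weak (mark_spec H2 hk sx leN xA kd2) (leqnn _) _.
move=> s3 e3 [m3 H3] _; have [x3 f3] := m3.
have W3 : nreg s3 rW = nreg s rSB by rewrite f3 // k2n.
have lx3 : isleaf s3 (nreg s3 rW) x.
  by rewrite W3; apply: isleaf_ext (ext_trans e2 e3) lx.
have C3 : nreg s3 rC = size w by rewrite f3 // k2n.
have T3 x0 : (0 < K <= size w)%N -> rreg s3 xTK = finish (nth x0 w K.-1).
  by move=> h; rewrite x3 k2r //; apply: h7.
apply: wp_seq; apply: wp_run => //; move E4: (run (walk_step K) s3) => s4 e4.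
have [q1 q2 q3 q4] := walk_step_spec lx3 C3 T3 E4.
have kp4 : keeps walk_regs walk_xregs s0 s4.
  apply: keeps_trans kp2 _; apply: keeps_trans q2.
  exact: keeps_sub (same_keeps m3).
have H4 : holds s4 A (fun y => if y == x then kd else if y \in w then kd else mu y).
  by apply: holds_ext e4 _ H3; rewrite -E4 /=; case: ifP.
have nth_sen : ~~ jlt (thr x) (sen R).
  rewrite thr_lt ?sen_wfk // -ltNge /=; have /andP[sx0 _] := good_wfk gA xA.
  exact: le_lt_trans sx0 (start_finish lenx).
apply: wp_weak (lookup_spec H4 q1 nth_sen leN) (leqnn _) _.
move=> s5 e5 [H5 m5 o5 _ _]; have [x5 f5] := m5.
split.
- exact: ext_trans ex (ext_trans e2 (ext_trans e3 (ext_trans e4 e5))).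
- by apply: keeps_trans kp4 _; apply: keeps_sub (same_keeps m5).
exists (thr x), (rcons w x); split; split => //.
- by rewrite h1 Ew cat_rcons.
- by rewrite h2 (wendE gA e lenx).
- apply: holds_eq H5 => y _; rewrite mem_rcons inE.
  by case: (y == x); case: (y \in w).
- by rewrite f5 // q3 size_rcons.
- by move=> x0; rewrite size_rcons x5; apply: q4.
Qed.

Definition walk_cost : nat :=
  (maxcost (walk_start 0) + (desc_cost + (bcost (tcomp walk_test) + walk_body_cost).+1))%N.

Definition walk_post s0 A b mu (kd : bool) K s : Prop :=
  [/\ keeps walk_regs walk_xregs s0 s,
      holds s A (fun x => if x \in walk A b then kd else mu x),
      nreg s rC = size (walk A b), opt_ptr s (nreg s rSB) (wend A b) &
      forall x0, (0 < K <= size (walk A b))%N ->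
        rreg s xTK = finish (nth x0 (walk A b) K.-1)].

Lemma walk_spec s A b mu (kd : bool) K p n N : good A -> (size A <= N)%N ->
  holds s A mu -> p \in [:: rAP; rEP] -> isleaf s (nreg s p) b -> wfk b ->
  nreg s rKIND = kd -> (size (walk A b) <= n)%N ->
  wp (walk_code K p) s (walk_cost * (hbound N).+1 * n.+1)
    (walk_post s A b mu kd K).
Proof.
move=> gA leN H pin lb wb hkd len_.
have pp : loopfree (walk_start p) /\ p != rKB /\ maxcost (walk_start p) = maxcost (walk_start 0).
  by move: pin; rewrite !inE => /orP[]/eqP->.
have [lf [pk mc]] := pp.
apply: (@wp_weak _ _ _ (maxcost (walk_start p) + (desc_cost * (hbound N).+1 +
  (n.+1 * (bcost (tcomp walk_test) + walk_body_cost * (hbound N).+1).+1))) _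
  (walk_post s A b mu kd K)) => //; last first.
  rewrite mc /walk_cost; move: (maxcost _) desc_cost (bcost _) walk_body_cost (hbound N).
  move=> a1 a2 a3 a4 h; rewrite !mulnDl !leq_add //.
  - by rewrite -mulnA leq_pmulr // muln_gt0.
  - by rewrite leq_pmulr.
  - rewrite [X in (X <= _)%N]mulnC leq_mul2r; apply/orP; right.
    by rewrite mulSn mulnDl; have := leq_pmulr a3 (ltn0Sn h); lia.
apply: wp_seq; apply: wp_run => //; rewrite /walk_start run_seq run_set.
have [hk k1] := key_from_spec lb pk.
have e1 : ext s (run (key_from p) s).
  suff lf' : loopfree (key_from p) by have [] := exec_run s lf'.
  by move: pin; rewrite !inE => /orP[]/eqP->.
move: (run _ s) hk k1 e1 => s1 hk k1 e1; set s2 := set_nreg s1 rC _ => _.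
have e2 : ext s s2 by apply: ext_trans e1 (ext_set_nreg _ _ _).
have k2 : keeps walk_regs walk_xregs s s2.
  by apply: keeps_nset => //; apply: keeps_sub k1.
have H2 : holds s2 A mu.
  by apply: holds_ext e2 _ H; have [f _] := k1; rewrite /= /upd /= f.
have nsen : ~~ jlt b (sen R).
  have [->|ne] := eqVneq b (sen R); first by rewrite jlt_irr.
  by apply/negP; apply: jlt_asym; apply: sen_min.
apply: wp_seq; apply: wp_weak (lookup_spec H2 (k := b) hk nsen leN) (leqnn _) _.
move=> s3 e3 [H3 m3 o3 _ _] _; have [x3 f3] := m3.
have W : walked s A b mu kd K (size (walk A b)) s3.
  split; first exact: ext_trans e3.
    by apply: keeps_trans k2 _; apply: keeps_sub (same_keeps m3).
  exists b, [::]; split; split => //; first by rewrite f3.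
  by move=> x0 /andP[K0 /=]; rewrite leqNgt K0.
have L : wp (CWhile walk_test (walk_body K)) s3 ((size (walk A b)).+1 *
    (bcost (tcomp walk_test) + walk_body_cost * (hbound N).+1).+1)
    (walk_post s A b mu kd K).
  apply: (wp_while (I := walked s A b mu kd K)) => //.
    by move=> k s' Ws' tv; apply: walk_body_spec Ws' _ _ _ tv.
  move=> k s' [ex kp [k' [w [[h1 h2 _ h4] [h5 h6 h7]]]]] tv.
  have w0 : walk A k' = [::].
    rewrite walkE //; case e : (nxt A k') h4 => [x|//] /= [ne [_ _ _ g2 g3]].
    move: tv; rewrite /= negb_and !negbK (introF eqP ne) /= g2 g3.
    rewrite -subr_eq0 addrAC subrr add0r => bx.
    by rewrite border_job.
  rewrite w0 cats0 in h1; rewrite -h1 in h5 h6 h7.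
  by split => //; rewrite h2 wend0.
by apply: wp_weak L _ _ => //; rewrite leq_mul2r ltnS len_ orbT.
Qed.

End Walking.

(** * Update of one region: change, merge, split *)

Definition key_input : code :=
  CSetR xKS (XReg 0) ;; CSetR xKL (XReg 1) ;; rKB ::= 0%N.

Definition find_region : code := rAP ::= rPB ;; rKIND ::= ACst 0.

(** The old marks are cleared before the change, since afterwards the old walk could no longer be
    retraced. The second walk, still with mark 0, only counts the new schedule and finds the end of
    the region. *)
Definition modify_code (K : nat) (c : code) : code :=
  key_input ;; desc_code ;; find_region ;; walk_code K rAP ;;
  key_input ;; c ;; walk_code K rAP.

Definition merge_test (K : nat) : test :=
  TAnd (TNot (TNLe (ACst K) rC)) (TNot (TNEq rEP (ACst 0))).

(** The next region is cleared while its border still exists; the merged region receives its marks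
    from the walk in [split_code]. *)
Definition merge_code (K : nat) : code :=
  rEP ::= rSB ;;
  CIf (merge_test K) (walk_code K rEP ;; key_from rEP ;; delete_code) CSkip.

Definition split_test (K : nat) : test := TNLe rC (ACst K.*2).

Definition split_key : code :=
  CSetR xKS (XReg xTK) ;; CSetR xKL (XSub (XReg xKS) (XReg xKS)) ;;
  rKB ::= ACst 0 ;; rKIND ::= ACst 0.

Definition split_code (K : nat) : code :=
  rKIND ::= ACst 1 ;; walk_code K rAP ;;
  CIf (split_test K) CSkip (split_key ;; insert_code).

Definition update_code (K : nat) (c : code) : code :=
  modify_code K c ;; merge_code K ;; split_code K.

Section Updating.
Variable R : realType.
Implicit Types (s : state R) (x y k a b e j : job R) (A : seq (job R)).

Lemma border_isleaf s p a : isleaf s 0 (sen R) -> border_ptr s p a -> isleaf s p a.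
Proof. by rewrite /border_ptr => h0; case: eqP => [-> ->|]. Qed.

Definition input_is s j : Prop :=
  [/\ rreg s 0 = start j, rreg s 1 = len j & nreg s 0 = label j].

Lemma key_input_spec s j : input_is s j ->
  let s' := run key_input s in
  [/\ key_is s' j, keeps [:: rKB] [:: xKS; xKL] s s' & ext s s'].
Proof.
move=> [h1 h2 h3] s'; split.
- by split; rewrite /= /upd /=.
- by apply: keeps_nset => //; do 2 apply: keeps_rset => //.
- by have [] := exec_run (c := key_input) s isT.
Qed.

Lemma keeps_input s s' j : keeps walk_regs walk_xregs s s' -> input_is s j ->
  input_is s' j.
Proof. by move=> [f g] [h1 h2 h3]; split; rewrite ?f ?g. Qed.

(** What insertion and deletion have in common, so that both updates are handled by one proof. The
    premise on [mu j] suits insertion, which gives the new job mark 0. *)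
Definition modifies (c : code) (cost N : nat) A j (D : seq (job R) -> Prop) : Prop :=
  forall s mu, holds s A mu -> key_is s j -> nreg s rKIND = 0%N ->
  (j \notin A -> mu j = false) ->
  wp c s (cost * (hbound N).+1) (fun s' => same_regs dict_regs s s' /\
    exists2 A', D A' & holds s' A' mu).

(** Between the stages the region of [a] carries no marks. The bound [n] on its walk is 2K + 1 after
    the change and 3K after a possible merge. *)
Definition midway s K N a A (n : nat) : Prop :=
  [/\ semiK K A a, (size (walk A a) <= n)%N, (size A <= N)%N,
      holds s A (marks_but A a) & isleaf s (nreg s rAP) a].

Definition same_jobs A A' : Prop :=
  forall x, 1 <= len x -> (x \in A) = (x \in A').

Definition modify_cost (cost : nat) : nat :=
  (maxcost key_input + (desc_cost + (maxcost find_region + (walk_cost +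
   (maxcost key_input + (cost + walk_cost))))))%N.

Lemma good_cons A A' j : sorted (@jlt R) A' -> good A -> wfk j ->
  A' =i j :: A \/ A =i j :: A' -> good A'.
Proof.
move=> st gA wj AA'; rewrite /good st; apply/allP => x xA'.
case: AA' => h; last by apply: good_wfk gA _; rewrite h inE xA' orbT.
by move: xA'; rewrite h inE => /orP[/eqP->//|]; apply: good_wfk gA.
Qed.

(** The factor 3K + 1 bounds the loop tests of every walk in an update, so all stages share it. The
    strict bound on the size of [A] leaves room for an inserted job. *)
Lemma modify_spec K c cost N s A j D : (0 < K)%N ->
  (forall A', D A' -> A' =i j :: A \/ A =i j :: A') ->
  modifies c cost N A j D -> invK K A -> holds s A (marks A) ->
  input_is s j -> wfk j -> 1 <= len j -> (size A < N)%N ->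
  let a := lastb [seq y <- A | jlt y j] in
  wp (modify_code K c) s
    (modify_cost cost * (hbound N).+1 * (K + K.*2).+1)
    (fun s' => exists A', [/\ D A',
       midway s' K N a A' K.*2.+1, nreg s' rKIND = 0%N,
       nreg s' rC = size (walk A' a) & opt_ptr s' (nreg s' rSB) (wend A' a)]).
Proof.
move=> K0 DA md iA H hin wj lj ltN a; have [gA sA HA] := iA.
have leN := ltnW ltN; pose h := (hbound N).+1; pose M := (K + K.*2).+1.
have [aB aj amax] := lastbP gA sA wj lj; rewrite -/a in aB aj amax.
have wa : wfk a by move: aB; rewrite mem_borders => /andP[/(good_wfk gA)].
have js : jlt (sen R) j by apply: sen_min => //; apply: contraTneq lj => ->; rewrite ler10.
have js' : ~~ jlt j (sen R) by apply/negP => /(jlt_asym js).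
apply: (@wp_weak _ _ _ (maxcost key_input + (desc_cost * h + (maxcost find_region +
  (walk_cost * h * M + (maxcost key_input + (cost * h + walk_cost * h * M)))))) _ _ _);
  last by move=> s' _; exact: id.
  apply: wp_seq; apply: wp_run => //; have [hk k1 _] := key_input_spec hin.
  move: (run _ s) hk k1 => s1 hk1 k1 e1.
  have H1 : holds s1 A (marks A) by apply: holds_ext e1 _ H; have [f _] := k1; rewrite f.
  apply: wp_seq; apply: wp_weak (lookup_spec H1 hk1 js' leN) (leqnn _) _.
  move=> s2 e2 [H2 m2 _ pb2 _] _; rewrite -/a in pb2.
  apply: wp_seq; apply: wp_run => //; rewrite /find_region run_set_seq run_set.
  set s3 := set_nreg _ _ _ => e3.
  have k13 : keeps (rAP :: rKIND :: walk_regs) walk_xregs s s3.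
    do 2 apply: keeps_nset => //; apply: keeps_trans (keeps_sub _ _ k1) _ => //.
    exact: keeps_sub (same_keeps m2).
  have in3 : input_is s3 j.
    by have [f g] := k13; have [i1 i2 i3] := hin; split; rewrite ?f ?g.
  have ap3 : isleaf s3 (nreg s3 rAP) a.
    by apply: isleaf_ext e3 _; apply: border_isleaf pb2; case: H2.
  have H3 : holds s3 A (marks A) by apply: holds_ext e3 _ H2.
  have sz1 : (size (walk A a) <= K + K.*2)%N.
    by apply: leq_trans (leq_addl _ _); case: (HA a aB).
  have W3 := walk_spec K gA leN H3 (p := rAP) isT ap3 wa (kd := false) erefl sz1.
  apply: wp_seq; apply: wp_weak W3 (leqnn _) _.
  move=> s4 e4 [k4 H4 _ _ _] _.
  have in4 := keeps_input k4 in3.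
  apply: wp_seq; apply: wp_run => //; have [hk5 k5 _] := key_input_spec in4.
  move: (run _ s4) hk5 k5 => s5 hk5 k5 e5.
  have k45 : keeps walk_regs walk_xregs s3 s5.
    by apply: keeps_trans k4 (keeps_sub _ _ k5).
  have H5 : holds s5 A (fun x => if x \in walk A a then false else marks A x).
    by apply: holds_ext e5 _ H4; have [f _] := k5; rewrite f.
  have kd5 : nreg s5 rKIND = 0%N by have [f _] := k45; rewrite f.
  have mu5 : j \notin A -> (if j \in walk A a then false else marks A j) = false.
    by move=> nj; case: ifP => // _; apply/negbTE; apply: contra nj => /(marks_in gA)[].
  apply: wp_seq; apply: wp_weak (md s5 _ H5 hk5 kd5 mu5) (leqnn _) _.
  move=> s6 e6 [m6 [A' DA' H6]] _; have AA' := DA A' DA'; have [_ st' sA' _] := H6.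
  have gA' := good_cons st' gA wj AA'.
  have leN' : (size A' <= N)%N.
    apply: leq_trans ltN; rewrite -[(size A).+1]/(size (j :: A)).
    apply: uniq_leq_size => [|x xA'].
      exact: (sorted_uniq (@jlt_trans R) (@jlt_irr R)).
    case: AA' => hh; first by rewrite -hh.
    by rewrite inE hh inE xA' !orbT.
  have [sK szA'] := update_semi gA gA' lj AA' aB aj amax iA sA'.
  have k36 : keeps walk_regs walk_xregs s3 s6.
    by apply: keeps_trans k45 (keeps_sub _ _ (same_keeps m6)).
  have [f36 _] := k36.
  have ap6 : isleaf s6 (nreg s6 rAP) a.
    by rewrite f36 //; apply: isleaf_ext (ext_trans e4 (ext_trans e5 e6)) ap3.
  have kd6 : nreg s6 rKIND = false by rewrite f36.
  have sz6 : (size (walk A' a) <= K + K.*2)%N.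
    by apply: leq_trans szA' _; move: K0; clear; lia.
  apply: wp_weak (walk_spec K gA' leN' H6 (p := rAP) isT ap6 wa kd6 sz6) (leqnn _) _.
  move=> s7 e7 [k7 H7 c7 o7 _]; have [f7 _] := k7.
  exists A'; split => //; last by rewrite f7.
  split => //.
    apply: holds_eq H7 => x _; rewrite -(update_marks gA gA' lj AA' aB aj amax x).
    by case: (x \in walk A' a); case: (x \in walk A a); rewrite ?andbF ?andbT.
  by rewrite f7 //; apply: isleaf_ext e7 ap6.
rewrite /modify_cost -/h -/M; have h0 : (0 < h)%N by []; have M0 : (0 < M)%N by [].
move: h M h0 M0 (maxcost key_input) desc_cost (maxcost find_region) walk_cost.
clear => h M h0 M0 a1 a2 a3 a4; rewrite !mulnDl !leq_add // -?mulnA ?leq_pmulr ?muln_gt0 ?h0 //.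
all: by rewrite leq_mul2l leq_pmulr ?orbT.
Qed.

Definition merge_cost : nat :=
  (maxcost (rEP ::= rSB) + ((bcost (tcomp (merge_test 0))).+1 + (walk_cost +
    (maxcost (key_from rEP) + delete_cost))))%N.

Lemma merge_spec K N s A a : (0 < K)%N ->
  midway s K N a A K.*2.+1 -> nreg s rKIND = 0%N ->
  nreg s rC = size (walk A a) -> opt_ptr s (nreg s rSB) (wend A a) ->
  wp (merge_code K) s (merge_cost * (hbound N).+1 * (K + K.*2).+1)
    (fun s' => exists A', [/\ same_jobs A A', midway s' K N a A' (K + K.*2) &
       forall u, u \in borders A' -> jlt a u -> (K <= size (walk A' a))%N]).
Proof.
move=> K0 [sK sz leN H ap] kd hc ho; have [gA sA aB HA] := sK.
pose h := (hbound N).+1; pose M := (K + K.*2).+1.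
have wa : wfk a by move: aB; rewrite mem_borders => /andP[/(good_wfk gA)].
apply: (@wp_weak _ _ _ (maxcost (rEP ::= rSB) + (bcost (tcomp (merge_test K)) +
  (walk_cost * h * M + (maxcost (key_from rEP) + delete_cost * h))).+1) _ _ _);
  last by move=> s' _; exact: id.
  apply: wp_seq; apply: wp_run => //; rewrite run_set; set s1 := set_nreg _ _ _ => e1.
  have H1 : holds s1 A (marks_but A a) by apply: holds_ext e1 _ H.
  have ap1 : isleaf s1 (nreg s1 rAP) a by apply: isleaf_ext e1 ap.
  have tE : teval s1 (merge_test K) = (size (walk A a) < K)%N && (nreg s rSB != 0%N).
    by rewrite /= /upd /= hc -ltnNge.
  apply: wp_if => //; rewrite tE; last first.
    (* Without a merge, either the region already has [K] jobs or, by [wendP], no border follows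
       it. *)
    move=> nt; apply: wp_run => //.
    exists A; split => //.
      by split => //; apply: leq_trans sz _; move: K0; clear; lia.
    move=> u uB au; move: nt; rewrite negb_and -leqNgt negbK => /orP[//|/eqP e0].
    have := wendP a gA; move: ho; case: (wend A a) => [e [//]|_].
    by move: uB; rewrite mem_borders => /andP[uA bu] /(_ u uA bu); rewrite au.
  move=> /andP[lt /eqP ne]; move: ho; case we : (wend A a) => [e|//] [_ le].
  have := wendP a gA; rewrite we => -[eA be ae emin].
  have eB : e \in borders A by rewrite mem_borders eA.
  have ea : e != a by apply: contraTneq ae => ->; rewrite jlt_irr.
  have we' := good_wfk gA eA.
  have es : e != sen R.
    apply: contraTneq ae => ->; have [->|na] := eqVneq a (sen R); first by rewrite jlt_irr.
    by apply/negP; apply: jlt_asym; apply: sen_min.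
  have ep1 : isleaf s1 (nreg s1 rEP) e by apply: isleaf_ext e1 le.
  have sze : (size (walk A e) <= K + K.*2)%N.
    by apply: leq_trans (leq_addl _ _); case: (HA e eB ea).
  have kd1 : nreg s1 rKIND = false by [].
  apply: wp_seq; apply: wp_weak (walk_spec K gA leN H1 (p := rEP) isT ep1 we' kd1 sze) (leqnn _) _.
  move=> s2 e2 [k2 H2 _ _ _] _; have [f2 _] := k2.
  have ep2 : isleaf s2 (nreg s2 rEP) e by rewrite f2 //; apply: isleaf_ext e2 ep1.
  apply: wp_seq; apply: wp_run => //; have [hk3 k3] := key_from_spec ep2 (p := rEP) isT.
  move: (run _ s2) hk3 k3 => s3 hk3 k3 e3; have [f3 _] := k3.
  have H3 : holds s3 A (fun x => if x \in walk A e then false else marks_but A a x).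
    by apply: holds_ext e3 _ H2; rewrite f3.
  apply: wp_weak (delete_spec H3 hk3 (sen_min we' es) leN eA) (leqnn _) _.
  move=> s4 e4 [m4 [A' EA' H4]]; have [_ st' sA' _] := H4; have [_ f4] := m4.
  have AA' : A =i e :: A'.
    by move=> x; rewrite inE EA' inE; have [->|_] := eqVneq x e; rewrite ?eA ?andbT.
  have nA' : e \notin A' by rewrite EA' inE eqxx andbF.
  have gA' : good A' by apply: good_cons st' gA we' (or_intror AA').
  have [sK' sz' lo'] := merge_semi sK gA' nA' AA' we sA' lt.
  exists A'; split => //.
    by move=> x lx; rewrite AA' inE eq_sym (negPf (border_neq_job be lx)).
  split => //.
  - apply: leq_trans leN; apply: uniq_leq_size => [|x xA'].
      exact: (sorted_uniq (@jlt_trans R) (@jlt_irr R)).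
    by rewrite AA' inE xA' orbT.
  - apply: holds_eq H4 => x _; rewrite -(merge_marks sK gA' nA' AA' we x) andbC.
    by case: (x \in walk A e).
  - rewrite f4 // f3 // f2 //.
    exact: isleaf_ext (ext_trans e2 (ext_trans e3 e4)) ap1.
have -> : bcost (tcomp (merge_test K)) = bcost (tcomp (merge_test 0)) by [].
rewrite /merge_cost -/h -/M -addSn; have h0 : (0 < h)%N by []; have M0 : (0 < M)%N by [].
move: h M h0 M0 (maxcost (rEP ::= rSB)) (bcost _).+1%N walk_cost (maxcost (key_from rEP)) delete_cost.
clear => h M h0 M0 a1 a2 a3 a4 a5; rewrite !mulnDl !leq_add // -?mulnA ?leq_pmulr ?muln_gt0 ?h0 //.
by rewrite leq_mul2l leq_pmulr ?orbT.
Qed.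

Definition split_cost : nat :=
  (maxcost (rKIND ::= ACst 1) + (walk_cost + ((bcost (tcomp (split_test 0))).+1 +
    (maxcost split_key + insert_cost))))%N.

Lemma split_spec K N s A a : (0 < K)%N ->
  midway s K N a A (K + K.*2) ->
  (forall u, u \in borders A -> jlt a u -> (K <= size (walk A a))%N) ->
  wp (split_code K) s (split_cost * (hbound N).+1 * (K + K.*2).+1)
    (fun s' => exists A', [/\ same_jobs A A', invK K A' & holds s' A' (marks A')]).
Proof.
move=> K0 [sK sz leN H ap] lo; have [gA sA aB HA] := sK.
pose h := (hbound N).+1; pose M := (K + K.*2).+1.
have wa : wfk a by move: aB; rewrite mem_borders => /andP[/(good_wfk gA)].
apply: (@wp_weak _ _ _ (maxcost (rKIND ::= ACst 1) + (walk_cost * h * M +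
  (bcost (tcomp (split_test K)) + (maxcost split_key + insert_cost * h)).+1)) _ _ _);
  last by move=> s' _; exact: id.
  apply: wp_seq; apply: wp_run => //; rewrite run_set; set s1 := set_nreg _ _ _ => e1.
  have H1 : holds s1 A (marks_but A a) by apply: holds_ext e1 _ H.
  have ap1 : isleaf s1 (nreg s1 rAP) a by apply: isleaf_ext e1 ap.
  have kd1 : nreg s1 rKIND = true by [].
  apply: wp_seq; apply: wp_weak (walk_spec K gA leN H1 (p := rAP) isT ap1 wa kd1 sz) (leqnn _) _.
  move=> s2 e2 [k2 H2 c2 _ T2] _.
  have {}H2 : holds s2 A (marks A).
    apply: holds_eq H2 => x _; rewrite (marks_butE x gA aB).
    by case: (x \in walk A a); rewrite ?orbT ?orbF.
  have tE : teval s2 (split_test K) = (size (walk A a) <= K.*2)%N by rewrite /= c2.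
  apply: wp_if => //; rewrite tE.
    move=> le; apply: wp_run => //; exists A; split => //.
    exact: semi_inv sK le lo.
  rewrite -ltnNge => lt; pose x0 := sen R.
  have TK : rreg s2 xTK = finish (nth x0 (walk A a) K.-1).
    by apply: T2; rewrite K0 /=; move: lt; clear; lia.
  apply: wp_seq; apply: wp_run => //.
  pose z := border_at (finish (nth x0 (walk A a) K.-1)).
  have hk3 : key_is (run split_key s2) z.
    by split; rewrite /= /upd /= ?TK ?subrr.
  have r3 : nreg (run split_key s2) rROOT = nreg s2 rROOT by [].
  have kd3 : nreg (run split_key s2) rKIND = 0%N by [].
  move: (run split_key s2) hk3 r3 kd3 => s3 hk3 r3 kd3 e3.
  have H3 : holds s3 A (marks A) by apply: holds_ext e3 _ H2.
  have win : nth x0 (walk A a) K.-1 \in walk A a.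
    by apply: mem_nth; apply: leq_ltn_trans lt; move: K0; clear; lia.
  have [xA lx ax] := walk_in gA win; have wx := good_wfk gA xA.
  have /andP[x0' _] := wx.
  have z0 : 0 < start z by apply: le_lt_trans x0' (start_finish lx).
  have wz : wfk z by rewrite /wfk (ltW z0) /= !eqxx orbT.
  have zs : z != sen R by apply: contraTneq z0 => ->; rewrite ltxx.
  have bz : border z by rewrite /border.
  have nz : z \notin A.
    apply/negP => zA; have zB : z \in borders A by rewrite mem_borders zA.
    (* otherwise the walk would have stopped at [z] *)
    have az : jlt a z.
      have ba : border a by move: aB; rewrite mem_borders => /andP[].
      rewrite jlt_borders // /z /=; apply: le_lt_trans (start_finish lx).
      by rewrite -jlt_border_job.
    have ylt : (K < size (walk A a))%N by apply: leq_ltn_trans lt; clear; lia.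
    have yin : nth x0 (walk A a) K \in walk A a by apply: mem_nth.
    have [yA ly _] := walk_in gA yin; have := walk_border gA yin zA bz az.
    have /(pairwiseP x0)/(_ K.-1 K) := walk_chain a gA.
    rewrite !inE prednK // leqnn ylt (ltnW ylt) => /(_ isT isT isT) xy.
    by rewrite leNgt /z /= (le_lt_trans xy (start_finish ly)).
  (* The border is inserted with mark 0, which agrees with [marks A] because only keys of [A] are
     marked. *)
  have mz : nreg s3 rKIND = marks A z.
    rewrite kd3; case mz : (marks A z) => //.
    by have [zA] := marks_in gA mz; rewrite (negPf nz) in zA.
  apply: wp_weak (insert_spec H3 hk3 (sen_min wz zs) leN nz mz) (leqnn _) _.
  move=> s4 e4 [m4 [B EB H4]]; have [_ stB sB _] := H4.
  have gB : good B by apply: good_cons stB gA wz (or_introl EB).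
  exists B; split.
  - by move=> x lx'; rewrite EB inE eq_sym (negPf (border_neq_job bz lx')).
  - exact: (split_inv sK K0 gB lt sz (x0 := x0) erefl EB).
  - by apply: holds_eq H4 => x _; rewrite (split_marks sK K0 gB lt sz (x0 := x0) erefl EB).
have -> : bcost (tcomp (split_test K)) = bcost (tcomp (split_test 0)) by [].
rewrite /split_cost -/h -/M -addSn; have h0 : (0 < h)%N by []; have M0 : (0 < M)%N by [].
move: h M h0 M0 (maxcost (rKIND ::= ACst 1)) walk_cost (bcost _).+1%N (maxcost split_key) insert_cost.
clear => h M h0 M0 a1 a2 a3 a4 a5; rewrite !mulnDl !leq_add // -?mulnA ?leq_pmulr ?muln_gt0 ?h0 //.
by rewrite leq_mul2l leq_pmulr ?orbT.
Qed.

Definition update_cost (cost : nat) : nat :=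
  (modify_cost cost + (merge_cost + split_cost))%N.

Lemma update_spec K c cost N s A j D : (0 < K)%N ->
  (forall A', D A' -> A' =i j :: A \/ A =i j :: A') ->
  modifies c cost N A j D -> invK K A -> holds s A (marks A) ->
  input_is s j -> wfk j -> 1 <= len j -> (size A < N)%N ->
  wp (update_code K c) s (update_cost cost * (hbound N).+1 * (K + K.*2).+1)
    (fun s' => exists A' A'', [/\ D A', same_jobs A' A'',
       invK K A'' & holds s' A'' (marks A'')]).
Proof.
move=> K0 DA md iA H hin wj lj ltN; pose h := (hbound N).+1; pose M := (K + K.*2).+1.
apply: (@wp_weak _ _ _ (modify_cost cost * h * M +
  (merge_cost * h * M + split_cost * h * M)) _ _ _); last by move=> s' _; exact: id.
  apply: wp_seq; apply: wp_weak (modify_spec K0 DA md iA H hin wj lj ltN) (leqnn _) _.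
  move=> s1 _ [A' [AA' mid kd hc ho]] _.
  apply: wp_seq; apply: wp_weak (merge_spec K0 mid kd hc ho) (leqnn _) _.
  move=> s2 _ [A1 [sj mid1 lo]] _.
  apply: wp_weak (split_spec K0 mid1 lo) (leqnn _) _.
  move=> s3 _ [A2 [sj2 iA2 H2]]; exists A', A2; split => //.
  by move=> x lx; rewrite sj // sj2.
rewrite /update_cost -/h -/M; move: (modify_cost cost) merge_cost split_cost h M.
by clear => a1 a2 a3 h M; rewrite !mulnDl.
Qed.

End Updating.

(** * The algorithm *)

Definition member_out : code :=
  CSel 0 (TAnd (TNot (key_lt rCUR))
    (TAnd (TNot (lt_key rCUR)) (TNEq (cnm rCUR) (ACst 1)))) (ACst 1) (ACst 0).

Definition member_code : code := key_input ;; desc_code ;; member_out.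

Definition value_code : code := 0%N ::= cnm rROOT.

Definition algorithm (K : nat) : dynamic_algorithm := DynamicAlgorithm
  (compile (update_code K insert_code)) (compile (update_code K delete_code))
  (compile member_code) (compile value_code).

(** For n jobs the tree has at most 2n + 1 keys; the bound 2n + 3 on the keys leaves room for an
    insertion. *)
Definition update_time (K n : nat) : nat :=
  ((update_cost insert_cost + update_cost delete_cost) *
   (hbound (n.*2 + 3)).+1 * (K + K.*2).+1)%N.

Definition query_cost : nat :=
  (maxcost key_input + (desc_cost + (maxcost member_out + maxcost value_code)))%N.

Definition query_time (n : nat) : nat := (query_cost * (hbound (n.*2 + 3)).+1)%N.

(** * From the programs to the requests *)

Section Assembly.
Variables (R : realType) (K : nat).
Hypothesis K0 : (0 < K)%N.
Implicit Types (s : state R) (m : memory R) (J : {fset job R}) (A : seq (job R)).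

Fixpoint decode s (n p : nat) : seq (job R * bool) :=
  if n is n'.+1 then
    if nheap s (0 + p) == 0%N then
      [:: (Job (nheap s (1 + p)) (rheap s (0 + p)) (rheap s (1 + p)),
           nheap s (6 + p) == 1%N)]
    else decode s n' (nheap s (1 + p)) ++ decode s n' (nheap s (2 + p))
  else [::].

Lemma rep_decode s p t n : rep s p t -> (height t < n)%N -> decode s n p = leaves t.
Proof.
elim: t p n => [x b|l IHl r IHr] p [//|n] /= [_].
  move=> [[_ -> -> -> ->] [_ _ _ ->]] _ /=; congr [:: (_, _)]; last by case: b.
  exact: job_eq.
move=> [-> rl rr _] lt /=; rewrite (IHl _ n) ?(IHr _ n) //; lia.
Qed.

(** [fully_dynamic] asks for a function of the memory alone, so the tree is decoded, with the height
    stored at the root as fuel. *)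
Definition sol m : {fset job R} :=
  let s := state_of m in let p := nreg s rROOT in
  seq_fset tt [seq z.1 | z <- decode s (nheap s (0 + p)).+1 p & z.2].

Lemma holds_sol m A mu : holds (state_of m) A mu ->
  forall x, (x \in sol m) = (x \in A) && mu x.
Proof.
move=> [_ _ _ [t [rt _ kt mt]]] x; rewrite /sol seq_fsetE.
have [[-> _ _ _] _] := rep_fields rt; rewrite (rep_decode rt) //.
apply/mapP/andP => [[[y b]]|].
  rewrite mem_filter /= => /andP[hb yin] ->; have /= /eqP <- := allP mt _ yin.
  by split => //; rewrite -kt; apply/mapP; exists (y, b).
move=> [xA mx]; move: xA; rewrite -kt => /mapP[[y b] yin /= e].
exists (y, b) => //; rewrite mem_filter yin andbT /=.
by have /= /eqP -> := allP mt _ yin; rewrite -e.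
Qed.

Definition valid m J : Prop :=
  exists A, [/\ holds (state_of m) A (marks A), invK K A &
    forall x, (x \in J) = (x \in A) && (1 <= len x)].

Lemma valid_sol m J A : holds (state_of m) A (marks A) -> invK K A ->
  (forall x, (x \in J) = (x \in A) && (1 <= len x)) -> sol m = marked A J.
Proof.
move=> H [gA _ _] JA; apply/fsetP => x; rewrite (holds_sol H) !inE JA.
case mx : (marks A x); rewrite ?andbF // !andbT.
by have [-> ->] := marks_in gA mx.
Qed.

(** [state_of (mem_of s)] may differ from [s] in registers from [nregs] on, but not in anything that
    [holds] reads. *)
Lemma holds_state_of s A mu : holds s A mu -> holds (state_of (mem_of s)) A mu.
Proof.
apply: holds_ext => //; split => //= a _; rewrite /nregs.
by rewrite !addKn.
Qed.

Lemma insert_modifies N A j : jlt (sen R) j -> (size A <= N)%N -> j \notin A ->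
  modifies insert_code insert_cost N A j (fun A' => A' =i j :: A).
Proof.
move=> js leN nj s mu H hk kd mj.
have kd' : nreg s rKIND = mu j by rewrite kd mj.
apply: wp_weak (insert_spec H hk js leN nj kd') (leqnn _) _ => s' _ [sm [A' E H']].
by split => //; exists A'.
Qed.

Lemma delete_modifies N A j : jlt (sen R) j -> (size A <= N)%N -> j \in A ->
  modifies delete_code delete_cost N A j (fun A' => A' =i [pred y in A | y != j]).
Proof.
move=> js leN jA s mu H hk kd _.
apply: wp_weak (delete_spec H hk js leN jA) (leqnn _) _ => s' _ [sm [A' E H']].
by split => //; exists A'.
Qed.

Definition put_state s (j : job R) : state R :=
  set_rreg (set_rreg (set_nreg s 0 (label j)) 0 (start j)) 1 (len j).

Lemma put_jobE m j : put_job m j = mem_of (put_state (state_of m) j).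
Proof. by rewrite /put_job -{1}(state_ofK m) mem_set_nreg // !mem_set_rreg. Qed.

Lemma put_state_spec s j A mu : holds s A mu ->
  input_is (put_state s j) j /\ holds (put_state s j) A mu.
Proof. by move=> H; split; [split|apply: holds_ext H]. Qed.

Lemma blank_valid : valid (blank R) fset0.
Proof.
have gA : good [:: sen R] by rewrite /good /= sen_wfk.
have n0 : nxt [:: sen R] (sen R) = None by rewrite /nxt /= jlt_irr.
have w0 : walk [:: sen R] (sen R) = [::] by rewrite walkE // n0.
exists [:: sen R]; split.
- split => //; first by rewrite inE.
  exists (Leaf (sen R) false); split => //.
  + split => //; split => //; split => //=.
    by rewrite /isb eqxx andbF.
  + by rewrite /= /marks /borders /= sen_border /= w0.
- split => //; first by rewrite inE.
  move=> b; rewrite mem_borders inE => /andP[/eqP-> _]; rewrite w0; split => // u.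
  by rewrite mem_borders inE => /andP[/eqP-> _]; rewrite jlt_irr.
- by move=> x; rewrite in_fset0 inE; case: eqP => // ->; rewrite ler10.
Qed.

Lemma size_valid A J (n : nat) : invK K A ->
  (forall x, (x \in J) = (x \in A) && (1 <= len x)) ->
  (size A < (maxn #|` J| n).*2 + 3)%N.
Proof.
move=> iA JA; have := inv_size iA JA K0.
have := leq_maxl #|` J| n; move: (maxn _ _) => M h1 h2.
apply: leq_ltn_trans h2 _; rewrite addn3 ltnS leqW // ltnS leq_double //.
Qed.

Lemma update_valid m J (j : job R) c cost J' N D : valid m J ->
  wfk j -> 1 <= len j ->
  (forall A A', (forall x, (x \in J) = (x \in A) && (1 <= len x)) -> D A A' ->
     A' =i j :: A \/ A =i j :: A') ->
  (forall A, (size A <= N)%N -> invK K A ->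
     (forall x, (x \in J) = (x \in A) && (1 <= len x)) ->
     modifies c cost N A j (D A)) ->
  (forall A A', D A A' ->
     (forall x, (x \in J) = (x \in A) && (1 <= len x)) ->
     forall x, (x \in J') = (x \in A') && (1 <= len x)) ->
  (forall A, invK K A ->
     (forall x, (x \in J) = (x \in A) && (1 <= len x)) -> (size A < N)%N) ->
  exists m' t, [/\ exec (compile (update_code K c)) (put_job m j) m' t,
    (t <= update_cost cost * (hbound N).+1 * (K + K.*2).+1)%N & valid m' J'].
Proof.
move=> [A [H iA JA]] wj lj HD Hm HJ Hs; have ltN := Hs A iA JA.
have [hin H'] := put_state_spec j H.
have [s' [t [E le _ [A' [A'' [AA' sj iA'' H'']]]]]] :=
  update_spec K0 (fun A' => HD A A' JA) (Hm A (ltnW ltN) iA JA) iA H' hin wj lj ltN.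
exists (mem_of s'), t; split => //; first by rewrite put_jobE.
exists A''; split => //; first exact: holds_state_of.
move=> x; rewrite (HJ A A' AA' JA); case lx : (1 <= len x); rewrite ?andbF // !andbT.
exact: sj.
Qed.

Lemma job_ok_wfk (j : job R) : job_ok j -> wfk j.
Proof. by rewrite /job_ok /wfk => /andP[-> ->]. Qed.

Lemma member_valid m J (j : job R) : valid m J -> job_ok j ->
  exists m' t, [/\ exec (compile member_code) (put_job m j) m' t,
    (t <= query_time #|` J|)%N, valid m' J, sol m' = sol m &
    ncell m' 0 = (j \in sol m)].
Proof.
move=> [A [H iA JA]] jok; have [gA _ _] := iA.
have wj := job_ok_wfk jok; have lj : 1 <= len j by case/andP: jok.
have leN : (size A <= #|` J|.*2 + 3)%N.
  by have := size_valid 0 iA JA; rewrite maxn0 => /ltnW.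
have [hin H'] := put_state_spec j H.
have js : jlt (sen R) j by apply: sen_min => //; apply: contraTneq lj => ->; rewrite ler10.
have js' : ~~ jlt j (sen R) by apply/negP => /(jlt_asym js).
pose h := (hbound (#|` J|.*2 + 3)).+1.
have W : wp member_code (put_state (state_of m) j)
    (maxcost key_input + (desc_cost * h + maxcost member_out))
    (fun s' => holds s' A (marks A) /\ nreg s' 0 = (j \in sol m)).
  apply: wp_seq; apply: wp_run => //; have [hk k1 _] := key_input_spec hin.
  move: (run _ _) hk k1 => s1 hk k1 e1.
  have H1 : holds s1 A (marks A) by apply: holds_ext e1 _ H'; have [f _] := k1; rewrite f.
  apply: wp_seq; apply: wp_weak (lookup_spec H1 hk js' leN) (leqnn _) _.
  move=> s2 e2 [H2 [x2 f2] _ _ [x [lx xA cx xj]]] _.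
  have hk2 : key_is s2 j by have [? ? ?] := hk; split; rewrite ?x2 ?f2.
  apply: wp_run => //; split; first by apply: holds_ext (ext_set_nreg _ _ _) _ H2.
  have -> : nreg (run member_out s2) 0 = if ~~ teval s2 (key_lt rCUR) &&
      (~~ teval s2 (lt_key rCUR) && (nheap s2 (6 + nreg s2 rCUR) == 1%N)) then 1%N else 0%N.
    by [].
  rewrite (key_ltE hk2 (e := rCUR) lx) (lt_keyE hk2 (e := rCUR) lx) cx (holds_sol H).
  have [e|ne] := eqVneq x j; first by rewrite e jlt_irr /= -e xA; case: (marks A x).
  have -> : (j \in A) = false by apply/negP => /xj/eqP; rewrite (negPf ne).
  by case: ifP => // /and3P[/(jlt_total _) h1 h2 _]; rewrite h1 // eq_sym in h2.
have [s' [t [E le _ [Hs' a]]]] := W; exists (mem_of s'), t.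
have Hm := holds_state_of Hs'.
split; [by rewrite put_jobE| |by exists A| |by []].
  apply: leq_trans le _; rewrite /query_time -/h /query_cost.
  have h0 : (0 < h)%N by [].
  move: (maxcost key_input) desc_cost (maxcost member_out) (maxcost value_code).
  clearbody h; clear -h0 => a1 a2 a3 a4; rewrite !mulnDl !leq_add ?leq_pmulr //.
  by apply: leq_trans (leq_addr _ _); rewrite leq_pmulr.
by rewrite (valid_sol Hm iA JA) (valid_sol H iA JA).
Qed.

Lemma value_valid m J : valid m J ->
  exists m' t, [/\ exec (compile value_code) m m' t,
    (t <= query_time #|` J|)%N, valid m' J, sol m' = sol m &
    ncell m' 0 = #|` sol m|].
Proof.
move=> [A [H iA JA]]; have [gA _ _] := iA.
have [ex [t E le]] := exec_run (c := value_code) (state_of m) isT.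
rewrite state_ofK in E.
have H' : holds (run value_code (state_of m)) A (marks A).
  by apply: holds_ext ex _ H.
have Hm := holds_state_of H'.
exists (mem_of (run value_code (state_of m))), t; split => //.
- apply: leq_trans le _; rewrite /query_time /query_cost.
  move: (maxcost key_input) desc_cost (maxcost member_out) (maxcost value_code) (hbound _).
  clear => a1 a2 a3 a4 h; rewrite !mulnDl.
  by do 3 apply: leq_trans (leq_addl _ _); rewrite leq_pmulr.
- by exists A.
- by rewrite (valid_sol Hm iA JA) (valid_sol H iA JA).
have [_ st _ [t' [rt _ kt mt]]] := H; have [[_ _ _ ct] _] := rep_fields rt.
have -> : ncell (mem_of (run value_code (state_of m))) 0 = cnt t' by [].
rewrite /cnt -size_filter -(size_map fst); apply: esym.
have us : uniq [seq z.1 | z <- leaves t' & z.2].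
  apply: subseq_uniq (sorted_uniq (@jlt_trans R) (@jlt_irr R) st).
  by rewrite -kt; apply: map_subseq; apply: filter_subseq.
apply: perm_size; apply: uniq_perm (fset_uniq _) us _ => x.
rewrite (holds_sol H) -{1}kt; apply/andP/mapP => [[/mapP[[y b] yin /= ->] my]|[[y b]]].
  exists (y, b) => //; rewrite mem_filter yin andbT /=.
  by move: my; have /= /eqP <- := allP mt _ yin.
rewrite mem_filter /= => /andP[hb yin] ->; have /= /eqP <- := allP mt _ yin.
by split => //; apply/mapP; exists (y, b).
Qed.

Lemma request_valid m J q : valid m J -> admissible J q ->
  exists m' t, exec (prog (algorithm K) q) (input m q) m' t /\
    [/\ valid m' (update J q),
        (t <= (if is_update q then update_time K else query_time) (njobs J q))%N &
        ~~ is_update q -> sol m' = sol m /\ answers (sol m) q (ncell m' 0)].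
Proof.
move=> vm; case: q => [j|j|j|] /=.
- move=> /andP[jok nj]; have wj := job_ok_wfk jok; have lj : 1 <= len j by case/andP: jok.
  have js : jlt (sen R) j.
    by apply: sen_min => //; apply: contraTneq lj => ->; rewrite ler10.
  have [|||| m' [t [E le v]]] := @update_valid m J j insert_code insert_cost (j |` J)%fset
    ((njobs J (Insert j)).*2 + 3) (fun A A' => A' =i j :: A) vm wj lj.
  + by move=> A A' _; left.
  + move=> A leA iA JA; apply: insert_modifies => //.
    by apply: contra nj => jA; rewrite JA jA.
  + move=> A A' E JA x; rewrite in_fset1U JA E inE.
    by case: eqP => // ->; rewrite lj.
  + by move=> A iA JA; apply: size_valid.
  exists m', t; split; first exact: E.
  split; [exact: v|apply: leq_trans le _|by []].
  rewrite /update_time; move: (hbound _) (update_cost insert_cost) (update_cost delete_cost).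
  by move=> h a1 a2; rewrite !leq_mul // leq_addr.
- move=> jJ.
  have [||||||m' [t [E le v]]] := @update_valid m J j delete_code delete_cost (J `\ j)%fset
    ((njobs J (Delete j)).*2 + 3) (fun A A' => A' =i [pred y in A | y != j]) vm.
  + have [A [_ [gA _ _] JA]] := vm; move: jJ; rewrite JA => /andP[jA _].
    exact: good_wfk gA jA.
  + by have [A [_ _ JA]] := vm; move: jJ; rewrite JA => /andP[].
  + move=> A A' JA E; right => x; rewrite inE E inE; move: jJ; rewrite JA => /andP[jA _].
    by have [->|_] := eqVneq x j; rewrite ?jA ?andbT.
  + move=> A leA [gA _ _] JA; move: jJ; rewrite JA => /andP[jA lj].
    apply: delete_modifies => //; apply: sen_min; first exact: good_wfk gA jA.
    by apply: contraTneq lj => ->; rewrite ler10.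
  + by move=> A A' E JA x; rewrite in_fsetD1 JA E inE andbCA andbA.
  + by move=> A iA JA; apply: size_valid.
  exists m', t; split; first exact: E.
  split; [exact: v|apply: leq_trans le _|by []].
  rewrite /update_time; move: (hbound _) (update_cost insert_cost) (update_cost delete_cost).
  by move=> h a1 a2; rewrite !leq_mul // leq_addl.
- move=> jok; have [m' [t [E le v es a]]] := member_valid vm jok.
  exists m', t; split; first exact: E.
  by rewrite /njobs maxnn; split; [exact: v|exact: le|].
- move=> _; have [m' [t [E le v es a]]] := value_valid vm.
  exists m', t; split; first exact: E.
  by rewrite /njobs maxnn; split; [exact: v|exact: le|].
Qed.

Lemma reachable_valid m J : reachable (algorithm K) m J -> valid m J.
Proof.
elim=> [|{}m {}J q m' t _ vm ad ex]; first exact: blank_valid.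
have [m2 [t2 [ex2 [v _ _]]]] := request_valid vm ad.
by rewrite (exec_det ex ex2).
Qed.

Lemma algorithm_fully_dynamic (eps : R) : 0 < eps -> eps^-1 <= K%:R ->
  fully_dynamic (1 + eps) (update_time K) query_time (algorithm K).
Proof.
move=> e0 eK; exists sol => m J /reachable_valid vm; split.
  have [A [H iA JA]] := vm; rewrite (valid_sol H iA JA).
  exact: (@inv_approximate R K A J iA JA eps e0 eK).
move=> q ad; have [m' [t [ex [v le an]]]] := request_valid vm ad.
by exists m', t.
Qed.

End Assembly.

(** * Asymptotic running times *)

Section Bounds.
Variable R : realType.

(** For n >= 2, 2n + 3 <= n^3, so the height bound is at most 6 log2 n; the successor adds 1 <= log2
    n, whence the constant 7. *)
Lemma hbound_ln (n : nat) : (2 <= n)%N ->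
  ((hbound (n.*2 + 3)).+1)%:R <= 7 / ln 2 * ln (n%:R : R).
Proof.
move=> n2; have n0 : (0 < n%:R :> R) by rewrite ltr0n; lia.
have l2 : 0 < ln (2 : R) by rewrite ln_gt0 // ltr1n.
have l2n : ln (2 : R) <= ln n%:R by rewrite ler_ln ?posrE // ler_nat.
rewrite mulrAC ler_pdivlMr // -natr1 mulrDl mul1r.
rewrite (_ : 7 * ln n%:R = 6 * ln n%:R + ln (n%:R : R)); last first.
  by rewrite -[X in _ + X]mul1r -mulrDl natr1.
apply: lerD => //; rewrite /hbound.
have : (2 ^ trunc_log 2 ((n.*2 + 3) ^ 2) <= n ^ 6)%N.
  apply: leq_trans (trunc_logP _ _) _ => //; first by rewrite expn_gt0 addn_gt0 orbT.
  rewrite (expnM n 3 2) leq_exp2r // !expnS expn0 muln1 -muln2.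
  have : (2 * (2 * n) <= n * (n * n))%N by rewrite !leq_mul.
  lia.
move: (trunc_log _ _) => h; rewrite -(ler_nat R) !natrX => le.
have two0 : 0 < (2 : R) by rewrite ltr0n.
have p2 : 0 < (2 : R) ^+ h by exact: exprn_gt0.
have pn : 0 < (n%:R : R) ^+ 6 by exact: exprn_gt0.
rewrite -(ler_ln p2 pn) in le.
rewrite (lnXn _ two0) (lnXn _ n0) in le.
by rewrite (mulr_natl _ h) (mulr_natl _ 6).
Qed.

Lemma query_time_bound : bigO_n query_time (fun n => ln (n%:R : R)).
Proof.
rewrite /query_time; move: query_cost => C.
exists (C%:R * (7 / ln 2)) => n n2; rewrite natrM -mulrA.
by rewrite ler_wpM2l ?ler0n ?hbound_ln.
Qed.

(** The successor makes the value exceed 1 / eps and keeps it positive when eps > 1. *)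
Definition granularity (eps : R) : nat := (Num.truncn eps^-1).+1.

Lemma update_time_bound :
  bigO_eps_n (fun eps n => update_time (granularity eps) n)
    (fun eps n => ln (n%:R : R) / eps).
Proof.
rewrite /update_time; move: (update_cost insert_cost + update_cost delete_cost)%N.
move=> C E E0.
(* The number of loop tests 3K + 1 equals 3 floor(1 / eps) + 4, and 4 <= 4E / eps because eps <=
   E. *)
exists (C%:R * (7 / ln 2) * (3 + 4 * E)) => eps n e0 eE n2.
rewrite !natrM.
have ei : 0 < eps^-1 by rewrite invr_gt0.
have kb : ((granularity eps + (granularity eps).*2).+1)%:R <= (3 + 4 * E) / eps.
  have tr : (Num.truncn eps^-1)%:R <= eps^-1 by rewrite truncn_le ltW.
  have -> : (granularity eps + (granularity eps).*2).+1 = (3 * Num.truncn eps^-1 + 4)%N.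
    by rewrite /granularity -muln2; lia.
  rewrite [(3 + 4 * E) / eps]mulrDl natrD natrM; apply: lerD; first by rewrite ler_wpM2l.
  by rewrite -mulrA ler_peMr // ler_pdivlMr // mul1r.
rewrite [X in _ <= X](_ : _ = C%:R * (7 / ln 2 * ln n%:R) * ((3 + 4 * E) / eps)); last first.
  by rewrite -!mulrA; congr (_ * (_ * (_ * _))); rewrite !mulrA; congr (_ / _); rewrite mulrC.
rewrite ler_pM ?mulr_ge0 // ?ler0n // ler_wpM2l ?ler0n ?hbound_ln //.
Qed.

End Bounds.

Theorem theorem1 (R : realType) :
  exists (Tupdate : R -> nat -> nat) (Tquery : nat -> nat),
    [/\ bigO_eps_n Tupdate (fun (eps : R) (n : nat) => ln (n%:R : R) / eps),
        bigO_n Tquery (fun n : nat => ln (n%:R : R)) &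
        forall eps : R, 0 < eps ->
          exists A : dynamic_algorithm,
            fully_dynamic (1 + eps) (Tupdate eps) Tquery A].
Proof.
exists (fun eps n => update_time (granularity eps) n), query_time; split.
- exact: update_time_bound.
- exact: query_time_bound.
- move=> eps e0; exists (algorithm (granularity eps)).
  by apply: algorithm_fully_dynamic => //; apply/ltW; rewrite truncnS_gt.
Qed.
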